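(* For each $k\ge1$, the system $\Pi^1_k\text{-}\mathsf{CA}_0^\omega+\mathsf{HBU}$ proves $\Pi^1_k\text{-}\mathsf{TR}_0$.
   Context: Finite types: $0$ is the type of natural numbers, $\sigma\to\tau$ is the type of maps from type $\sigma$ objects to type $\tau$ objects; $1=0\to0$, $n+1=n\to0$. The language $L_\omega$ has variables of all finite types and constants $0,1,<_0,+_0,\times_0,=_0$, combinators and recursors; for $\tau=\tau_1\to\dots\to\tau_k\to0$, $x=_\tau y$ abbreviates $\forall z_1^{\tau_1}\dots z_k^{\tau_k}(xz_1\dots z_k=_0yz_1\dots z_k)$. $\mathsf{RCA}_0^\omega$ is the theory in classical logic with axioms: (1) $0,1,<_0,+_0,\times_0$ form an ordered semi-ring with equality $=_0$; (2) the defining axioms of the combinators $\Pi,\Sigma$ (giving $\lambda$-abstraction); (3) $\mathbf R_0(f,m,0)=m$, $\mathbf R_0(f,m,n+1)=f(n,\mathbf R_0(f,m,n))$; (4) extensionality: $x=_\rho y\to\varphi(x)=_\tau\varphi(y)$ for all $\varphi^{\rho\to\tau}$ and all types; (5) induction for quantifier-free formulas of $L_\omega$ (variables of any type allowed); (6) $\mathsf{QF\text{-}AC}^{1,0}$: $(\forall x^1)(\exists y^0)A(x,y)\to(\exists Y^{2})(\forall x^1)A(x,Y(x))$ for quantifier-free $A$. $\Pi^1_k\text{-}\mathsf{CA}_0^\omega$ is $\mathsf{RCA}_0^\omega$ plus the axiom $(\mathbf S_k^2)$: there is a functional $\mathbf S_k^2\le1$ which decides the truth or falsity of $\Sigma^1_k$-formulas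 in Kleene normal form (with quantifier-free part given by $f^1$; only function parameters are allowed). For $k=1$: $(\forall f^1)\big[(\exists g^1)(\forall n^0)(f(\overline gn)=0)\leftrightarrow\mathbf S_1(f)=0\big]$, where $\overline gn=\langle g(0),\dots,g(n-1)\rangle$; for general $k$ similarly with $k$ alternating quantifiers over type $1$ objects, starting with $\exists$, followed by a number quantifier. Reals are represented by sequences of rationals $(q_n)$ with $|q_n-q_{n+i}|<2^{-n}$ for all $n,i$; $(q_n)=_{\mathbb R}(r_n)$ iff $|q_n-r_n|\le2^{-n+1}$ for all $n$; functions on $\mathbb R$ are type $1\to1$ objects mapping equal reals to equal reals. $\mathsf{HBU}$: for every $\Psi:\mathbb R\to\mathbb R^+$ there are $y_1,\dots,y_k\in[0,1]$ such that every $x\in[0,1]$ lies in some $(y_i-\Psi(y_i),y_i+\Psi(y_i))$, $i\le k$. $\Pi^1_k\text{-}\mathsf{TR}_0$: for any $\Pi^1_k$-formula $\theta$ of the language of second-order arithmetic (no parameters of type two) and any $X\subseteq\mathbb N$, $\mathsf{WO}(X)\to(\exists Y\subseteq\mathbb N)H_\theta(X,Y)$. Here $\mathsf{WO}(X)$ says that $X$ codes a countable well-ordering $<_X$, and $H_\theta(X,Y)$ says that $X$ is a linear ordering and $Y=\{(m,j):j\in\mathrm{field}(X)\wedge\theta(m,Y^j)\}$, where $Y^j=\{(m,i):i<_Xj\wedge(m,i)\in Y\}$. Subsets of $\mathbb N$ are given by characteristic functions of type $1$. *)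

(* Defs.v *)
(* The theorem asserts formal derivability, so L_omega and classical logic are
   deeply embedded, with intrinsically typed de Bruijn syntax. *)
From Stdlib Require Export List.
Export ListNotations.

Set Implicit Arguments.
Unset Strict Implicit.
Unset Printing Implicit Defensive.

Declare Scope ty_scope.
Declare Scope tm_scope.
Declare Scope fm_scope.
Delimit Scope ty_scope with ty.
Delimit Scope tm_scope with tm.
Delimit Scope fm_scope with fm.

Inductive ty : Type :=
| ty0 : ty
| arr : ty -> ty -> ty.
Bind Scope ty_scope with ty.
Infix "⇒" := arr (at level 55, right associativity) : ty_scope.

Definition ty1 : ty := (ty0 ⇒ ty0)%ty.
Definition ty2 : ty := (ty1 ⇒ ty0)%ty.

Definition ctx : Type := list ty.

Inductive var : ctx -> ty -> Type :=
| VZ : forall Γ σ, var (σ :: Γ) σ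
| VS : forall Γ σ τ, var Γ τ -> var (σ :: Γ) τ.
Arguments VZ {Γ σ}.
Arguments VS {Γ σ τ} _.

(* [<_0] and [=_0] are the two atomic relations, see [fm]. *)
Inductive con : ty -> Type :=
| CZero : con ty0
| COne : con ty0
| CPlus : con (ty0 ⇒ ty0 ⇒ ty0)
| CTimes : con (ty0 ⇒ ty0 ⇒ ty0)
| CPi : forall ρ τ, con (ρ ⇒ τ ⇒ ρ)
| CSigma : forall δ ρ τ, con ((δ ⇒ ρ ⇒ τ) ⇒ (δ ⇒ ρ) ⇒ δ ⇒ τ)
| CRec : forall σ, con ((ty0 ⇒ σ ⇒ σ) ⇒ σ ⇒ ty0 ⇒ σ).

Inductive tm (Γ : ctx) : ty -> Type :=
| Var : forall σ, var Γ σ -> tm Γ σ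
| Con : forall σ, con σ -> tm Γ σ
| App : forall σ τ, tm Γ (σ ⇒ τ) -> tm Γ σ -> tm Γ τ.
Arguments Var {Γ σ} _.
Arguments Con {Γ σ} _.
Arguments App {Γ σ τ} _ _.
Bind Scope tm_scope with tm.

Infix "·" := App (at level 34, left associativity) : tm_scope.
Notation "0" := (Con CZero) : tm_scope.
Notation "1" := (Con COne) : tm_scope.
Notation "s + t" := (Con CPlus · s · t)%tm : tm_scope.
Notation "s * t" := (Con CTimes · s · t)%tm : tm_scope.

Notation "#0" := (Var VZ) : tm_scope.
Notation "#1" := (Var (VS VZ)) : tm_scope.
Notation "#2" := (Var (VS (VS VZ))) : tm_scope.
Notation "#3" := (Var (VS (VS (VS VZ)))) : tm_scope.
Notation "#4" := (Var (VS (VS (VS (VS VZ))))) : tm_scope.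
Notation "#5" := (Var (VS (VS (VS (VS (VS VZ)))))) : tm_scope.

Definition sub (Γ Δ : ctx) : Type := forall τ, var Γ τ -> tm Δ τ.

Fixpoint tsub {Γ Δ} (s : sub Γ Δ) {τ} (t : tm Γ τ) : tm Δ τ :=
  match t with
  | Var x => s _ x
  | Con c => Con c
  | App u v => App (tsub s u) (tsub s v)
  end.

Definition ids {Γ} : sub Γ Γ := fun _ x => Var x.
Definition shift {Γ σ} : sub Γ (σ :: Γ) := fun _ x => Var (VS x).
Definition wk {Γ σ τ} (t : tm Γ τ) : tm (σ :: Γ) τ := tsub shift t.

Definition scons {Γ Δ σ} (t : tm Δ σ) (s : sub Γ Δ) : sub (σ :: Γ) Δ :=
  fun τ x =>
    match x in var Γ' τ'
      return match Γ' with
             | [] => unit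
             | ρ :: Γ1 => tm Δ ρ -> sub Γ1 Δ -> tm Δ τ'
             end
    with
    | VZ => fun t _ => t
    | VS y => fun _ s => s _ y
    end t s.

Definition up {Γ Δ σ} (s : sub Γ Δ) : sub (σ :: Γ) (σ :: Δ) :=
  scons #0%tm (fun τ x => wk (s τ x)).

(* Lambda-abstraction, by the usual bracket abstraction. *)
Definition lam_var {Γ σ τ} (x : var (σ :: Γ) τ) : tm Γ (σ ⇒ τ) :=
  match x in var Γ' τ'
    return match Γ' with
           | [] => unit
           | ρ :: Γ1 => tm Γ1 (ρ ⇒ τ')
           end
  with
  | @VZ _ ρ => Con (CSigma ρ (ρ ⇒ ρ) ρ) · Con (CPi ρ (ρ ⇒ ρ)) · Con (CPi ρ ρ)
  | VS y => Con (CPi _ _) · Var y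
  end%tm.

Fixpoint lam {Γ σ τ} (t : tm (σ :: Γ) τ) : tm Γ (σ ⇒ τ) :=
  match t with
  | Var x => lam_var x
  | Con c => Con (CPi _ _) · Con c
  | App u v => Con (CSigma _ _ _) · lam u · lam v
  end%tm.

Inductive fm : ctx -> Type :=
| Eq : forall Γ, tm Γ ty0 -> tm Γ ty0 -> fm Γ
| Lt : forall Γ, tm Γ ty0 -> tm Γ ty0 -> fm Γ
| Bot : forall Γ, fm Γ
| Imp : forall Γ, fm Γ -> fm Γ -> fm Γ
| All : forall Γ σ, fm (σ :: Γ) -> fm Γ.
Arguments Bot {Γ}.
Arguments All {Γ} σ _.
Bind Scope fm_scope with fm.

Definition Neg {Γ} (A : fm Γ) : fm Γ := Imp A Bot.
Definition And {Γ} (A B : fm Γ) : fm Γ := Neg (Imp A (Neg B)).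
Definition Or {Γ} (A B : fm Γ) : fm Γ := Imp (Neg A) B.
Definition Iff {Γ} (A B : fm Γ) : fm Γ := And (Imp A B) (Imp B A).
Definition Ex {Γ} σ (A : fm (σ :: Γ)) : fm Γ := Neg (All σ (Neg A)).
Arguments Ex {Γ} σ _.
Definition Le {Γ} (s t : tm Γ ty0) : fm Γ := Or (Lt s t) (Eq s t).

Notation "s ≐ t" := (Eq s%tm t%tm) (at level 70, no associativity) : fm_scope.
Notation "s ≺ t" := (Lt s%tm t%tm) (at level 70, no associativity) : fm_scope.
Notation "s ≼ t" := (Le s%tm t%tm) (at level 70, no associativity) : fm_scope.
Notation "¬ A" := (Neg A) (at level 75, right associativity) : fm_scope.
Infix "∧" := And (at level 80, right associativity) : fm_scope.
Infix "∨" := Or (at level 85, right associativity) : fm_scope.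
Infix "⊃" := Imp (at level 90, right associativity) : fm_scope.
Infix "≡" := Iff (at level 95, no associativity) : fm_scope.
Notation "'∀[' σ ] A" := (All σ A) (at level 100, A at level 100) : fm_scope.
Notation "'∃[' σ ] A" := (Ex σ A) (at level 100, A at level 100) : fm_scope.

Fixpoint fsub {Γ} (A : fm Γ) : forall {Δ}, sub Γ Δ -> fm Δ :=
  match A in fm Γ' return forall Δ, sub Γ' Δ -> fm Δ with
  | Eq u v => fun _ s => Eq (tsub s u) (tsub s v)
  | Lt u v => fun _ s => Lt (tsub s u) (tsub s v)
  | Bot => fun _ _ => Bot
  | Imp A B => fun _ s => Imp (fsub A s) (fsub B s)
  | All σ A => fun _ s => All σ (fsub A (up s))
  end.

Definition fwk {Γ σ} (A : fm Γ) : fm (σ :: Γ) := fsub A shift.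
Definition finst {Γ σ} (A : fm (σ :: Γ)) (t : tm Γ σ) : fm Γ :=
  fsub A (scons t ids).

Fixpoint qf {Γ} (A : fm Γ) : Prop :=
  match A with
  | Eq _ _ | Lt _ _ | Bot => True
  | Imp A B => qf A /\ qf B
  | All _ _ => False
  end.

Fixpoint EqT {Γ} (τ : ty) : tm Γ τ -> tm Γ τ -> fm Γ :=
  match τ return tm Γ τ -> tm Γ τ -> fm Γ with
  | ty0 => fun s t => Eq s t
  | arr σ τ => fun s t => All σ (EqT (wk s · #0) (wk t · #0))
  end%tm.
Arguments EqT {Γ τ} _ _.

(* A theory is a set of formulas in context; its open members stand for their
   universal closures (no axiom is subject to the freshness condition of
   [prv_allI], since that condition only concerns the hypotheses [H]). *)
Definition theory : Type := forall Γ, fm Γ -> Prop.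

Inductive prv (T : theory) : forall Γ, list (fm Γ) -> fm Γ -> Prop :=
| prv_ax : forall Γ (H : list (fm Γ)) A, T Γ A -> prv T H A
| prv_hyp : forall Γ (H : list (fm Γ)) A, In A H -> prv T H A
| prv_impI : forall Γ (H : list (fm Γ)) A B, prv T (A :: H) B -> prv T H (Imp A B)
| prv_impE : forall Γ (H : list (fm Γ)) A B, prv T H (Imp A B) -> prv T H A -> prv T H B
| prv_raa : forall Γ (H : list (fm Γ)) A, prv T (Neg A :: H) Bot -> prv T H A
| prv_allI : forall Γ (H : list (fm Γ)) σ (A : fm (σ :: Γ)),
    prv T (map fwk H) A -> prv T H (All σ A)
| prv_allE : forall Γ (H : list (fm Γ)) σ (A : fm (σ :: Γ)) (t : tm Γ σ),
    prv T H (All σ A) -> prv T H (finst A t).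

Definition proves (T : theory) {Γ} (A : fm Γ) : Prop := prv T [] A.

(* The ordered semi-ring is the discretely ordered one with least element 0, as
   usual for PA^-; [ax_ge0] and [ax_discrete] also follow from the other axioms
   by quantifier-free induction.  Of the recursors only R_0 has axioms. *)
Inductive RCA0w : theory :=
| ax_refl : forall Γ (x : tm Γ ty0), RCA0w (x ≐ x)%fm
| ax_sym : forall Γ (x y : tm Γ ty0), RCA0w (x ≐ y ⊃ y ≐ x)%fm
| ax_trans : forall Γ (x y z : tm Γ ty0), RCA0w (x ≐ y ⊃ y ≐ z ⊃ x ≐ z)%fm
| ax_lt_eq : forall Γ (x x' y y' : tm Γ ty0),
    RCA0w (x ≐ x' ⊃ y ≐ y' ⊃ x ≺ y ⊃ x' ≺ y')%fm
| ax_addA : forall Γ (x y z : tm Γ ty0), RCA0w ((x + y) + z ≐ x + (y + z))%fm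
| ax_addC : forall Γ (x y : tm Γ ty0), RCA0w (x + y ≐ y + x)%fm
| ax_mulA : forall Γ (x y z : tm Γ ty0), RCA0w ((x * y) * z ≐ x * (y * z))%fm
| ax_mulC : forall Γ (x y : tm Γ ty0), RCA0w (x * y ≐ y * x)%fm
| ax_distr : forall Γ (x y z : tm Γ ty0), RCA0w (x * (y + z) ≐ x * y + x * z)%fm
| ax_add0 : forall Γ (x : tm Γ ty0), RCA0w (x + 0 ≐ x)%fm
| ax_mul0 : forall Γ (x : tm Γ ty0), RCA0w (x * 0 ≐ 0)%fm
| ax_mul1 : forall Γ (x : tm Γ ty0), RCA0w (x * 1 ≐ x)%fm
| ax_lt_irr : forall Γ (x : tm Γ ty0), RCA0w (¬ x ≺ x)%fm
| ax_lt_trans : forall Γ (x y z : tm Γ ty0), RCA0w (x ≺ y ⊃ y ≺ z ⊃ x ≺ z)%fm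
| ax_lt_total : forall Γ (x y : tm Γ ty0), RCA0w (x ≺ y ∨ x ≐ y ∨ y ≺ x)%fm
| ax_lt_add : forall Γ (x y z : tm Γ ty0), RCA0w (x ≺ y ⊃ x + z ≺ y + z)%fm
| ax_lt_mul : forall Γ (x y z : tm Γ ty0),
    RCA0w (0 ≺ z ⊃ x ≺ y ⊃ x * z ≺ y * z)%fm
| ax_ge0 : forall Γ (x : tm Γ ty0), RCA0w (0 ≼ x)%fm
| ax_lt01 : forall Γ, @RCA0w Γ (0 ≺ 1)%fm
| ax_discrete : forall Γ (x : tm Γ ty0), RCA0w (0 ≺ x ⊃ 1 ≼ x)%fm
| ax_Pi : forall Γ ρ τ (x : tm Γ ρ) (y : tm Γ τ),
    RCA0w (EqT (Con (CPi ρ τ) · x · y)%tm x)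
| ax_Sigma : forall Γ δ ρ τ (x : tm Γ (δ ⇒ ρ ⇒ τ)) (y : tm Γ (δ ⇒ ρ)) (z : tm Γ δ),
    RCA0w (EqT (Con (CSigma δ ρ τ) · x · y · z) (x · z · (y · z)))%tm
| ax_Rec0 : forall Γ (f : tm Γ (ty0 ⇒ ty0 ⇒ ty0)) (m : tm Γ ty0),
    RCA0w (Con (CRec ty0) · f · m · 0 ≐ m)%fm
| ax_RecS : forall Γ (f : tm Γ (ty0 ⇒ ty0 ⇒ ty0)) (m n : tm Γ ty0),
    RCA0w (Con (CRec ty0) · f · m · (n + 1) ≐ f · n · (Con (CRec ty0) · f · m · n))%fm
| ax_ext : forall Γ ρ τ (φ : tm Γ (ρ ⇒ τ)) (x y : tm Γ ρ),
    RCA0w (EqT x y ⊃ EqT (φ · x)%tm (φ · y)%tm)%fm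
| ax_ind : forall Γ (A : fm (ty0 :: Γ)), qf A ->
    RCA0w (finst A 0%tm ⊃
           (∀[ty0] A ⊃ fsub A (scons (#0 + 1)%tm (fun _ x => Var (VS x)))) ⊃
           ∀[ty0] A)%fm
(* QF-AC^{1,0}; in [A], #0 is y and #1 is x *)
| ax_QFAC : forall Γ (A : fm (ty0 :: ty1 :: Γ)), qf A ->
    RCA0w ((∀[ty1] ∃[ty0] A) ⊃
           ∃[ty2] ∀[ty1]
             fsub A (scons (#1 · #0)%tm (scons #0%tm (fun _ x => Var (VS (VS x))))))%fm.

(* Injective, but not surjective. *)
Definition pair {Γ} (i j : tm Γ ty0) : tm Γ ty0 := ((i + j) * (i + j) + i)%tm.

(* In [body], #0 is the previous value and #1 the recursion index. *)
Definition rec0 {Γ} (body : tm (ty0 :: ty0 :: Γ) ty0) (m n : tm Γ ty0) : tm Γ ty0 :=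
  (Con (CRec ty0) · lam (lam body) · m · n)%tm.

Definition pred {Γ} (t : tm Γ ty0) : tm Γ ty0 := rec0 #1 0 t.
Definition monus {Γ} (s t : tm Γ ty0) : tm Γ ty0 := rec0 (pred #0) s t.
(* [sqrt (n+1)] is [sqrt n + 1] if [(sqrt n + 1)^2 <= n + 1], else [sqrt n] *)
Definition sqrt {Γ} (t : tm Γ ty0) : tm Γ ty0 :=
  rec0 (#0 + monus 1 (monus ((#0 + 1) * (#0 + 1)) (#1 + 1)))%tm 0%tm t.
Definition pow2 {Γ} (t : tm Γ ty0) : tm Γ ty0 := rec0 (#0 + #0)%tm 1%tm t.

(* [pfst (pair i j) = i] and [psnd (pair i j) = j], as
   [sqrt (pair i j) = i + j]. *)
Definition pfst {Γ} (t : tm Γ ty0) : tm Γ ty0 := monus t (sqrt t * sqrt t)%tm.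
Definition psnd {Γ} (t : tm Γ ty0) : tm Γ ty0 := monus (sqrt t) (pfst t).

(* The code of <g(0),...,g(n-1)>: the empty sequence has code 0, and
   appending [a] to a sequence with code [s] gives [pair s a + 1]. *)
Definition initseg {Γ} (g : tm Γ ty1) (n : tm Γ ty0) : tm Γ ty0 :=
  rec0 (pair #0 (wk (wk g) · #1) + 1)%tm 0%tm n.

Inductive quant : Type := QAll | QEx.
Definition dual (q : quant) : quant :=
  match q with QAll => QEx | QEx => QAll end.
Definition quantify (q : quant) {Γ} σ (A : fm (σ :: Γ)) : fm Γ :=
  match q with QAll => All σ A | QEx => Ex σ A end.
Arguments quantify q {Γ} σ A.

Fixpoint tuple {Γ} (l : list (tm Γ ty0)) : tm Γ ty0 :=
  match l with
  | [] => 0%tm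
  | [a] => a
  | a :: l' => pair a (tuple l')
  end.

(* [kleene QEx k f []] is the formula
   (∃g_1)(∀g_2)...(Q g_k)(Q' n) f(<g_1 n,...,g_k n>) = 0,
   where Q' is dual to Q and g_i n is the code of the initial segment. *)
Fixpoint kleene (q : quant) (k : nat) {Γ} (f : tm Γ ty1) (gs : list (tm Γ ty1)) : fm Γ :=
  match k with
  | O => quantify q ty0
           (wk f · tuple (map (fun g => initseg (wk g) #0) gs) ≐ 0)%fm
  | S k' => quantify q ty1
              (kleene (dual q) k' (wk f) (map wk gs ++ [#0%tm]))
  end.

Definition Sk_axiom {Γ} (k : nat) : fm Γ :=
  (∃[ty2] (∀[ty1] #1 · #0 ≼ 1) ∧
          (∀[ty1] kleene QEx k #0%tm [] ≡ #1 · #0 ≐ 0))%fm.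

Inductive Pi1CA0w (k : nat) : theory :=
| CA_RCA0w : forall Γ (A : fm Γ), RCA0w A -> Pi1CA0w k A
| CA_Sk : forall Γ, @Pi1CA0w k Γ (Sk_axiom k).

(* [Rat p m d] is the rational (p - m)/d, where d > 0. *)
Record rat (Γ : ctx) : Type := Rat { rp : tm Γ ty0; rm : tm Γ ty0; rd : tm Γ ty0 }.

(* <p,<m,c>> codes (p - m)/(c + 1), so that every natural number codes a
   rational, and every object of type 1 is a sequence of rationals. *)
Definition ratc {Γ} (p : tm Γ ty0) : rat Γ :=
  Rat (pfst p) (pfst (psnd p)) (psnd (psnd p) + 1)%tm.

Definition radd {Γ} (r s : rat Γ) : rat Γ :=
  Rat (rp r * rd s + rp s * rd r)%tm (rm r * rd s + rm s * rd r)%tm (rd r * rd s)%tm.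
Definition rneg {Γ} (r : rat Γ) : rat Γ := Rat (rm r) (rp r) (rd r).
Definition rsub {Γ} (r s : rat Γ) : rat Γ := radd r (rneg s).
Definition rlt {Γ} (r s : rat Γ) : fm Γ :=
  (rp r * rd s + rm s * rd r ≺ rp s * rd r + rm r * rd s)%fm.
Definition rle {Γ} (r s : rat Γ) : fm Γ :=
  (rp r * rd s + rm s * rd r ≼ rp s * rd r + rm r * rd s)%fm.
Definition rabs_lt {Γ} (r e : rat Γ) : fm Γ := (rlt r e ∧ rlt (rneg r) e)%fm.
Definition rabs_le {Γ} (r e : rat Γ) : fm Γ := (rle r e ∧ rle (rneg r) e)%fm.

(* [eps n] is 2^{-n} and [eps2 n] is 2^{-n+1}. *)
Definition eps {Γ} (n : tm Γ ty0) : rat Γ := Rat 1%tm 0%tm (pow2 n).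
Definition eps2 {Γ} (n : tm Γ ty0) : rat Γ := Rat (1 + 1)%tm 0%tm (pow2 n).

Definition approx {Γ} (x : tm Γ ty1) (n : tm Γ ty0) : rat Γ := ratc (x · n)%tm.

Definition is_real {Γ} (x : tm Γ ty1) : fm Γ :=
  (∀[ty0] ∀[ty0] let x := wk (wk x) in
     rabs_lt (rsub (approx x #1) (approx x (#1 + #0))) (eps #1))%fm.

Definition real_eq {Γ} (x y : tm Γ ty1) : fm Γ :=
  (∀[ty0] rabs_le (rsub (approx (wk x) #0) (approx (wk y) #0)) (eps2 #0))%fm.

(* x <_R y iff q_n + 2^{-n+1} < r_n for some n *)
Definition real_lt {Γ} (x y : tm Γ ty1) : fm Γ :=
  (∃[ty0] rlt (radd (approx (wk x) #0) (eps2 #0)) (approx (wk y) #0))%fm.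
Definition real_le {Γ} (x y : tm Γ ty1) : fm Γ := (¬ real_lt y x)%fm.

(* [real_lt] with y ± z given by the sequence (q_{n+1} ± r_{n+1})_n *)
Definition real_lt_add {Γ} (x y z : tm Γ ty1) : fm Γ :=
  (∃[ty0] rlt (radd (approx (wk x) #0) (eps2 #0))
              (radd (approx (wk y) (#0 + 1)) (approx (wk z) (#0 + 1))))%fm.
Definition real_sub_lt {Γ} (y z x : tm Γ ty1) : fm Γ :=
  (∃[ty0] rlt (radd (rsub (approx (wk y) (#0 + 1)) (approx (wk z) (#0 + 1))) (eps2 #0))
              (approx (wk x) #0))%fm.

Definition real_nat {Γ} (m : tm Γ ty0) : tm Γ ty1 :=
  (Con (CPi _ _) · pair m (pair 0 0))%tm.

Definition in_unit {Γ} (x : tm Γ ty1) : fm Γ :=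
  (is_real x ∧ real_le (real_nat 0) x ∧ real_le x (real_nat 1))%fm.

Definition pos_fun {Γ} (Ψ : tm Γ (ty1 ⇒ ty1)) : fm Γ :=
  ((∀[ty1] is_real #0 ⊃
      is_real (wk Ψ · #0) ∧ real_lt (real_nat 0) (wk Ψ · #0)) ∧
   (∀[ty1] ∀[ty1] is_real #1 ⊃ is_real #0 ⊃ real_eq #1 #0 ⊃
      real_eq (wk (wk Ψ) · #1) (wk (wk Ψ) · #0)))%fm.

(* The points y_1,...,y_k are given by k : 0 and y : 0 -> 1, indexed by i < k.
   In the inner formulas: #0 = i, #1 = x, then y, k, Ψ. *)
Definition HBU {Γ} : fm Γ :=
  (∀[ty1 ⇒ ty1] pos_fun #0 ⊃
   ∃[ty0] ∃[ty0 ⇒ ty1]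
     (∀[ty0] #0 ≺ #2 ⊃ in_unit (#1 · #0)) ∧
     (∀[ty1] in_unit #0 ⊃
        ∃[ty0] #0 ≺ #3 ∧
          real_sub_lt (#2 · #0) (#4 · (#2 · #0)) #1 ∧
          real_lt_add #1 (#2 · #0) (#4 · (#2 · #0))))%fm.

Inductive Pi1CA0w_HBU (k : nat) : theory :=
| CAH_CA : forall Γ (A : fm Γ), Pi1CA0w k A -> Pi1CA0w_HBU k A
| CAH_HBU : forall Γ, @Pi1CA0w_HBU k Γ HBU.

(* A set is a 0/1-valued function, and membership is value 1. *)
Definition is_set {Γ} (X : tm Γ ty1) : fm Γ := (∀[ty0] wk X · #0 ≼ 1)%fm.
Definition mem {Γ} (t : tm Γ ty0) (X : tm Γ ty1) : fm Γ := (X · t ≐ 1)%fm.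
Definition AllSet {Γ} (A : fm (ty1 :: Γ)) : fm Γ := (∀[ty1] is_set #0 ⊃ A)%fm.
Definition ExSet {Γ} (A : fm (ty1 :: Γ)) : fm Γ := (∃[ty1] is_set #0 ∧ A)%fm.
Notation "t ∈ X" := (mem t%tm X%tm) (at level 70, no associativity) : fm_scope.
Notation "'∀set' A" := (AllSet A) (at level 100, A at level 100) : fm_scope.
Notation "'∃set' A" := (ExSet A) (at level 100, A at level 100) : fm_scope.

Inductive num_term {Γ} : tm Γ ty0 -> Prop :=
| nt_var : forall x, num_term (Var x)
| nt_0 : num_term 0%tm
| nt_1 : num_term 1%tm
| nt_add : forall s t, num_term s -> num_term t -> num_term (s + t)%tm
| nt_mul : forall s t, num_term s -> num_term t -> num_term (s * t)%tm.

Inductive arithmetical : forall Γ, fm Γ -> Prop :=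
| ar_eq : forall Γ (s t : tm Γ ty0), num_term s -> num_term t -> arithmetical (s ≐ t)%fm
| ar_lt : forall Γ (s t : tm Γ ty0), num_term s -> num_term t -> arithmetical (s ≺ t)%fm
| ar_mem : forall Γ (t : tm Γ ty0) (X : var Γ ty1),
    num_term t -> arithmetical (t ∈ Var X)%fm
| ar_bot : forall Γ, arithmetical (@Bot Γ)
| ar_imp : forall Γ (A B : fm Γ),
    arithmetical A -> arithmetical B -> arithmetical (A ⊃ B)%fm
| ar_all : forall Γ (A : fm (ty0 :: Γ)), arithmetical A -> arithmetical (∀[ty0] A)%fm.

(* Second-order formulas are formulas of L_omega all of whose atoms only use
   variables of type 0 and set variables of type 1, so a parameter of higher type
   in the context cannot occur in them. *)
Inductive Pi1 : nat -> forall Γ, fm Γ -> Prop :=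
| Pi1_0 : forall Γ (A : fm Γ), arithmetical A -> Pi1 0 A
| Pi1_S : forall k Γ (A : fm (ty1 :: Γ)), Sigma1 k A -> Pi1 (S k) (∀set A)%fm
with Sigma1 : nat -> forall Γ, fm Γ -> Prop :=
| Sigma1_0 : forall Γ (A : fm Γ), arithmetical A -> Sigma1 0 A
| Sigma1_S : forall k Γ (A : fm (ty1 :: Γ)), Pi1 k A -> Sigma1 (S k) (∃set A)%fm.

(* X codes the reflexive order {(i,j) : pair i j ∈ X}; its field consists of the
   i with pair i i ∈ X, and i <_X j means i <=_X j and not j <=_X i. *)
Definition le_in {Γ} (X : tm Γ ty1) (i j : tm Γ ty0) : fm Γ := (pair i j ∈ X)%fm.
Definition lt_in {Γ} (X : tm Γ ty1) (i j : tm Γ ty0) : fm Γ :=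
  (pair i j ∈ X ∧ ¬ pair j i ∈ X)%fm.
Definition in_field {Γ} (X : tm Γ ty1) (i : tm Γ ty0) : fm Γ := (pair i i ∈ X)%fm.

Definition LO {Γ} (X : tm Γ ty1) : fm Γ :=
  ((∀[ty0] ∀[ty0] let X := wk (wk X) in
      le_in X #1 #0 ⊃ in_field X #1 ∧ in_field X #0) ∧
   (∀[ty0] ∀[ty0] ∀[ty0] let X := wk (wk (wk X)) in
      le_in X #2 #1 ⊃ le_in X #1 #0 ⊃ le_in X #2 #0) ∧
   (∀[ty0] ∀[ty0] let X := wk (wk X) in
      le_in X #1 #0 ⊃ le_in X #0 #1 ⊃ #1 ≐ #0) ∧
   (∀[ty0] ∀[ty0] let X := wk (wk X) in
      in_field X #1 ⊃ in_field X #0 ⊃ le_in X #1 #0 ∨ le_in X #0 #1))%fm.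

Definition WO {Γ} (X : tm Γ ty1) : fm Γ :=
  (LO X ∧ ¬ ∃[ty1] ∀[ty0] lt_in (wk (wk X)) (#1 · (#0 + 1)) (#1 · #0))%fm.

(* Z = Y^j = {(m,i) : i <_X j, (m,i) ∈ Y} *)
Definition is_initial {Γ} (X Y : tm Γ ty1) (j : tm Γ ty0) (Z : tm Γ ty1) : fm Γ :=
  (∀[ty0] #0 ∈ wk Z ≡
     (∃[ty0] ∃[ty0] #2 ≐ pair #1 #0 ∧
        lt_in (wk (wk (wk X))) #0 (wk (wk (wk j))) ∧ #2 ∈ wk (wk (wk Y))))%fm.

(* In [θ], #0 is the set variable Y, #1 the number variable m, and the
   remaining variables are parameters.  The defined set Y^j in θ(m,Y^j) is
   eliminated by (∃Z)(Z = Y^j ∧ θ(m,Z)). *)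
Definition theta_at {Γ} (θ : fm (ty1 :: ty0 :: Γ)) {Δ} (s : sub Γ Δ)
    (m : tm Δ ty0) (X Y : tm Δ ty1) (j : tm Δ ty0) : fm Δ :=
  (∃set is_initial (wk X) (wk Y) (wk j) #0 ∧
        fsub θ (scons #0%tm (scons (wk m) (fun _ x => wk (s _ x)))))%fm.

Definition H_ {Γ} (θ : fm (ty1 :: ty0 :: Γ)) {Δ} (s : sub Γ Δ) (X Y : tm Δ ty1) : fm Δ :=
  (LO X ∧
   ∀[ty0] #0 ∈ wk Y ≡
     (∃[ty0] ∃[ty0]
        let X := wk (wk (wk X)) in
        let Y := wk (wk (wk Y)) in
        #2 ≐ pair #1 #0 ∧ in_field X #0 ∧
        theta_at θ (fun _ x => wk (wk (wk (s _ x)))) #1 X Y #0))%fm.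

Definition TR {Γ} (θ : fm (ty1 :: ty0 :: Γ)) : fm Γ :=
  (∀set WO #0 ⊃ ∃set H_ θ (fun _ x => Var (VS (VS x))) #1%tm #0%tm)%fm.

(* Main.v *)
(* By the completeness theorem it is enough to work in a model of the theory; dividing by
   extensional equality makes both the equality of the model and extensionality genuine, and
   the numbers of the model embed into an ordered field, where inequalities can be handled.

   The functional [S_k] yields a functional [G] that decides [θ], since an arithmetical
   matrix has a Kleene normal form whose witness is computed from the number quantifier.
   Suppose that no [Y] satisfies the recursion along [X].  Then every [Y] has a wrong element
   whose level is [X]-minimal; call the one that QF-AC selects [N Y].  Sets agreeing
   with [Y] up to [N Y] form a neighbourhood of [Y], so HBU (for Cantor space, embedded into
   [0,1] by the digits 0 and 2 in base 4) gives [Y_i] with [i < k] whose neighbourhoods cover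
   everything.  Let [Z] contain [n] iff [n = N Y_i] for some [i < k] such that the correct
   value of [Y_i] at [n] is 1.  Two sets whose first wrong element is [n] agree below the level
   of [n], hence have the same correct value there.  Therefore [Z] differs from each [Y_i]
   at [N Y_i], and no neighbourhood covers [Z]. *)

(* The model may be nonstandard, and it has induction and choice only for predicates that it decides
   itself. Hence every predicate used in an induction or a choice needs a characteristic functional
   that is an object of the model. Number quantifiers become admissible through [E] (Kleene's ∃²)
   and [μ], both obtained from [S_k]. The number [k] of centres in HBU may be nonstandard too, so
   [Z] is defined by asking [E] for an index [i < k].

   The normal form has to be uniform: [G] takes [m] and [Y] as arguments, so all matrices and
   witnesses must depend on the environment through a term.

   Base 4 with digits 0 and 2 leaves gaps. After digits of value [C / 4^i], digit 0 leads into
   [[4C, 4C + 1] / 4^{i+1}] and digit 2 into [[4C + 2, 4C + 3] / 4^{i+1}]. Comparison with the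
   middle [(4C + 3/2) / 4^{i+1}] finds the digit with [4^{-(i+1)} / 2] to spare. This test decodes
   every real, not only those of Cantor space, so the radius [4^{-(N+2)}] can be defined everywhere;
   it respects equality of reals because the test does. *)
Require Import Defs.
From Stdlib Require Cantor.
From HB Require Import structures.
From mathcomp Require Import all_boot all_order all_algebra fraction.
From mathcomp Require Import ring lra boolp.
Import Defs.

Set Implicit Arguments.
Unset Strict Implicit.
Unset Printing Implicit Defensive.

(** * Substitution and derivability *)

Lemma var_cons_ind Γ σ (P : forall τ, var (σ :: Γ) τ -> Prop) :
  P σ VZ -> (forall τ y, P τ (VS y)) -> forall τ x, P τ x.
Proof.
move=> PZ PS τ x.
exact: (match x in var Γ' τ'
  return match Γ' as G return var G τ' -> Prop with
         | [] => fun _ => True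
         | ρ :: Γ1 => fun x => forall Q : (forall τ, var (ρ :: Γ1) τ -> Prop),
             Q ρ VZ -> (forall τ y, Q τ (VS y)) -> Q τ' x
         end x
  with
  | VZ _ _ => fun Q QZ _ => QZ
  | VS _ _ _ y => fun Q _ QS => QS _ y
  end P PZ PS).
Qed.

Lemma var_nil_ind (P : forall τ, var [] τ -> Prop) τ x : P τ x.
Proof.
exact: (match x in var Γ' τ'
  return match Γ' as G return var G τ' -> Prop with
         | [] => P τ'
         | _ => fun _ => True
         end x
  with VZ _ _ => I | VS _ _ _ _ => I end).
Qed.

Lemma sub_ext Γ (B : ty -> Type) (s1 s2 : forall τ, var Γ τ -> B τ) :
  (forall τ x, s1 τ x = s2 τ x) -> s1 = s2.
Proof.
move=> E; apply: functional_extensionality_dep => τ.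
by apply: functional_extensionality_dep => x; apply: E.
Qed.

Lemma sub_cons_ext Γ σ (B : ty -> Type) (s1 s2 : forall τ, var (σ :: Γ) τ -> B τ) :
  s1 σ VZ = s2 σ VZ -> (forall τ x, s1 τ (VS x) = s2 τ (VS x)) -> s1 = s2.
Proof. by move=> EZ ES; apply: sub_ext => τ x; elim/var_cons_ind: x. Qed.

Definition scomp {Γ Δ Ξ} (s2 : sub Δ Ξ) (s1 : sub Γ Δ) : sub Γ Ξ :=
  fun τ x => tsub s2 (s1 τ x).

Lemma tsub_comp Γ Δ Ξ (s2 : sub Δ Ξ) (s1 : sub Γ Δ) τ (t : tm Γ τ) :
  tsub s2 (tsub s1 t) = tsub (scomp s2 s1) t.
Proof. by elim: t => //= ? ? ? -> ? ->. Qed.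

Lemma tsub_ids Γ τ (t : tm Γ τ) : tsub ids t = t.
Proof. by elim: t => //= ? ? ? -> ? ->. Qed.

Lemma wk_tsub Γ Δ σ (s : sub Γ Δ) τ (t : tm Γ τ) :
  tsub (@up _ _ σ s) (wk t) = wk (tsub s t).
Proof. by rewrite /wk !tsub_comp. Qed.

Lemma up_comp Γ Δ Ξ σ (s2 : sub Δ Ξ) (s1 : sub Γ Δ) :
  scomp (@up _ _ σ s2) (up s1) = up (scomp s2 s1).
Proof. by apply: sub_cons_ext => // τ x; rewrite /scomp /= wk_tsub. Qed.

Lemma up_ids Γ σ : @up _ _ σ (@ids Γ) = ids.
Proof. exact: sub_cons_ext. Qed.

Lemma fsub_comp Γ (A : fm Γ) : forall Δ Ξ (s1 : sub Γ Δ) (s2 : sub Δ Ξ),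
  fsub (fsub A s1) s2 = fsub A (scomp s2 s1).
Proof.
elim: A => {Γ} /=.
- by move=> *; rewrite !tsub_comp.
- by move=> *; rewrite !tsub_comp.
- by [].
- by move=> Γ A IHA B IHB Δ Ξ s1 s2; rewrite IHA IHB.
- by move=> Γ σ A IH Δ Ξ s1 s2; rewrite IH up_comp.
Qed.

Lemma fsub_ids Γ (A : fm Γ) : fsub A ids = A.
Proof.
elim: A => {Γ} //=.
- by move=> *; rewrite !tsub_ids.
- by move=> *; rewrite !tsub_ids.
- by move=> Γ A -> B ->.
- by move=> Γ σ A IH; rewrite up_ids IH.
Qed.

Lemma scomp_scons Γ Δ Ξ σ (s2 : sub Δ Ξ) (s1 : sub Γ Δ) (t : tm Δ σ) :
  scomp s2 (scons t s1) = scons (tsub s2 t) (scomp s2 s1).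
Proof. exact: sub_cons_ext. Qed.

Lemma scomp_scons_up Γ Δ Ξ σ (s2 : sub Δ Ξ) (s1 : sub Γ Δ) (t : tm Ξ σ) :
  scomp (scons t s2) (up s1) = scons t (scomp s2 s1).
Proof. by apply: sub_cons_ext => // τ x; rewrite /scomp /= /wk tsub_comp. Qed.

Lemma fsub_wk Γ Δ σ (A : fm Γ) (s : sub Γ Δ) :
  fsub (fwk A) (@up _ _ σ s) = fwk (fsub A s).
Proof. by rewrite /fwk !fsub_comp. Qed.

Lemma finst_fsub Γ Δ σ (A : fm (σ :: Γ)) (t : tm Γ σ) (s : sub Γ Δ) :
  fsub (finst A t) s = finst (fsub A (up s)) (tsub s t).
Proof.
rewrite /finst !fsub_comp scomp_scons_up scomp_scons; congr (fsub _ (scons _ _)).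
by apply: sub_ext => τ x; rewrite /scomp /= tsub_ids.
Qed.

Lemma finst_up Γ Δ σ (A : fm (σ :: Γ)) (t : tm Δ σ) (s : sub Γ Δ) :
  finst (fsub A (up s)) t = fsub A (scons t s).
Proof.
rewrite /finst fsub_comp scomp_scons_up; congr (fsub _ (scons _ _)).
by apply: sub_ext => τ x; rewrite /scomp tsub_ids.
Qed.

Lemma EqT_fsub τ : forall Γ Δ (t u : tm Γ τ) (s : sub Γ Δ),
  fsub (EqT t u) s = EqT (tsub s t) (tsub s u).
Proof.
elim: τ => //= σ _ τ IH Γ Δ t u s.
by rewrite IH /= !wk_tsub.
Qed.

Section ProofSystem.
Variable T : theory.

Lemma prv_weaken Γ (H : list (fm Γ)) A :
  prv T H A -> forall H', incl H H' -> prv T H' A.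
Proof.
elim=> {Γ H A}.
- by move=> *; apply: prv_ax.
- by move=> Γ H A HA H' sub; apply: prv_hyp; apply: sub.
- move=> Γ H A B _ IH H' sub; apply: prv_impI; apply: IH.
  by move=> C [->|HC]; [left|right; apply: sub].
- by move=> Γ H A B _ IH1 _ IH2 H' sub; apply: prv_impE (IH1 _ sub) (IH2 _ sub).
- move=> Γ H A _ IH H' sub; apply: prv_raa; apply: IH.
  by move=> C [->|HC]; [left|right; apply: sub].
- move=> Γ H σ A _ IH H' sub; apply: prv_allI; apply: IH.
  exact: incl_map.
- by move=> Γ H σ A t _ IH H' sub; apply: prv_allE; apply: IH.
Qed.

Hypothesis Tsub : forall Γ Δ (A : fm Γ) (s : sub Γ Δ), T A -> T (fsub A s).

(** Henkin witnesses will be fresh variables, so derivations have to move into larger contexts; the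
    axioms follow because [T] is closed under substitution. *)
Lemma prv_fsub Γ (H : list (fm Γ)) A : prv T H A ->
  forall Δ (s : sub Γ Δ), prv T (map (fun B => fsub B s) H) (fsub A s).
Proof.
elim=> {Γ H A}.
- by move=> *; apply: prv_ax; apply: Tsub.
- by move=> Γ H A HA Δ s; apply: prv_hyp; apply: (in_map (fun B => fsub B s)).
- by move=> Γ H A B _ IH Δ s; apply: prv_impI; apply: IH.
- by move=> Γ H A B _ IH1 _ IH2 Δ s; apply: prv_impE (IH1 _ s) (IH2 _ s).
- by move=> Γ H A _ IH Δ s; apply: prv_raa; apply: IH.
- move=> Γ H σ A _ IH Δ s /=; apply: prv_allI.
  have := IH _ (up s); rewrite !map_map.
  by under [in X in X -> _]map_ext => B do rewrite fsub_wk.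
- move=> Γ H σ A t _ IH Δ s; rewrite finst_fsub.
  by apply: prv_allE; apply: (IH _ s).
Qed.

Lemma prv_efq Γ (H : list (fm Γ)) A : prv T H Bot -> prv T H A.
Proof. by move=> HB; apply: prv_raa; apply: prv_weaken HB _ _; right. Qed.

End ProofSystem.

(** * Countability of the syntax *)

(** The option admits the empty set, and [e] may also hit elements outside [P], which makes subsets
    countable with the same enumeration. *)
Definition countable_set (X : Type) (P : X -> Prop) : Prop :=
  exists e : nat -> option X, forall x, P x -> exists n, e n = Some x.

Definition countable_type (X : Type) := countable_set (fun _ : X => True).

Lemma countable_sub X (P Q : X -> Prop) :
  (forall x, P x -> Q x) -> countable_set Q -> countable_set P.
Proof. by move=> PQ [e eP]; exists e => x /PQ; apply: eP. Qed.

Lemma countable_nat : countable_type nat.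
Proof. by exists Some => x _; exists x. Qed.

Lemma countable_single X (x : X) : countable_set (fun y => y = x).
Proof. by exists (fun _ => Some x) => y ->; exists 0%N. Qed.

Lemma countable_image X Y (f : X -> option Y) (P : X -> Prop) :
  countable_set P -> countable_set (fun y => exists2 x, P x & f x = Some y).
Proof.
move=> [e eP]; exists (fun n => obind f (e n)) => y [x /eP [n en] fx].
by exists n; rewrite en.
Qed.

Lemma countable_bigcup X I (P : I -> Prop) (Q : I -> X -> Prop) :
  countable_set P -> (forall i, P i -> countable_set (Q i)) ->
  countable_set (fun x => exists2 i, P i & Q i x).
Proof.
move=> [e eP] cQ.
have [d dP] : exists d : I -> nat -> option X,
    forall i, P i -> forall x, Q i x -> exists n, d i n = Some x.
  exists (fun i => if pselect (P i) is left Pi then sval (cid (cQ i Pi)) else fun _ => None).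
  by move=> i Pi; case: pselect => // Pi'; case: cid.
exists (fun n => if unpickle n is Some (a, b) then obind (d ^~ b) (e a) else None).
move=> x [i Pi Qix]; have [a ea] := eP i Pi; have [b db] := dP i Pi x Qix.
by exists (pickle (a, b)); rewrite pickleK ea.
Qed.

Lemma countable_image2 X Y Z (f : X -> Y -> Z) (P : X -> Prop) (Q : Y -> Prop) :
  countable_set P -> countable_set Q ->
  countable_set (fun z => exists2 x, P x & exists2 y, Q y & f x y = z).
Proof.
move=> cP cQ; apply: countable_bigcup cP _ => x _.
apply: countable_sub (countable_image (fun y => Some (f x y)) cQ).
by move=> z [y Qy <-]; exists y.
Qed.

(** Reduces countability of an inductive type to an induction on depth, in which each level is a
    union of images of the previous one under the constructors. *)
Lemma countable_depth X (d : X -> nat) :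
  (forall n, countable_set (fun x => (d x <= n)%N)) -> countable_type X.
Proof.
move=> cX; have := countable_bigcup countable_nat (fun n _ => cX n).
by apply: countable_sub => x _; exists (d x).
Qed.

Lemma countable_or X (P Q : X -> Prop) :
  countable_set P -> countable_set Q -> countable_set (fun x => P x \/ Q x).
Proof.
move=> cP cQ.
have cb : countable_set (fun n => (n < 2)%N) by apply: countable_sub countable_nat.
have : countable_set (fun x => exists2 n, (n < 2)%N & (if n is 0%N then P else Q) x).
  by apply: (countable_bigcup (Q := fun n => if n is 0%N then P else Q)) cb _; case.
by apply: countable_sub => x [Px|Qx]; [exists 0%N|exists 1%N].
Qed.

Lemma ty_eq_dec (σ τ : ty) : {σ = τ} + {σ <> τ}.
Proof. decide equality. Qed.

HB.instance Definition _ := hasDecEq.Build ty (fun σ τ => sumboolP (ty_eq_dec σ τ)).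

(** Constructors of an indexed family land in different fibres, so the total space is easier to
    enumerate. Decidable equality of types filters out one fibre and makes the transport along the
    index equation canonical. *)
Lemma countable_fiber (B : ty -> Type) τ :
  countable_type {σ : ty & B σ} -> countable_type (B τ).
Proof.
move=> [e eP].
exists (fun n => if e n is Some (existT σ b) then
                 if @eqP _ σ τ is ReflectT E then Some (eq_rect σ B b τ E) else None
               else None).
move=> b _; have [n en] := eP (existT B τ b) I; exists n; rewrite en.
by case: eqP => // E; rewrite (eq_irrelevance E erefl).
Qed.

Lemma countable_ty : countable_type ty.
Proof.
pose d := fix d σ := if σ is arr σ τ then (maxn (d σ) (d τ)).+1 else 0%N.
apply: (countable_depth (d := d)); elim=> [|n IH].
  by apply: countable_sub (countable_single ty0) => -[].
apply: countable_sub (countable_or (countable_single ty0) (countable_image2 arr IH IH)).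
move=> [|σ τ]; first by left.
by rewrite /= ltnS geq_max => /andP [? ?]; right; exists σ => //; exists τ.
Qed.

Lemma countable_var Γ τ : countable_type (var Γ τ).
Proof.
apply: (countable_fiber (B := var Γ)); elim: Γ => [|ρ Γ IH].
  by exists (fun _ => None) => -[σ x]; case: (@var_nil_ind (fun _ _ => False) σ x).
have := countable_or (countable_single (existT (var (ρ :: Γ)) ρ VZ))
  (countable_image (fun x : {σ & var Γ σ} =>
     Some (existT (var (ρ :: Γ)) (projT1 x) (VS (projT2 x)))) IH).
apply: countable_sub => -[σ x] _; move: σ x.
by apply: var_cons_ind => [|σ y]; [left|right; exists (existT _ σ y)].
Qed.

Lemma countable_con τ : countable_type (con τ).
Proof.
apply: countable_fiber.
have c1 := countable_single.
pose K ρ τ := existT con _ (CPi ρ τ).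
pose S' δ (p : ty * ty) := existT con _ (CSigma δ p.1 p.2).
pose R (σ : ty) := Some (existT con _ (CRec σ)).
have cpair := countable_image2 (fun x y => (x, y)) countable_ty countable_ty.
have := countable_or (c1 _ (existT con _ CZero)) (countable_or (c1 _ (existT con _ COne))
  (countable_or (c1 _ (existT con _ CPlus)) (countable_or (c1 _ (existT con _ CTimes))
  (countable_or (countable_image2 K countable_ty countable_ty)
  (countable_or (countable_image2 S' countable_ty cpair) (countable_image R countable_ty)))))).
apply: countable_sub => -[_ []]; rewrite /K /S' /R; [by tauto..| | |].
- by move=> ρ τ' _; do 4 right; left; exists ρ => //; exists τ'.
- move=> δ ρ τ' _; do 5 right; left; exists δ => //; exists (ρ, τ') => //.
  by exists ρ => //; exists τ'.
- by move=> σ _; do 6 right; exists σ.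
Qed.

Lemma countable_tm Γ τ : countable_type (tm Γ τ).
Proof.
pose d := fix d τ (t : tm Γ τ) := if t is App _ _ u v then (maxn (d _ u) (d _ v)).+1 else 0%N.
suff H n : forall τ, countable_set (fun t : tm Γ τ => (d _ t <= n)%N).
  by apply: (countable_depth (d := d τ)) => n; apply: H.
elim: n => [|n IH] {}τ.
- apply: countable_sub (countable_or
    (countable_image (fun x => Some (Var x)) (countable_var Γ τ))
    (countable_image (fun c => Some (Con c)) (countable_con τ))).
  by case=> // σ x _; [left|right]; exists x.
- have cA : countable_set (fun t : tm Γ τ => exists2 σ, True &
      exists2 u, (d (σ ⇒ τ)%ty u <= n)%N & exists2 v, (d _ v <= n)%N & App u v = t).
    apply: countable_bigcup countable_ty _ => σ _.
    exact: countable_image2 (IH _) (IH _).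
  apply: countable_sub (countable_or cA (IH τ)).
  case=> [σ x|σ c|σ τ' u v] /=; [by right|by right|].
  rewrite ltnS geq_max => /andP [? ?].
  by left; exists σ => //; exists u => //; exists v.
Qed.

Lemma countable_fm Γ : countable_type (fm Γ).
Proof.
pose d := fix d Γ (A : fm Γ) := match A with
  | Imp _ A B => (maxn (d _ A) (d _ B)).+1 | All _ _ A => (d _ A).+1 | _ => 0%N end.
suff H n : forall Γ, countable_set (fun A : fm Γ => (d _ A <= n)%N).
  by apply: (countable_depth (d := d Γ)) => n; apply: H.
have ct Δ := countable_tm Δ ty0.
elim: n => [|n IH] {}Γ.
- apply: countable_sub (countable_or (countable_image2 (@Eq Γ) (ct Γ) (ct Γ))
   (countable_or (countable_image2 (@Lt Γ) (ct Γ) (ct Γ)) (countable_single Bot))).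
  case=> // Δ; [move=> u v _; left|move=> u v _; right; left|by right; right].
  + by exists u => //; exists v.
  + by exists u => //; exists v.
- have cA : countable_set (fun A : fm Γ => exists2 σ, True &
      exists2 B : fm (σ :: Γ), (d _ B <= n)%N & Some (All σ B) = Some A).
    apply: countable_bigcup countable_ty _ => σ _.
    exact: (countable_image (fun B => Some (All σ B)) (IH (σ :: Γ))).
  apply: countable_sub (countable_or cA (countable_or (countable_image2 (@Imp Γ) (IH Γ) (IH Γ)) (IH Γ))).
  case=> [?|?|?|Δ A B|Δ σ B] /=; [by right; right..| |].
  + rewrite ltnS geq_max => /andP [? ?].
    by right; left; exists A => //; exists B.
  + by rewrite ltnS => ?; left; exists σ => //; exists B.
Qed.

Lemma fm_enum Γ : exists e : nat -> fm Γ, forall A, exists n, e n = A.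
Proof.
have [e eP] := countable_fm Γ; exists (fun n => odflt Bot (e n)) => A.
by have [n en] := eP A I; exists n; rewrite en.
Qed.

(** * Model existence *)

(** Equality of type 0 is an arbitrary relation, because the term model only satisfies the axioms
    about it; it becomes the identity in the quotient. *)
Record structure := Structure {
  dom :> ty -> Type;
  app : forall σ τ, dom (σ ⇒ τ)%ty -> dom σ -> dom τ;
  cint : forall σ, con σ -> dom σ;
  deq : dom ty0 -> dom ty0 -> Prop;
  dlt : dom ty0 -> dom ty0 -> Prop }.

Definition env (M : structure) (Γ : ctx) : Type := forall τ, var Γ τ -> M τ.

Definition econs {M : structure} {Γ σ} (a : M σ) (ρ : env M Γ) : env M (σ :: Γ) :=
  fun τ x =>
    match x in var Γ' τ'
      return match Γ' with
             | [] => unit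
             | ν :: Γ1 => M ν -> env M Γ1 -> M τ'
             end
    with
    | VZ _ _ => fun a _ => a
    | VS _ _ _ y => fun _ ρ => ρ _ y
    end a ρ.

Definition enil {M : structure} : env M [] :=
  fun τ x => match x in var Γ' τ' return if Γ' is [] then M τ' else unit with
    VZ _ _ => tt | VS _ _ _ _ => tt end.

Fixpoint eval (M : structure) {Γ} (ρ : env M Γ) {τ} (t : tm Γ τ) : M τ :=
  match t with
  | Var _ x => ρ _ x
  | Con _ c => cint M c
  | App _ _ u v => app (eval ρ u) (eval ρ v)
  end.

Fixpoint sat (M : structure) {Γ} (A : fm Γ) : env M Γ -> Prop :=
  match A in fm Γ' return env M Γ' -> Prop with
  | Eq _ u v => fun ρ => deq (eval ρ u) (eval ρ v)
  | Lt _ u v => fun ρ => dlt (eval ρ u) (eval ρ v)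
  | Bot _ => fun _ => False
  | Imp _ A B => fun ρ => sat A ρ -> sat B ρ
  | All _ σ A => fun ρ => forall a : M σ, sat A (econs a ρ)
  end.

Definition is_model (M : structure) (T : theory) : Prop :=
  forall Γ (A : fm Γ), T Γ A -> forall ρ : env M Γ, sat A ρ.

Section Semantics.
Variable M : structure.

Lemma eval_tsub Γ Δ (s : sub Γ Δ) (ρ : env M Δ) τ (t : tm Γ τ) :
  eval ρ (tsub s t) = eval (fun _ x => eval ρ (s _ x)) t.
Proof. by elim: t => //= ? ? ? -> ? ->. Qed.

Lemma eval_wk Γ σ (ρ : env M Γ) (a : M σ) τ (t : tm Γ τ) :
  eval (econs a ρ) (wk t) = eval ρ t.
Proof. by rewrite eval_tsub. Qed.

Lemma sat_fsub Γ (A : fm Γ) : forall Δ (s : sub Γ Δ) (ρ : env M Δ),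
  sat (fsub A s) ρ <-> sat A (fun _ x => eval ρ (s _ x)).
Proof.
elim: A => {Γ} //=.
- by move=> *; rewrite !eval_tsub.
- by move=> *; rewrite !eval_tsub.
- by move=> Γ A IHA B IHB Δ s ρ; rewrite IHA IHB.
- move=> Γ σ A IH Δ s ρ; split=> HA a; have := HA a; rewrite IH.
  + by congr (sat _ _); apply: sub_cons_ext => //= τ x; rewrite eval_wk.
  + by congr (sat _ _); apply: sub_cons_ext => //= τ x; rewrite eval_wk.
Qed.

Lemma sat_finst Γ σ (A : fm (σ :: Γ)) t (ρ : env M Γ) :
  sat (finst A t) ρ <-> sat A (econs (eval ρ t) ρ).
Proof.
rewrite sat_fsub.
suff -> : (fun τ x => eval ρ (scons t ids x)) = econs (eval ρ t) ρ by [].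
exact: sub_cons_ext.
Qed.

End Semantics.

(** * Henkin construction of a complete theory with witnesses *)

Section Henkin.
Variable T : theory.
Hypothesis Tsub : forall Γ Δ (A : fm Γ) (s : sub Γ Δ), T A -> T (fsub A s).

Variables (Γ0 : ctx) (A0 : fm Γ0).
Hypothesis unprovable : ~ prv T [] A0.

(* The formulas still to be decided are kept as a table: row [j] enumerates the
   formulas over the [j]-th context, weakened to the current context. *)
Record world := World {
  wctx : ctx;
  whyp : list (fm wctx);
  wtab : nat -> nat -> fm wctx }.

Definition enum Γ : nat -> fm Γ := sval (cid (fm_enum Γ)).

Lemma enum_surj Γ A : exists n, @enum Γ n = A.
Proof. by rewrite /enum; case: cid => e /= eP; apply: eP. Qed.

(** Every step adds exactly one variable. It is a counterexample to [A] when [A] is a refuted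
    universal formula, and a dummy of type 0 in the other cases. *)
Definition henkin Γ (H : list (fm Γ)) (A : fm Γ) : {σ & list (fm (σ :: Γ))} :=
  if `[< ~ prv T (A :: H) Bot >] then existT _ ty0 (map fwk (A :: H)) else
  match A in fm Γ' return list (fm Γ') -> {σ & list (fm (σ :: Γ'))} with
  | All _ σ B => fun H => existT _ σ (Neg B :: map fwk H)
  | _ => fun H => existT _ ty0 (map fwk H)
  end H.

Definition task n (w : world) : fm (wctx w) :=
  let p := Cantor.of_nat n in wtab w p.1 p.2.

Definition wstep n (w : world) : world :=
  let h := henkin (whyp w) (task n w) in
  World (projT2 h)
    (fun j i => if j == n.+1 then enum (projT1 h :: wctx w) i else fwk (wtab w j i)).

Fixpoint stage n : world :=
  if n is m.+1 then wstep m (stage m) else World [Neg A0] (fun _ => @enum Γ0).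

Notation C n := (wctx (stage n)).
Notation H n := (whyp (stage n)).

Lemma henkinP Γ (L : list (fm Γ)) (A : fm Γ) :
  let h := henkin L A in
  incl (map fwk L) (projT2 h) /\
  (In (fwk A) (projT2 h) \/ prv T L (Neg A) /\
    forall σ B, A = All σ B ->
    exists t : tm (projT1 h :: Γ) σ, In (Neg (fsub B (scons t shift))) (projT2 h)).
Proof.
rewrite /henkin; case: asboolP => [_|nc] /=.
  by split; [right|left; left].
have {nc} HA : prv T L (Neg A) by apply: prv_impI; apply: contrapT.
case: A L HA => [Δ u v|Δ u v|Δ|Δ A B|Δ σ A] L HA /=; try by split=> //; right.
split; first by move=> B HB; right.
right; split=> // σ' B E.
have [? E'] : exists E : σ = σ', eq_rect σ (fun σ => fm (σ :: Δ)) A σ' E = B.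
  have := congr1 (fun X : fm Δ => match X in fm Δ' return {σ & fm (σ :: Δ')} with
     All _ σ A => existT _ σ A | _ => existT _ ty0 Bot end) E => /= E1.
  by exists (projT1_eq E1); apply: (projT2_eq E1).
subst σ'; move: E' => /= <-; exists #0%tm; left; congr Neg.
suff -> : scons #0%tm shift = @ids (σ :: Δ) by rewrite fsub_ids.
by apply: (@sub_cons_ext _ _ (tm (σ :: Δ))).
Qed.

Lemma closed_term (σ : ty) Γ : exists t : tm Γ σ, True.
Proof.
elim: σ => [|σ _ τ [t _]]; first by exists 0%tm.
by exists (App (Con (CPi τ σ)) t).
Qed.

(** The fresh variable can be generalised and then instantiated by a closed term, and every type has
    one. *)
Lemma prv_fwk Γ σ (L : list (fm Γ)) : prv T (map (@fwk _ σ) L) Bot -> prv T L Bot.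
Proof.
move=> HB; have [t _] := closed_term σ Γ.
by have := prv_allE (A := Bot) t (prv_allI HB).
Qed.

Lemma henkin_consistent Γ (L : list (fm Γ)) (A : fm Γ) :
  ~ prv T L Bot -> ~ prv T (projT2 (henkin L A)) Bot.
Proof.
rewrite /henkin; case: asboolP => [nc _|nc] /=; first by move=> HB; apply: nc; apply: (@prv_fwk _ ty0 (A :: L)) HB.
have {nc} HA : prv T L (Neg A) by apply: prv_impI; apply: contrapT.
case: A L HA => [Δ u v|Δ u v|Δ|Δ A B|Δ σ A] L HA nc /=; try by move=> HB; apply: nc; apply: prv_fwk HB.
(* Inconsistency of [Neg B] for a fresh variable proves [B], hence [All σ B], which [HA] refutes. *)
move=> HB; apply: nc; apply: (prv_impE HA).
by apply: prv_allI; apply: prv_raa.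
Qed.

Lemma stage_consistent n : ~ prv T (H n) Bot.
Proof.
elim: n => [|n IH] /=; last exact: henkin_consistent.
by move=> HB; apply: unprovable; apply: prv_raa.
Qed.

(* The junk value for [m < n] is never used. *)
Fixpoint lift n m : sub (C n) (C m) :=
  match @eqP _ n m with
  | ReflectT E => eq_rect n (fun k => sub (C n) (C k)) ids m E
  | ReflectF _ => match m with
    | 0 => fun τ _ => sval (cid (closed_term τ (C 0)))
    | k.+1 => fun τ x => wk (@lift n k τ x)
    end
  end.
Arguments lift n m [τ] x.

Lemma lift_id n : lift n n = ids.
Proof. by case: n => [|n] /=; case: eqP => // E; rewrite (eq_irrelevance E erefl). Qed.

Lemma liftS n m : (n <= m)%N -> lift n m.+1 = (fun τ x => wk (lift n m x)).
Proof. by move=> le_nm /=; case: eqP => // E; exfalso; move: le_nm; rewrite E ltnn. Qed.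

Lemma lift_comp n m l : (n <= m)%N -> (m <= l)%N -> scomp (lift m l) (lift n m) = lift n l.
Proof.
move=> le_nm; elim: l => [|l IH].
  by rewrite leqn0 => /eqP E; subst m; rewrite lift_id; apply: sub_ext => τ x; apply: tsub_ids.
rewrite leq_eqVlt ltnS => /orP [/eqP E|le_ml].
  by subst m; rewrite lift_id; apply: sub_ext => τ x; apply: tsub_ids.
rewrite !liftS // ?(leq_trans le_nm) // -IH //; apply: sub_ext => τ x.
by rewrite /scomp /wk tsub_comp.
Qed.

Lemma prv_stageS n A : prv T (H n) A -> prv T (H n.+1) (fwk A).
Proof.
move=> HA; apply: prv_weaken (prv_fsub Tsub HA shift) _ _.
by have [] := henkinP (H n) (task n (stage n)).
Qed.

Lemma prv_stage n m A : (n <= m)%N -> prv T (H n) A -> prv T (H m) (fsub A (lift n m)).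
Proof.
move=> le_nm HA; elim: m le_nm => [|m IH].
  by rewrite leqn0 => /eqP E; subst n; rewrite lift_id fsub_ids.
rewrite leq_eqVlt ltnS => /orP [/eqP E|le_nm].
  by subst n; rewrite lift_id fsub_ids.
by have := prv_stageS (IH le_nm); rewrite /fwk fsub_comp liftS.
Qed.

(** Membership in the limit theory: the stages have different contexts and can only be compared
    through [lift], so a formula counts as true once some later stage proves its lift. *)
Definition holds n (A : fm (C n)) : Prop :=
  exists2 m, (n <= m)%N & prv T (H m) (fsub A (lift n m)).
Arguments holds : clear implicits.

Lemma holds_lift n m A : (n <= m)%N -> holds m (fsub A (lift n m)) <-> holds n A.
Proof.
move=> le_nm; split=> [[l le_ml]|[l le_nl HA]].
  by rewrite fsub_comp lift_comp // => HA; exists l => //; apply: leq_trans le_ml.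
exists (maxn m l); first exact: leq_maxl.
rewrite fsub_comp lift_comp ?leq_maxl //.
have := prv_stage (leq_maxr m l) HA.
by rewrite fsub_comp lift_comp ?leq_maxr.
Qed.

Lemma holds_prv n A : prv T (H n) A -> holds n A.
Proof. by exists n => //; rewrite lift_id fsub_ids. Qed.

Lemma holds_mp n A B : holds n (Imp A B) -> holds n A -> holds n B.
Proof.
move=> [m le_nm HAB] [l le_nl HA].
apply/(holds_lift _ (leq_trans le_nm (leq_maxl m l))); apply: holds_prv.
have := prv_stage (leq_maxl m l) HAB; have := prv_stage (leq_maxr m l) HA.
rewrite !fsub_comp !lift_comp ?leq_maxr ?leq_maxl // => HA' HAB'.
exact: prv_impE HAB' HA'.
Qed.

Lemma holds_consistent n A : holds n A -> ~ holds n (Neg A).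
Proof.
move=> HA HN; have [m _] := holds_mp HN HA.
exact: stage_consistent.
Qed.

Lemma wtab_lift j n i : (j <= n)%N ->
  wtab (stage n) j i = fsub (enum (C j) i) (lift j n).
Proof.
elim: n => [|n IH]; first by rewrite leqn0 => /eqP ->; rewrite lift_id fsub_ids.
rewrite leq_eqVlt ltnS => /orP [/eqP E|le_jn].
  by subst j; rewrite lift_id fsub_ids /= eqxx.
rewrite liftS //= ifN; last by rewrite neq_ltn ltnS le_jn.
by rewrite IH // /fwk fsub_comp.
Qed.

Lemma processed n (A : fm (C n)) : exists2 m, (n <= m)%N &
  task m (stage m) = fsub A (lift n m).
Proof.
have [i Ei] := enum_surj A.
(* The code of a pair is at least its first component, so row [n] of the table is already filled
   when this task comes up. *)
exists (Cantor.to_nat (n, i)).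
  by apply/ssrnat.leP; have := Cantor.to_nat_non_decreasing n i; apply: PeanoNat.Nat.le_trans; apply: PeanoNat.Nat.le_add_l.
rewrite /task Cantor.cancel_of_to /= wtab_lift ?Ei //.
by apply/ssrnat.leP; have := Cantor.to_nat_non_decreasing n i; apply: PeanoNat.Nat.le_trans; apply: PeanoNat.Nat.le_add_l.
Qed.

Lemma fsub_liftS n m (A : fm (C n)) : (n <= m)%N ->
  fsub A (lift n m.+1) = fwk (fsub A (lift n m)).
Proof. by move=> le_nm; rewrite liftS // /fwk fsub_comp. Qed.

Lemma holds_total n A : holds n A \/ holds n (Neg A).
Proof.
have [m le_nm Em] := processed A.
have [_ [HA|[HA _]]] := henkinP (H m) (task m (stage m)); [left|right].
- exists m.+1; first exact: leqW.
  by rewrite fsub_liftS // -Em; apply: prv_hyp.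
- by exists m => //; rewrite Em in HA.
Qed.

Lemma holds_witness n σ (B : fm (σ :: C n)) : ~ holds n (All σ B) ->
  exists2 m, (n <= m)%N & exists t : tm (C m) σ, ~ holds m (fsub B (scons t (lift n m))).
Proof.
move=> nB; have [m le_nm Em] := processed (All σ B).
have [_ [HA|[HA Hw]]] := henkinP (H m) (task m (stage m)).
  case: nB; exists m.+1; first exact: leqW.
  by rewrite fsub_liftS // -Em; apply: prv_hyp.
have [t Ht] := Hw σ (fsub B (up (lift n m))) Em.
exists m.+1; first exact: leqW.
exists t => HB; apply: (holds_consistent HB); apply: holds_prv; apply: prv_hyp.
rewrite liftS //; move: Ht; rewrite fsub_comp scomp_scons_up.
by congr (In (Neg (fsub B (scons t _)))); apply: sub_ext.
Qed.

(** An element is a term of some stage. Nothing is identified between stages; application and the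
    relations first lift both arguments to the later of their stages. *)
Definition term_structure : structure :=
  @Structure (fun τ => {n & tm (C n) τ})
    (fun σ τ f a => let m := maxn (projT1 f) (projT1 a) in
       existT _ m (App (tsub (lift (projT1 f) m) (projT2 f)) (tsub (lift (projT1 a) m) (projT2 a))))
    (fun σ c => existT _ 0%N (Con c))
    (fun a b => let m := maxn (projT1 a) (projT1 b) in
       holds m (Eq (tsub (lift (projT1 a) m) (projT2 a)) (tsub (lift (projT1 b) m) (projT2 b))))
    (fun a b => let m := maxn (projT1 a) (projT1 b) in
       holds m (Lt (tsub (lift (projT1 a) m) (projT2 a)) (tsub (lift (projT1 b) m) (projT2 b)))).

Definition lift_to N τ (a : term_structure τ) : tm (C N) τ :=
  tsub (lift (projT1 a) N) (projT2 a).

Definition below Γ (ρ : env term_structure Γ) N := forall τ x, (projT1 (ρ τ x) <= N)%N.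

Lemma eval_term_structure Γ (ρ : env term_structure Γ) N τ (t : tm Γ τ) : below ρ N ->
  (projT1 (eval ρ t) <= N)%N /\ lift_to N (eval ρ t) = tsub (fun _ x => lift_to N (ρ _ x)) t.
Proof.
move=> bN; elim: t => [σ x|σ c|σ σ' u [lu Eu] v [lv Ev]] //=.
split; first by rewrite geq_max lu lv.
rewrite -Eu -Ev /lift_to /= !tsub_comp !lift_comp ?geq_max ?lu ?lv //.
  exact: leq_maxr.
exact: leq_maxl.
Qed.

Lemma below_ex Γ (ρ : env term_structure Γ) : exists N, below ρ N.
Proof.
elim: Γ ρ => [|σ Γ IH] ρ.
  by exists 0%N => τ x; apply: (@var_nil_ind (fun τ x => (projT1 (ρ τ x) <= 0)%N)).
have [N bN] := IH (fun _ x => ρ _ (VS x)).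
exists (maxn N (projT1 (ρ _ VZ))) => τ x; move: τ x.
by apply: var_cons_ind => [|τ y]; rewrite leq_max ?leqnn ?orbT // bN.
Qed.

Lemma truth Γ (A : fm Γ) : forall (ρ : env term_structure Γ) N, below ρ N ->
  sat A ρ <-> holds N (fsub A (fun _ x => lift_to N (ρ _ x))).
Proof.
elim: A => {Γ} /=.
- move=> Γ u v ρ N bN.
  have [lu Eu] := eval_term_structure u bN; have [lv Ev] := eval_term_structure v bN.
  rewrite -(@holds_lift _ N) ?geq_max ?lu ?lv //= !tsub_comp !lift_comp
    ?leq_maxl ?leq_maxr ?geq_max ?lu ?lv //.
  by rewrite -/(lift_to N (eval ρ u)) -/(lift_to N (eval ρ v)) Eu Ev.
- move=> Γ u v ρ N bN.
  have [lu Eu] := eval_term_structure u bN; have [lv Ev] := eval_term_structure v bN.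
  rewrite -(@holds_lift _ N) ?geq_max ?lu ?lv //= !tsub_comp !lift_comp
    ?leq_maxl ?leq_maxr ?geq_max ?lu ?lv //.
  by rewrite -/(lift_to N (eval ρ u)) -/(lift_to N (eval ρ v)) Eu Ev.
- move=> Γ ρ N _; split=> // -[m _]; exact: stage_consistent.
- move=> Γ A IHA B IHB ρ N bN; rewrite IHA // IHB //; split; last exact: holds_mp.
  (* Completeness of the limit theory decides the premise: if it holds, the conclusion does; if it
     is refuted, the implication follows by ex falso. *)
  move=> AB; have [HA|[m le_nm HA]] := holds_total (fsub A (fun _ x => lift_to N (ρ _ x))).
    have [m le_nm HB] := AB HA; exists m => //=; apply: prv_impI.
    by apply: prv_weaken HB _ _; right.
  exists m => //=; apply: prv_impI; apply: prv_efq; apply: (prv_impE (A := fsub (fsub A (fun _ x => lift_to N (ρ _ x))) (lift N m))).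
    by apply: prv_weaken HA _ _; right.
  by apply: prv_hyp; left.
- move=> Γ σ A IH ρ N bN.
  have key m (t : tm (C m) σ) : (N <= m)%N ->
      sat A (econs (existT _ m t : term_structure σ) ρ) <->
      holds m (fsub (fsub A (up (fun _ x => lift_to N (ρ _ x)))) (scons t (lift N m))).
    move=> le_Nm; rewrite (IH _ m); last first.
      apply: var_cons_ind => //= τ y; exact: leq_trans (bN _ y) _.
    rewrite fsub_comp scomp_scons_up.
    suff -> : (fun τ x => lift_to m (econs (existT _ m t : term_structure σ) ρ x)) =
      scons t (scomp (lift N m) (fun τ x => lift_to N (ρ τ x))) by [].
    apply: sub_cons_ext => /= [|τ x]; first by rewrite /lift_to /= lift_id tsub_ids.
    by rewrite /scomp /lift_to tsub_comp lift_comp.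
  split.
    move=> HA; apply: contrapT => /holds_witness [m le_Nm [t]]; apply.
    exact/key.
  move=> HA [m t].
  (* The stage [m] of the given element may lie below [N]. Its lift to [maxn N m] is another element
     of the structure, but by the induction hypothesis both turn [A] into the same formula. *)
  have HA' := (holds_lift _ (leq_maxl N m)).2 HA.
  have E : sat A (econs (existT _ (maxn N m) (tsub (lift m (maxn N m)) t) : term_structure σ) ρ).
    apply/key; first exact: leq_maxl.
    case: HA' => l le_l /= Hl; exists l => //.
    by have := prv_allE (tsub (lift (maxn N m) l) (tsub (lift m (maxn N m)) t)) Hl;
       rewrite -finst_fsub finst_up.
  move: E; rewrite (IH _ (maxn N m)); last first.
    by apply: var_cons_ind => //= τ y; apply: leq_trans (bN _ y) (leq_maxl _ _).
  rewrite (IH _ (maxn N m)); last first.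
    by apply: var_cons_ind => /= [|τ y]; [exact: leq_maxr|apply: leq_trans (bN _ y) (leq_maxl _ _)].
  congr (holds _ (fsub A _)); apply: sub_cons_ext => //=.
  by rewrite /lift_to /= lift_id tsub_ids.
Qed.

Lemma term_structure_model : is_model term_structure T.
Proof.
move=> Γ A TA ρ; have [N bN] := below_ex ρ.
by apply/(truth _ bN); apply: holds_prv; apply: prv_ax; apply: Tsub.
Qed.

Lemma term_structure_refutes : exists ρ : env term_structure Γ0, ~ sat A0 ρ.
Proof.
exists (fun _ x => existT (fun n => tm (C n) _) 0%N (Var x)).
rewrite (@truth _ _ _ 0%N) // => HA; apply: (holds_consistent HA).
apply: holds_prv; apply: prv_hyp; left; rewrite /= -[in LHS](fsub_ids A0); congr (Neg (fsub _ _)).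
by apply: sub_ext => τ x; rewrite /lift_to lift_id tsub_ids.
Qed.

End Henkin.

Theorem model_existence (T : theory) :
  (forall Γ Δ (A : fm Γ) (s : sub Γ Δ), T Γ A -> T Δ (fsub A s)) ->
  forall Γ (A : fm Γ), ~ proves T A ->
  exists2 M, is_model M T & exists ρ : env M Γ, ~ sat A ρ.
Proof.
move=> Tsub Γ A nA; exists (term_structure T A); first exact: term_structure_model.
exact: term_structure_refutes.
Qed.

(** * Models with genuine equality *)

Lemma qf_fsub Γ (A : fm Γ) : forall Δ (s : sub Γ Δ), qf A -> qf (fsub A s).
Proof. by elim: A => //= ? ? IHA ? IHB Δ s [? ?]; split; [apply: IHA|apply: IHB]. Qed.

Lemma RCA0w_fsub Γ (A : fm Γ) : RCA0w A -> forall Δ (s : sub Γ Δ), RCA0w (fsub A s).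
Proof.
case=> {Γ A}; try by move=> *; constructor.
- by move=> Γ ρ τ x y Δ s; rewrite EqT_fsub /=; constructor.
- by move=> Γ δ ρ τ x y z Δ s; rewrite EqT_fsub /=; constructor.
- by move=> Γ ρ τ φ x y Δ s; rewrite /= !EqT_fsub /=; constructor.
- move=> Γ A qA Δ s; rewrite /= finst_fsub /=.
  suff -> : fsub (fsub A (scons (#0 + 1)%tm (fun τ x => Var (VS x)))) (up s) =
      fsub (fsub A (up s)) (scons (#0 + 1)%tm (fun τ x => Var (VS x))).
    by constructor; apply: qf_fsub.
  rewrite !fsub_comp scomp_scons_up scomp_scons; congr (fsub _ (scons _ _)).
- move=> Γ A qA Δ s; rewrite /=.
  suff -> : fsub (fsub A (scons (#1 · #0)%tm (scons #0%tm (fun τ x => Var (VS (VS x))))))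
                 (up (up s)) =
      fsub (fsub A (up (up s))) (scons (#1 · #0)%tm (scons #0%tm (fun τ x => Var (VS (VS x))))).
    by apply: ax_QFAC; apply: qf_fsub.
  rewrite !fsub_comp !scomp_scons_up !scomp_scons; congr (fsub _ (scons _ (scons _ _))).
  by apply: sub_ext => τ x; rewrite /scomp /= /wk !tsub_comp.
Qed.

Lemma quantify_fsub q Γ Δ σ (A : fm (σ :: Γ)) (s : sub Γ Δ) :
  fsub (quantify q σ A) s = quantify q σ (fsub A (up s)).
Proof. by case: q. Qed.

Lemma tuple_tsub Γ Δ (l : list (tm Γ ty0)) (s : sub Γ Δ) :
  tsub s (tuple l) = tuple (map (fun t => tsub s t) l).
Proof.
elim: l => // a [|b l] IH //.
by rewrite [tuple _]/= -/(tuple (b :: l)) /pair /= IH.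
Qed.

(* Only for variables: [lam] does not commute with the substitution of compound terms. *)
Lemma kleene_fsub k : forall q Γ Δ (s : sub Γ Δ) f f' gs gs',
  s ty1 f = Var f' -> map (s ty1) gs = map Var gs' ->
  fsub (kleene q k (Var f) (map Var gs)) s = kleene q k (Var f') (map Var gs').
Proof.
elim: k => [|k IH] q Γ Δ s f f' gs gs' Ef Egs; rewrite /= quantify_fsub; congr quantify.
- congr Eq => //; rewrite /= Ef; congr App.
  rewrite tuple_tsub !map_map; congr tuple.
  elim: gs gs' Egs => [|g gs IHg] [|g' gs'] //= [Eg Egs]; congr cons; last exact: IHg.
  by rewrite /initseg /rec0 /= Eg.
- have Em Ξ (l : list (var Ξ ty1)) : map (@wk _ ty1 _) (map Var l) ++ [#0%tm] = map Var (map VS l ++ [VZ]).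
    by rewrite map_app !map_map.
  rewrite !Em; apply: IH; first by rewrite /= Ef.
  rewrite !map_app !map_map /=; congr Datatypes.app.
  elim: gs gs' Egs => [|g gs IHg] [|g' gs'] //= [Eg Egs]; congr cons; last exact: IHg.
  by rewrite Eg.
Qed.

(** * Stability of HBU under substitution *)

Section SubstitutionInHBU.
Variables (Γ Δ : ctx) (s : sub Γ Δ).
Implicit Types (t u : tm Γ ty0) (q r : rat Γ) (x y z : tm Γ ty1).

(** Holds by computation: the step terms of the recursion contain bound variables only, so bracket
    abstraction turns them into closed combinators, which no substitution changes. *)
Lemma tsub_monus t u : tsub s (monus t u) = monus (tsub s t) (tsub s u).
Proof. by []. Qed.

Lemma tsub_sqrt t : tsub s (sqrt t) = sqrt (tsub s t).
Proof. by []. Qed.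

Lemma tsub_pfst t : tsub s (pfst t) = pfst (tsub s t).
Proof.
rewrite /pfst tsub_monus.
rewrite -[tsub s (sqrt t * sqrt t)%tm]/(tsub s (sqrt t) * tsub s (sqrt t))%tm.
by rewrite tsub_sqrt.
Qed.

Lemma tsub_psnd t : tsub s (psnd t) = psnd (tsub s t).
Proof. by rewrite /psnd tsub_monus tsub_pfst tsub_sqrt. Qed.

Definition rat_sub r : rat Δ := Rat (tsub s (rp r)) (tsub s (rm r)) (tsub s (rd r)).

Lemma rat_sub_add q r : rat_sub (radd q r) = radd (rat_sub q) (rat_sub r).
Proof. by []. Qed.

Lemma rat_sub_sub q r : rat_sub (rsub q r) = rsub (rat_sub q) (rat_sub r).
Proof. by []. Qed.

Lemma rat_sub_approx x t : rat_sub (approx x t) = approx (tsub s x) (tsub s t).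
Proof.
rewrite /approx /ratc /rat_sub [rp _]/= [rm _]/= [rd _]/=.
rewrite -[tsub s (_ + 1)%tm]/(tsub s (psnd (psnd (x · t))) + 1)%tm.
by rewrite !(tsub_pfst, tsub_psnd).
Qed.

Lemma rat_sub_eps t : rat_sub (eps t) = eps (tsub s t).
Proof. by []. Qed.

Lemma rat_sub_eps2 t : rat_sub (eps2 t) = eps2 (tsub s t).
Proof. by []. Qed.

Lemma fsub_rlt q r : fsub (rlt q r) s = rlt (rat_sub q) (rat_sub r).
Proof. by []. Qed.

Lemma fsub_rabs_lt q r : fsub (rabs_lt q r) s = rabs_lt (rat_sub q) (rat_sub r).
Proof. by []. Qed.

Lemma fsub_rabs_le q r : fsub (rabs_le q r) s = rabs_le (rat_sub q) (rat_sub r).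
Proof. by []. Qed.

End SubstitutionInHBU.

Definition rat_subE :=
  (rat_sub_add, rat_sub_sub, rat_sub_approx, rat_sub_eps, rat_sub_eps2).

Lemma fsub_Ex Γ Δ (s : sub Γ Δ) σ (A : fm (σ :: Γ)) : fsub (Ex σ A) s = Ex σ (fsub A (up s)).
Proof. by []. Qed.

Lemma fsub_All Γ Δ (s : sub Γ Δ) σ (A : fm (σ :: Γ)) :
  fsub (All σ A) s = All σ (fsub A (up s)).
Proof. by []. Qed.

Lemma fsub_And Γ Δ (s : sub Γ Δ) A B : fsub (And A B) s = And (fsub A s) (fsub B s).
Proof. by []. Qed.

Lemma fsub_Imp Γ Δ (s : sub Γ Δ) A B : fsub (Imp A B) s = Imp (fsub A s) (fsub B s).
Proof. by []. Qed.

Lemma fsub_Neg Γ Δ (s : sub Γ Δ) A : fsub (Neg A) s = Neg (fsub A s).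
Proof. by []. Qed.

Section SubstitutionInReals.
Variables (Γ Δ : ctx) (s : sub Γ Δ).
Implicit Types (x y z : tm Γ ty1).

Lemma fsub_is_real x : fsub (is_real x) s = is_real (tsub s x).
Proof. by rewrite /is_real !fsub_All fsub_rabs_lt !rat_subE !wk_tsub. Qed.

Lemma fsub_real_eq x y : fsub (real_eq x y) s = real_eq (tsub s x) (tsub s y).
Proof. by rewrite /real_eq !fsub_All fsub_rabs_le !rat_subE !wk_tsub. Qed.

Lemma fsub_real_lt x y : fsub (real_lt x y) s = real_lt (tsub s x) (tsub s y).
Proof. by rewrite /real_lt !fsub_Ex fsub_rlt !rat_subE !wk_tsub. Qed.

Lemma fsub_real_lt_add x y z :
  fsub (real_lt_add x y z) s = real_lt_add (tsub s x) (tsub s y) (tsub s z).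
Proof. by rewrite /real_lt_add !fsub_Ex fsub_rlt !rat_subE !wk_tsub. Qed.

Lemma fsub_real_sub_lt x y z :
  fsub (real_sub_lt x y z) s = real_sub_lt (tsub s x) (tsub s y) (tsub s z).
Proof. by rewrite /real_sub_lt !fsub_Ex fsub_rlt !rat_subE !wk_tsub. Qed.

Lemma fsub_in_unit x : fsub (in_unit x) s = in_unit (tsub s x).
Proof.
rewrite /in_unit /real_le !fsub_And fsub_is_real.
by rewrite 2!fsub_Neg !fsub_real_lt.
Qed.

End SubstitutionInReals.

Definition fsub_realE := (fsub_is_real, fsub_real_eq, fsub_real_lt, fsub_real_lt_add,
  fsub_real_sub_lt, fsub_in_unit).

(** The formula has no free variables but lives in a context. The substitution is pushed inwards one
    notion at a time, which keeps the large arithmetical terms folded. *)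
Lemma HBU_fsub Γ Δ (s : sub Γ Δ) : fsub HBU s = HBU.
Proof.
rewrite /HBU /pos_fun.
by rewrite !(fsub_All, fsub_Imp, fsub_Ex, fsub_And, fsub_realE).
Qed.

Lemma Pi1CA0w_HBU_fsub k Γ (A : fm Γ) : Pi1CA0w_HBU k A ->
  forall Δ (s : sub Γ Δ), Pi1CA0w_HBU k (fsub A s).
Proof.
case=> {Γ A} Γ => [A [{}Γ {}A HA|{A}Γ]|] Δ s.
- by do 2 constructor; apply: RCA0w_fsub.
- apply: CAH_CA; suff -> : fsub (Sk_axiom k) s = Sk_axiom k by apply: CA_Sk.
  by rewrite /Sk_axiom /= (kleene_fsub _ _ (f' := VZ) (gs := []) (gs' := [])).
- by rewrite HBU_fsub; apply: CAH_HBU.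
Qed.

(** * Quotient of a model by extensional equality *)

Section Quotient.
Variables (T : Type) (R : T -> T -> Prop).
Hypotheses (Rr : forall x, R x x) (Rs : forall x y, R x y -> R y x)
  (Rt : forall x y z, R x y -> R y z -> R x z).

Definition quot := {P : T -> Prop | exists x, P = R x}.
Definition cls (x : T) : quot := exist _ (R x) (ex_intro _ x erefl).
Definition repr (u : quot) : T := sval (cid (svalP u)).

Lemma clsP x y : cls x = cls y <-> R x y.
Proof.
split=> [/(congr1 sval) /= -> //|xy]; apply: eq_exist => /=; apply: funext => z.
by apply: propext; split=> [xz|yz]; [apply: Rt xz; apply: Rs|apply: Rt yz].
Qed.

Lemma repr_cls u : cls (repr u) = u.
Proof. by rewrite /repr; case: cid => x /= E; case: u E => P HP /= E; apply: eq_exist. Qed.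

Lemma cls_repr x : R (repr (cls x)) x.
Proof. by apply/clsP; rewrite repr_cls. Qed.

End Quotient.

Section NormalModel.
Variable M : structure.

Fixpoint eqd (τ : ty) : M τ -> M τ -> Prop :=
  match τ return M τ -> M τ -> Prop with
  | ty0 => fun a b => deq a b
  | arr σ τ => fun a b => forall c : M σ, eqd (app a c) (app b c)
  end.

Lemma sat_EqT τ : forall Γ (ρ : env M Γ) (t u : tm Γ τ),
  sat (EqT t u) ρ <-> eqd (eval ρ t) (eval ρ u).
Proof.
elim: τ => //= σ _ τ IH Γ ρ t u.
by split=> H c; have := H c; rewrite IH /= !eval_wk.
Qed.

Hypothesis HM : is_model M RCA0w.

Lemma deq_refl a : @deq M a a.
Proof. exact: (HM (@ax_refl [ty0] #0%tm) (econs a enil)). Qed.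
Lemma deq_sym a b : @deq M a b -> deq b a.
Proof. exact: (HM (@ax_sym [ty0; ty0] #0%tm #1%tm) (econs a (econs b enil))). Qed.
Lemma deq_trans a b c : @deq M a b -> deq b c -> deq a c.
Proof.
exact: (HM (@ax_trans [ty0; ty0; ty0] #0%tm #1%tm #2%tm) (econs a (econs b (econs c enil)))).
Qed.
Lemma dlt_deq a a' b b' : @deq M a a' -> deq b b' -> dlt a b -> dlt a' b'.
Proof.
exact: (HM (@ax_lt_eq [ty0; ty0; ty0; ty0] #0%tm #1%tm #2%tm #3%tm)
           (econs a (econs a' (econs b (econs b' enil))))).
Qed.

Lemma eqd_refl τ (a : M τ) : eqd a a.
Proof. by elim: τ a => [|σ _ τ IH] a /=; [apply: deq_refl|]. Qed.
Lemma eqd_sym τ (a b : M τ) : eqd a b -> eqd b a.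
Proof. by elim: τ a b => [|σ _ τ IH] a b /=; [apply: deq_sym|move=> E c; apply: IH]. Qed.
Lemma eqd_trans τ (a b c : M τ) : eqd a b -> eqd b c -> eqd a c.
Proof.
elim: τ a b c => [|σ _ τ IH] a b c /=; first exact: deq_trans.
by move=> E1 E2 d; apply: IH (E1 d) (E2 d).
Qed.
(** Congruence in the function is the definition of [eqd]; congruence in the argument is what the
    extensionality axiom provides. *)
Lemma eqd_app σ τ (f g : M (σ ⇒ τ)%ty) a b : eqd f g -> eqd a b -> eqd (app f a) (app g b).
Proof.
move=> Ef Ea; apply: (@eqd_trans _ _ (app f b)); last exact: Ef.
have := HM (@ax_ext [(σ ⇒ τ)%ty; σ; σ] _ _ #0%tm #1%tm #2%tm)
  (econs f (econs a (econs b enil))).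
by rewrite /= !sat_EqT; apply.
Qed.

Definition normalization : structure :=
  @Structure (fun τ => quot (@eqd τ))
    (fun σ τ f a => cls (@eqd _) (app (repr f) (repr a)))
    (fun σ c => cls (@eqd _) (cint M c))
    (fun a b => a = b)
    (fun a b => dlt (repr a) (repr b)).

Notation cl a := (cls (@eqd _) a).
Definition cl_env Γ (ρ : env M Γ) : env normalization Γ := fun _ x => cl (ρ _ x).

Lemma clP τ (a b : M τ) : cl a = cl b <-> eqd a b.
Proof. by apply: clsP; [exact: eqd_refl|exact: eqd_sym|exact: eqd_trans]. Qed.

Lemma repr_cl τ (a : M τ) : eqd (repr (cl a)) a.
Proof. by apply/clP; rewrite repr_cls. Qed.

Lemma app_cl σ τ (f : M (σ ⇒ τ)%ty) a :
  @app normalization _ _ (cl f) (cl a) = cl (app f a).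
Proof. by apply/clP; apply: eqd_app; apply: repr_cl. Qed.

Lemma eval_cl Γ (ρ : env M Γ) τ (t : tm Γ τ) : eval (cl_env ρ) t = cl (eval ρ t).
Proof.
elim: t => [//|//|σ τ' u Eu v Ev].
exact: etrans (f_equal2 (@app normalization _ _) Eu Ev) (app_cl _ _).
Qed.

Lemma cl_econs Γ σ (a : M σ) (ρ : env M Γ) :
  cl_env (econs a ρ) = econs (cl a : normalization σ) (cl_env ρ).
Proof. exact: sub_cons_ext. Qed.

Lemma sat_cl Γ (A : fm Γ) : forall ρ : env M Γ, sat A (cl_env ρ) <-> sat A ρ.
Proof.
elim: A => {Γ} /=.
- by move=> Γ u v ρ; rewrite !eval_cl clP.
- move=> Γ u v ρ; rewrite !eval_cl /=.
  have Ra a : deq (repr (cls (@eqd ty0) a)) a := repr_cl (a : M ty0).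
  by split; apply: dlt_deq => //; apply: deq_sym.
- by [].
- by move=> Γ A IHA B IHB ρ; rewrite IHA IHB.
- move=> Γ σ A IH ρ; split=> HA a.
    by apply/IH; rewrite cl_econs.
  by have := HA (repr a); rewrite -IH cl_econs repr_cls.
Qed.

Lemma normalization_model T : is_model M T -> is_model normalization T.
Proof.
move=> MT Γ A TA ρ.
have -> : ρ = cl_env (fun _ x => repr (ρ _ x)).
  by apply: sub_ext => τ x; rewrite /cl_env repr_cls.
by apply/sat_cl; apply: MT.
Qed.

(** Agreement is known only on the chosen representatives, so an arbitrary argument [c] is first
    replaced by [repr (cl c)]. *)
Lemma normalization_ext σ τ (f g : normalization (σ ⇒ τ)%ty) :
  (forall a, app f a = app g a) -> f = g.
Proof.
move=> E; rewrite -(repr_cls f) -(repr_cls g); apply/clP => /= c.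
apply: (@eqd_trans _ _ (app (repr f) (repr (cl c)))).
  by apply: eqd_app; [exact: eqd_refl|apply: eqd_sym; apply: repr_cl].
apply: (@eqd_trans _ _ (app (repr g) (repr (cl c)))).
  by apply/clP; exact: (E (cl c)).
by apply: eqd_app; [exact: eqd_refl|apply: repr_cl].
Qed.

End NormalModel.

Record normal (M : structure) : Prop := Normal {
  deqE : forall a b : M ty0, deq a b = (a = b);
  app_ext : forall σ τ (f g : M (σ ⇒ τ)%ty), (forall a, app f a = app g a) -> f = g }.

(** The bridge from derivability to truth: everything after this theorem argues inside a model with
    genuine equality. *)
Theorem normal_completeness (T : theory) :
  (forall Γ Δ (A : fm Γ) (s : sub Γ Δ), T Γ A -> T Δ (fsub A s)) ->
  (forall Γ (A : fm Γ), RCA0w A -> T Γ A) ->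
  forall Γ (A : fm Γ),
  (forall M, normal M -> is_model M T -> forall ρ : env M Γ, sat A ρ) -> proves T A.
Proof.
move=> Tsub TR Γ A HA; apply: contrapT => nA.
have [M MT [ρ nρ]] := model_existence Tsub nA; apply: nρ.
have MR : is_model M RCA0w by move=> ? ? /TR; apply: MT.
apply/(sat_cl MR); apply: HA; last exact: normalization_model.
by split=> //; apply: normalization_ext.
Qed.

(** * Ordered semirings embed into ordered fields *)

(** Because of [os_sub], a formal difference is zero, an element, or the negative of an element, and
    this orders the ring of differences. *)
Record ordered_semiring := OrderedSemiring {
  os_sort :> Type;
  os_zero : os_sort; os_one : os_sort;
  os_add : os_sort -> os_sort -> os_sort;
  os_mul : os_sort -> os_sort -> os_sort;
  os_lt : os_sort -> os_sort -> Prop;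
  os_addA : associative os_add;
  os_addC : commutative os_add;
  os_add0 : left_id os_zero os_add;
  os_mulA : associative os_mul;
  os_mulC : commutative os_mul;
  os_mul1 : left_id os_one os_mul;
  os_mulDl : left_distributive os_mul os_add;
  os_mul0 : left_zero os_zero os_mul;
  os_lt_irr : forall x, ~ os_lt x x;
  os_lt_trans : forall x y z, os_lt x y -> os_lt y z -> os_lt x z;
  os_lt_total : forall x y, os_lt x y \/ x = y \/ os_lt y x;
  os_lt_add : forall x y z, os_lt x y -> os_lt (os_add x z) (os_add y z);
  os_lt_mul : forall x y z, os_lt os_zero z -> os_lt x y -> os_lt (os_mul x z) (os_mul y z);
  os_lt01 : os_lt os_zero os_one;
  os_sub : forall x y, os_lt x y -> exists2 z, os_lt os_zero z & y = os_add x z }.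

HB.instance Definition _ (S : ordered_semiring) := gen_eqMixin S.
HB.instance Definition _ (S : ordered_semiring) := gen_choiceMixin S.
HB.instance Definition _ (S : ordered_semiring) :=
  GRing.isNmodule.Build S (@os_addA S) (@os_addC S) (@os_add0 S).

Lemma os_one_neq0 (S : ordered_semiring) : os_one S != os_zero S.
Proof. by apply/eqP => E; have := os_lt01 S; rewrite E; apply: os_lt_irr. Qed.

HB.instance Definition _ (S : ordered_semiring) :=
  GRing.Nmodule_isComNzSemiRing.Build S (@os_mulA S) (@os_mulC S) (@os_mul1 S)
    (@os_mulDl S) (@os_mul0 S) (os_one_neq0 S).

Import Order.TTheory GRing.Theory Num.Theory.
Local Open Scope ring_scope.

(** * The ring of differences and its ordered field of fractions *)

Section Differences.
Variable S : ordered_semiring.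
Implicit Types a b c d : S.

Lemma os_addI a : injective (+%R a).
Proof.
move=> b c E; have [H|[//|H]] := os_lt_total b c; exfalso.
- by have := os_lt_add a H; rewrite !(os_addC _ a); rewrite [os_add a b]E; apply: os_lt_irr.
- by have := os_lt_add a H; rewrite !(os_addC _ a); rewrite [os_add a b]E; apply: os_lt_irr.
Qed.

(** The Grothendieck construction, where [(a, b)] stands for [a - b]; transitivity needs the
    cancellation law [os_addI]. *)
Definition eqdiff (x y : S * S) : Prop := x.1 + y.2 = y.1 + x.2.

Lemma eqdiff_refl x : eqdiff x x. Proof. by []. Qed.
Lemma eqdiff_sym x y : eqdiff x y -> eqdiff y x. Proof. by []. Qed.
Lemma eqdiff_trans x y z : eqdiff x y -> eqdiff y z -> eqdiff x z.
Proof.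
rewrite /eqdiff => E1 E2; apply: (@os_addI y.2).
have -> : y.2 + (x.1 + z.2) = (x.1 + y.2) + z.2 by ring.
have -> : y.2 + (z.1 + x.2) = (z.1 + y.2) + x.2 by ring.
by rewrite E1 -E2; ring.
Qed.

Definition diff : Type := quot eqdiff.
Definition mkd a b : diff := cls eqdiff (a, b).

Lemma mkdP a b c d : mkd a b = mkd c d <-> a + d = c + b.
Proof.
by rewrite clsP; [|exact: eqdiff_refl|exact: eqdiff_sym|exact: eqdiff_trans].
Qed.

Lemma diff_ind (P : diff -> Prop) : (forall a b, P (mkd a b)) -> forall u, P u.
Proof. by move=> HP u; rewrite -(repr_cls u); case: (repr u). Qed.

Definition addd (u v : diff) := mkd ((repr u).1 + (repr v).1) ((repr u).2 + (repr v).2).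
Definition oppd (u : diff) := mkd (repr u).2 (repr u).1.
Definition muld (u v : diff) := let x := repr u in let y := repr v in
  mkd (x.1 * y.1 + x.2 * y.2) (x.1 * y.2 + x.2 * y.1).

Lemma repr_mkd a b : (repr (mkd a b)).1 + b = a + (repr (mkd a b)).2.
Proof.
exact: (cls_repr eqdiff_refl eqdiff_sym eqdiff_trans (a, b)).
Qed.

Lemma adddE a b c d : addd (mkd a b) (mkd c d) = mkd (a + c) (b + d).
Proof.
rewrite /addd; move: (repr_mkd a b) (repr_mkd c d).
move: (repr (mkd a b)) (repr (mkd c d)) => [p q] [r s] /= E1 E2; apply/mkdP.
have -> : p + r + (b + d) = (p + b) + (r + d) by ring.
by rewrite E1 E2; ring.
Qed.

Lemma oppdE a b : oppd (mkd a b) = mkd b a.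
Proof.
rewrite /oppd; move: (repr_mkd a b); move: (repr _) => [p q] /= E; apply/mkdP.
by rewrite addrC -E addrC.
Qed.

Lemma muldE a b c d : muld (mkd a b) (mkd c d) = mkd (a * c + b * d) (a * d + b * c).
Proof.
rewrite /muld; move: (repr_mkd a b) (repr_mkd c d).
move: (repr (mkd a b)) (repr (mkd c d)) => [p q] [r s] /= E1 E2.
apply: (@eq_trans _ _ (mkd (a * r + b * s) (a * s + b * r))); apply/mkdP.
- have -> : p * r + q * s + (a * s + b * r) = (p + b) * r + (a + q) * s by ring.
  have -> : a * r + b * s + (p * s + q * r) = (a + q) * r + (p + b) * s by ring.
  by rewrite E1.
- have -> : a * r + b * s + (a * d + b * c) = a * (r + d) + b * (c + s) by ring.
  have -> : a * c + b * d + (a * s + b * r) = a * (c + s) + b * (r + d) by ring.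
  by rewrite E2.
Qed.

HB.instance Definition _ := gen_eqMixin diff.
HB.instance Definition _ := gen_choiceMixin diff.

Fact adddA : associative addd.
Proof.
by elim/diff_ind=> a b; elim/diff_ind=> c d; elim/diff_ind=> e f; rewrite !adddE !addrA.
Qed.
Fact adddC : commutative addd.
Proof. by elim/diff_ind=> a b; elim/diff_ind=> c d; rewrite !adddE addrC (addrC b). Qed.
Fact add0d : left_id (mkd 0 0) addd.
Proof. by elim/diff_ind=> a b; rewrite adddE !add0r. Qed.
Fact addNd : left_inverse (mkd 0 0) oppd addd.
Proof. by elim/diff_ind=> a b; rewrite oppdE adddE; apply/mkdP; ring. Qed.

HB.instance Definition _ := GRing.isZmodule.Build diff adddA adddC add0d addNd.

Fact muldA : associative muld.
Proof.
elim/diff_ind=> a b; elim/diff_ind=> c d; elim/diff_ind=> e f; rewrite !muldE.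
by apply/mkdP; ring.
Qed.
Fact muldC : commutative muld.
Proof. by elim/diff_ind=> a b; elim/diff_ind=> c d; rewrite !muldE; apply/mkdP; ring. Qed.
Fact mul1d : left_id (mkd 1 0) muld.
Proof. by elim/diff_ind=> a b; rewrite muldE; apply/mkdP; ring. Qed.
Fact muldDl : left_distributive muld addd.
Proof.
elim/diff_ind=> a b; elim/diff_ind=> c d; elim/diff_ind=> e f.
by rewrite !(muldE, adddE); apply/mkdP; ring.
Qed.
Fact one_neq0d : mkd 1 0 != mkd 0 0.
Proof. by apply/eqP => /mkdP; rewrite !addr0; apply/eqP; apply: os_one_neq0. Qed.

HB.instance Definition _ :=
  GRing.Zmodule_isComNzRing.Build diff muldA muldC mul1d muldDl one_neq0d.

(** The integral domains over which the fraction field is built carry a decidable set of units and a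
    total inverse; both are supplied classically. *)
Definition unitd : {pred diff} := fun u => `[< exists v : diff, v * u = 1 >].
Definition invd (u : diff) : diff :=
  if pselect (exists v : diff, v * u = 1) is left H then sval (cid H) else u.

Fact mulVd : {in unitd, left_inverse 1 invd *%R}.
Proof. by move=> u /asboolP H; rewrite /invd; case: pselect => // ?; case: cid. Qed.
Fact unitPl_d (u v : diff) : v * u = 1 -> unitd u.
Proof. by move=> E; apply/asboolP; exists v. Qed.
Fact invd_out : {in [predC unitd], invd =1 id}.
Proof.
move=> u; rewrite inE => /asboolPn nu; rewrite /invd; by case: pselect.
Qed.

HB.instance Definition _ := GRing.ComNzRing_hasMulInverse.Build diff mulVd unitPl_d invd_out.

Definition posd (u : diff) : Prop := exists2 a, os_lt 0 a & u = mkd a 0.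

Lemma posd_mul u v : posd u -> posd v -> posd (u * v).
Proof.
move=> [a a0 ->] [b b0 ->]; exists (a * b).
  by have := os_lt_mul b0 a0; rewrite -[os_mul _ _]/(0 * b) mul0r.
by rewrite [LHS]muldE; apply/mkdP; ring.
Qed.

Lemma posd_add u v : posd u -> posd v -> posd (u + v).
Proof.
move=> [a a0 ->] [b b0 ->]; exists (a + b); last by rewrite [LHS]adddE addr0.
apply: os_lt_trans b0 _; have := os_lt_add b a0.
by rewrite -[os_add _ _]/(0 + b) add0r.
Qed.

Lemma posd_irr : ~ posd 0.
Proof.
move=> [a a0 /mkdP]; rewrite addr0 addr0 => E.
by move: a0; rewrite -E; apply: os_lt_irr.
Qed.

Lemma posd_total u : posd u \/ u = 0 \/ posd (- u).
Proof.
elim/diff_ind: u => a b; have [/os_sub [c c0 ->]|[->|/os_sub [c c0 ->]]] := os_lt_total a b.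
- by right; right; exists c => //; rewrite [LHS]oppdE; apply/mkdP; rewrite addr0 -[os_add _ _]/(a + c) addrC.
- by right; left; apply/mkdP; ring.
- by left; exists c => //; apply/mkdP; rewrite addr0 -[os_add _ _]/(b + c) addrC.
Qed.

Fact diff_integral : GRing.integral_domain_axiom diff.
Proof.
move=> u v uv0; apply/orP.
have [Pu|[->|Pu]] := posd_total u; [|by left|]; (have [Pv|[->|Pv]] := posd_total v; [|by right|]).
- by case: posd_irr; rewrite -uv0; apply: posd_mul.
- by case: posd_irr; rewrite -[0]oppr0 -uv0 -mulrN; apply: posd_mul.
- by case: posd_irr; rewrite -[0]oppr0 -uv0 -mulNr; apply: posd_mul.
- by case: posd_irr; rewrite -uv0 -mulrNN; apply: posd_mul.
Qed.

HB.instance Definition _ := GRing.ComUnitRing_isIntegral.Build diff diff_integral.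

Local Notation "x %:F" := (@tofrac diff x).

Definition quo : Type := {fraction diff}.
HB.instance Definition _ := GRing.Field.on quo.

Definition emb a : quo := tofrac (mkd a 0).

Definition posq (x : quo) : Prop := exists u v : diff, posd u /\ posd v /\ x = u%:F / v%:F.

Lemma posd_neq0 u : posd u -> u%:F != 0.
Proof. by move=> Pu; rewrite tofrac_eq0; apply/eqP => E; apply: posd_irr; rewrite -E. Qed.

Lemma posq_add x y : posq x -> posq y -> posq (x + y).
Proof.
move=> [u [v [Pu [Pv ->]]]] [u' [v' [Pu' [Pv' ->]]]].
exists (u * v' + u' * v), (v * v'); split; first by apply: posd_add; apply: posd_mul.
split; first exact: posd_mul.
have v0 := posd_neq0 Pv; have v0' := posd_neq0 Pv'.
by rewrite addf_div // tofracD !tofracM.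
Qed.

Lemma posq_mul x y : posq x -> posq y -> posq (x * y).
Proof.
move=> [u [v [Pu [Pv ->]]]] [u' [v' [Pu' [Pv' ->]]]].
exists (u * u'), (v * v'); split; first exact: posd_mul.
split; first exact: posd_mul.
by rewrite mulf_div !tofracM.
Qed.

Lemma posq_irr : ~ posq 0.
Proof.
move=> [u [v [Pu [Pv /esym/eqP]]]].
by rewrite mulf_eq0 invr_eq0 (negbTE (posd_neq0 Pu)) (negbTE (posd_neq0 Pv)).
Qed.

Lemma tofracP (x : quo) : exists u v : diff, v != 0 /\ x = u%:F / v%:F.
Proof.
elim/quotW: x => x; exists (frac x).1, (frac x).2; split; first exact: denom_ratioP.
have v0 : (frac x).2%:F != 0 by rewrite tofrac_eq0 denom_ratioP.
apply: (mulIf v0); rewrite divfK //; unlock FracField.tofrac.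
rewrite -[LHS]FracField.pi_mul; apply/eqmodP; rewrite /= FracField.equivfE.
rewrite /FracField.mulf /= !numden_Ratio ?(oner_neq0, mulr1, denom_ratioP) //.
by rewrite mulrC.
Qed.

Lemma posq_total x : x != 0 -> posq x \/ posq (- x).
Proof.
have [u [v [v0 ->]]] := tofracP x; move=> uv0.
have u0 : u != 0 by apply: contraNneq uv0 => ->; rewrite tofrac0 mul0r.
have {uv0} [Pu|[/eqP|Pu]] := posd_total u; last 1 first; rewrite ?(negbTE u0) //.
- have [Pv|[/eqP|Pv]] := posd_total v; [right|by rewrite (negbTE v0)|left].
  + by exists (- u), v; rewrite tofracN mulNr.
  + by exists (- u), (- v); rewrite !tofracN invrN mulrNN.
- have [Pv|[/eqP|Pv]] := posd_total v; [left|by rewrite (negbTE v0)|right].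
  + by exists u, v.
  + by exists u, (- v); rewrite !tofracN invrN mulrN.
Qed.

Definition ltq (x y : quo) : bool := `[< posq (y - x) >].
Definition leq_quo (x y : quo) : bool := (x == y) || ltq x y.
Definition normq (x : quo) : quo := if ltq 0 x then x else - x.

Fact ltq_add x y : ltq 0 x -> ltq 0 y -> ltq 0 (x + y).
Proof. by rewrite /ltq !subr0 => /asboolP Px /asboolP Py; apply/asboolP/posq_add. Qed.
Fact ltq_mul x y : ltq 0 x -> ltq 0 y -> ltq 0 (x * y).
Proof. by rewrite /ltq !subr0 => /asboolP Px /asboolP Py; apply/asboolP/posq_mul. Qed.
Fact ltq_asym x : ltq 0 x -> ~~ ltq x 0.
Proof.
rewrite /ltq subr0 sub0r => /asboolP Px; apply/asboolPn => Pn.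
by apply: posq_irr; rewrite -(subrr x); apply: posq_add.
Qed.
Fact ltq_sub x y : ltq 0 (y - x) = ltq x y.
Proof. by rewrite /ltq subr0. Qed.
Fact ltq_total x : x != 0 -> ltq 0 x || ltq x 0.
Proof.
by rewrite /ltq subr0 sub0r => /posq_total [] Px; apply/orP; [left|right]; apply/asboolP.
Qed.
Fact normqN x : normq (- x) = normq x.
Proof.
rewrite /normq; have [->|x0] := eqVneq x 0; first by rewrite !oppr0.
have EN y : ltq 0 (- y) = ltq y 0 by rewrite -(ltq_sub y) sub0r.
rewrite EN opprK; case: ifP => xn.
  by rewrite ifN //; apply: contraL xn => /ltq_asym.
by have := ltq_total x0; rewrite xn orbF => ->.
Qed.
Fact ge0_normq x : leq_quo 0 x -> normq x = x.
Proof. by rewrite /leq_quo /normq => /predU1P [<-|->] //; rewrite oppr0 if_same. Qed.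
Fact leq_quo_def x y : leq_quo x y = (x == y) || ltq x y.
Proof. by []. Qed.

HB.instance Definition _ := Num.IntegralDomain_isLtReal.Build quo
  ltq_add ltq_mul ltq_asym ltq_sub ltq_total normqN ge0_normq leq_quo_def.

Lemma ltr_emb a b : (emb a < emb b) <-> os_lt a b.
Proof.
have lt_emb c d : os_lt c d -> emb c < emb d.
  move=> /os_sub [e e0 ->]; apply/asboolP.
  exists (mkd e 0), 1; split; first by exists e.
  split; first by exists 1; [exact: os_lt01|].
  rewrite tofrac1 divr1 /emb -tofracB; congr _%:F.
  by rewrite -[LHS]/(addd (mkd _ _) (oppd (mkd _ _))) oppdE adddE; apply/mkdP; rewrite -[os_add _ _]/(c + e); ring.
split=> [ab|]; last exact: lt_emb.
have [//|[E|/lt_emb ba]] := os_lt_total a b; first by rewrite E ltxx in ab.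
by have := lt_trans ab ba; rewrite ltxx.
Qed.

End Differences.

Theorem ordered_semiring_embedding (S : ordered_semiring) :
  exists (F : realFieldType) (ι : S -> F),
    [/\ ι (os_zero S) = 0, ι (os_one S) = 1,
        {morph ι : a b / os_add a b >-> a + b},
        {morph ι : a b / os_mul a b >-> a * b} &
        forall a b, (ι a < ι b) <-> os_lt a b].
Proof.
exists (quo S), (@emb S); split; last exact: ltr_emb.
- exact: tofrac0.
- exact: tofrac1.
- by move=> a b; rewrite /emb -tofracD; congr tofrac; rewrite [RHS]adddE; apply/mkdP; rewrite -[os_add a b]/(a + b); ring.
- by move=> a b; rewrite /emb -tofracM; congr tofrac; rewrite [RHS]muldE; apply/mkdP; rewrite -[os_mul a b]/(a * b); ring.
Qed.

(** * Arithmetic in a model *)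

Record arith_model := ArithModel {
  am_struct :> structure;
  am_normal : normal am_struct;
  am_RCA0w : is_model am_struct RCA0w }.

Declare Scope dom_scope.
Delimit Scope dom_scope with D.
Infix "·" := app : dom_scope.
Notation "0" := (cint _ CZero) : dom_scope.
Notation "1" := (cint _ COne) : dom_scope.
Notation "x + y" := (cint _ CPlus · x · y)%D : dom_scope.
Notation "x * y" := (cint _ CTimes · x · y)%D : dom_scope.
Notation "x < y" := (dlt x y) : dom_scope.
Local Close Scope ring_scope.
Local Open Scope dom_scope.

Definition dle {M : structure} (a b : M ty0) : Prop := a < b \/ a = b.
Notation "x <= y" := (dle x y) : dom_scope.

Lemma orP_classic (P Q : Prop) : ((P -> False) -> Q) <-> P \/ Q.
Proof.
split; last by move=> [HP nP|HQ _].
by move=> H; have [HP|/H HQ] := pselect P; [left|right].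
Qed.

Section SatConnectives.
Variables (M : structure) (Γ : ctx) (ρ : env M Γ).

Lemma sat_Neg A : sat (Neg A) ρ <-> ~ sat A ρ. Proof. by []. Qed.
Lemma sat_Or A B : sat (Or A B) ρ <-> sat A ρ \/ sat B ρ.
Proof. exact: orP_classic. Qed.
Lemma sat_And A B : sat (And A B) ρ <-> sat A ρ /\ sat B ρ.
Proof.
split=> [H|[HA HB] H]; last exact: H HA HB.
by split; apply: contrapT => n; apply: H => // ? ?.
Qed.
Lemma sat_Imp A B : sat (Imp A B) ρ <-> (sat A ρ -> sat B ρ). Proof. by []. Qed.
Lemma sat_Iff A B : sat (Iff A B) ρ <-> (sat A ρ <-> sat B ρ).
Proof. by rewrite /Iff sat_And. Qed.
Lemma sat_All σ A : sat (All σ A) ρ <-> forall a : M σ, sat A (econs a ρ).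
Proof. by []. Qed.
Lemma sat_Ex σ A : sat (Ex σ A) ρ <-> exists a : M σ, sat A (econs a ρ).
Proof.
split=> [H|[a Ha] H]; last exact: H a Ha.
by apply: contrapT => n; apply: H => a Ha; apply: n; exists a.
Qed.

End SatConnectives.

Section BasicArithmetic.
Variable M : arith_model.
Implicit Types a b c n : M ty0.

Lemma sat_Eq Γ (ρ : env M Γ) s t : sat (Eq s t) ρ <-> eval ρ s = eval ρ t.
Proof. by rewrite /= (deqE (am_normal M)). Qed.

Lemma sat_Le Γ (ρ : env M Γ) s t : sat (Le s t) ρ <-> eval ρ s <= eval ρ t.
Proof. by rewrite /Le sat_Or sat_Eq. Qed.

Lemma eqdE τ (u v : M τ) : eqd u v <-> u = v.
Proof.
elim: τ u v => [|σ _ τ IH] u v /=; first by rewrite (deqE (am_normal M)).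
split=> [H|-> c]; last exact/IH.
by apply: (app_ext (am_normal M)) => c; apply/IH.
Qed.

Lemma PiE ρ τ (x : M ρ) (y : M τ) : cint M (CPi ρ τ) · x · y = x.
Proof.
have := am_RCA0w (@ax_Pi [ρ; τ] ρ τ #0%tm #1%tm) (econs x (econs y enil)).
by rewrite sat_EqT eqdE.
Qed.

Lemma SigmaE δ ρ τ (x : M (δ ⇒ ρ ⇒ τ)%ty) (y : M (δ ⇒ ρ)%ty) (z : M δ) :
  cint M (CSigma δ ρ τ) · x · y · z = x · z · (y · z).
Proof.
have := am_RCA0w (@ax_Sigma [(δ ⇒ ρ ⇒ τ)%ty; (δ ⇒ ρ)%ty; δ] δ ρ τ #0%tm #1%tm #2%tm)
  (econs x (econs y (econs z enil))).
by rewrite sat_EqT eqdE.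
Qed.

Lemma eval_lam_var Γ (ρ : env M Γ) σ τ (x : var (σ :: Γ) τ) (a : M σ) :
  eval ρ (lam_var x) · a = econs a ρ x.
Proof.
move: τ x; apply: var_cons_ind => [|τ y] /=; first by rewrite SigmaE !PiE.
by rewrite PiE.
Qed.

Lemma eval_lam Γ (ρ : env M Γ) σ τ (t : tm (σ :: Γ) τ) (a : M σ) :
  eval ρ (lam t) · a = eval (econs a ρ) t.
Proof.
elim: t => [τ' x|τ' c|σ' τ' u IHu v IHv] /=; first exact: eval_lam_var.
  by rewrite PiE.
by rewrite SigmaE IHu IHv.
Qed.

Lemma Rec0E (f : M (ty0 ⇒ ty0 ⇒ ty0)%ty) m : cint M (CRec ty0) · f · m · 0 = m.
Proof.
by have := am_RCA0w (@ax_Rec0 [_; ty0] #0%tm #1%tm) (econs f (econs m enil)); rewrite sat_Eq.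
Qed.

Lemma RecSE (f : M (ty0 ⇒ ty0 ⇒ ty0)%ty) m n :
  cint M (CRec ty0) · f · m · (n + 1) = f · n · (cint M (CRec ty0) · f · m · n).
Proof.
by have := am_RCA0w (@ax_RecS [_; ty0; ty0] #0%tm #1%tm #2%tm)
  (econs f (econs m (econs n enil))); rewrite sat_Eq.
Qed.

Notation env1 a := (econs a enil).
Notation env2 a b := (econs a (env1 b)).
Notation env3 a b c := (econs a (env2 b c)).

Lemma daddA a b c : (a + b) + c = a + (b + c).
Proof. by have := am_RCA0w (@ax_addA [_; _; _] #0%tm #1%tm #2%tm) (env3 a b c); rewrite sat_Eq. Qed.
Lemma daddC a b : a + b = b + a.
Proof. by have := am_RCA0w (@ax_addC [_; _] #0%tm #1%tm) (env2 a b); rewrite sat_Eq. Qed.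
Lemma dmulA a b c : (a * b) * c = a * (b * c).
Proof. by have := am_RCA0w (@ax_mulA [_; _; _] #0%tm #1%tm #2%tm) (env3 a b c); rewrite sat_Eq. Qed.
Lemma dmulC a b : a * b = b * a.
Proof. by have := am_RCA0w (@ax_mulC [_; _] #0%tm #1%tm) (env2 a b); rewrite sat_Eq. Qed.
Lemma dmulDr a b c : a * (b + c) = a * b + a * c.
Proof. by have := am_RCA0w (@ax_distr [_; _; _] #0%tm #1%tm #2%tm) (env3 a b c); rewrite sat_Eq. Qed.
Lemma dadd0 a : a + 0 = a.
Proof. by have := am_RCA0w (@ax_add0 [_] #0%tm) (env1 a); rewrite sat_Eq. Qed.
Lemma dmul0 a : a * 0 = 0.
Proof. by have := am_RCA0w (@ax_mul0 [_] #0%tm) (env1 a); rewrite sat_Eq. Qed.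
Lemma dmul1 a : a * 1 = a.
Proof. by have := am_RCA0w (@ax_mul1 [_] #0%tm) (env1 a); rewrite sat_Eq. Qed.
Lemma dlt_irr a : ~ a < a.
Proof. exact: (am_RCA0w (@ax_lt_irr [_] #0%tm) (env1 a)). Qed.
Lemma dlt_trans a b c : a < b -> b < c -> a < c.
Proof. exact: (am_RCA0w (@ax_lt_trans [_; _; _] #0%tm #1%tm #2%tm) (env3 a b c)). Qed.
Lemma dlt_total a b : a < b \/ a = b \/ b < a.
Proof.
by have := am_RCA0w (@ax_lt_total [_; _] #0%tm #1%tm) (env2 a b); rewrite !sat_Or sat_Eq.
Qed.
Lemma dlt_add a b c : a < b -> a + c < b + c.
Proof. exact: (am_RCA0w (@ax_lt_add [_; _; _] #0%tm #1%tm #2%tm) (env3 a b c)). Qed.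
Lemma dlt_mul a b c : 0 < c -> a < b -> a * c < b * c.
Proof. exact: (am_RCA0w (@ax_lt_mul [_; _; _] #0%tm #1%tm #2%tm) (env3 a b c)). Qed.
Lemma dle0 a : 0 <= a.
Proof. by have := am_RCA0w (@ax_ge0 [_] #0%tm) (env1 a); rewrite sat_Le. Qed.
Lemma dlt01 : (0 : M ty0) < 1.
Proof. exact: (am_RCA0w (@ax_lt01 []) (enil : env M [])). Qed.
Lemma d_discrete a : 0 < a -> 1 <= a.
Proof.
by have := am_RCA0w (@ax_discrete [_] #0%tm) (env1 a); rewrite sat_Imp sat_Le.
Qed.

Lemma qf_induction Γ (A : fm (ty0 :: Γ)) (ρ : env M Γ) : qf A ->
  sat A (econs 0 ρ) -> (forall n, sat A (econs n ρ) -> sat A (econs (n + 1) ρ)) ->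
  forall n, sat A (econs n ρ).
Proof.
move=> qA A0 AS; have := am_RCA0w (ax_ind qA) ρ; rewrite !sat_Imp; apply.
  exact/sat_finst.
move=> n An; apply/sat_fsub.
suff -> : (fun τ x => eval (econs n ρ) (scons (#0 + 1)%tm (fun _ x => Var (VS x)) x)) =
  econs (n + 1) ρ by apply: AS.
exact: sub_cons_ext.
Qed.

Lemma dltS a : a < a + 1.
Proof. by have := dlt_add a dlt01; rewrite !(daddC _ a) dadd0. Qed.

Lemma daddI a b c : a + b = a + c -> b = c.
Proof.
have lt_ne x y : x < y -> a + x <> a + y.
  by move=> /(dlt_add a) + E; rewrite !(daddC _ a) E; apply: dlt_irr.
by move=> E; have [/lt_ne|[//|/lt_ne]] := dlt_total b c; rewrite E.
Qed.

(** Since the abstracted step terms are closed, [pred t] and [monus s t] evaluate to applications of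
    these objects by mere conversion, in every environment. *)
Definition Pred : M ty1 := cint M (CRec ty0) · eval enil (lam (lam #1%tm)) · 0.
Definition Monus : M (ty0 ⇒ ty0 ⇒ ty0)%ty :=
  cint M (CRec ty0) · eval enil (lam (lam (pred #0%tm))).

Lemma Pred0 : Pred · 0 = 0. Proof. exact: Rec0E. Qed.
Lemma PredS n : Pred · (n + 1) = n.
Proof. by rewrite /Pred RecSE eval_lam eval_lam. Qed.

Lemma Monus0 a : Monus · a · 0 = a. Proof. exact: Rec0E. Qed.
Lemma MonusS a b : Monus · a · (b + 1) = Pred · (Monus · a · b).
Proof. by rewrite /Monus RecSE eval_lam eval_lam. Qed.

Lemma PredK n : n <> 0 -> Pred · n + 1 = n.
Proof.
pose A : fm [ty0] := (¬ (#0 ≐ 0) ⊃ pred #0 + 1 ≐ #0)%fm.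
have E m : sat A (env1 m) <-> (m <> 0 -> Pred · m + 1 = m).
  by rewrite sat_Imp sat_Neg !sat_Eq.
apply/E; move: n; apply: qf_induction => //; first by apply/E.
by move=> n _; apply/E => _; rewrite PredS.
Qed.

Lemma dle_refl a : a <= a. Proof. by right. Qed.
Lemma dlt_le a b : a < b -> a <= b. Proof. by left. Qed.
Lemma dlt_le_trans a b c : a < b -> b <= c -> a < c.
Proof. by move=> ab [|<-//]; apply: dlt_trans. Qed.

Lemma MonusK a b : b <= a -> b + Monus · a · b = a.
Proof.
pose A : fm [ty0; ty0] := (#0 ≼ #1 ⊃ #0 + monus #1 #0 ≐ #1)%fm.
have E m : sat A (env2 m a) <-> (m <= a -> m + Monus · a · m = a).
  by rewrite sat_Imp sat_Le sat_Eq.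
apply/E; move: b; apply: qf_induction; first by do !split.
  by apply/E => _; rewrite daddC dadd0 Monus0.
move=> n /E IH; apply/E => lt_na.
have lt_na' : n < a by apply: dlt_le_trans lt_na; apply: dltS.
(* [Pred] subtracts 1 only from a nonzero number; [a - n = 0] would give [n = a] by the induction
   hypothesis. *)
rewrite MonusS daddA (daddC 1) PredK; first exact: IH (dlt_le lt_na').
move=> E0; have := IH (dlt_le lt_na'); rewrite E0 dadd0 => E'.
by move: lt_na'; rewrite E'; apply: dlt_irr.
Qed.

Lemma d_sub a b : a < b -> exists2 c, 0 < c & b = a + c.
Proof.
move=> ab; exists (Monus · b · a); last by rewrite MonusK //; left.
have [//|E] := dle0 (Monus · b · a).
by have := MonusK (dlt_le ab); rewrite -E dadd0 => E'; move: ab; rewrite E' => /dlt_irr.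
Qed.

Lemma dleS a b : a < b <-> a + 1 <= b.
Proof.
split=> [/d_sub [c /d_discrete c1 ->]|]; last exact/dlt_le_trans/dltS.
case: c1 => [c1|<-]; last exact: dle_refl.
by left; rewrite !(daddC a); apply: dlt_add.
Qed.

Lemma Monus_eq0 a b : a <= b -> Monus · a · b = 0.
Proof.
pose A : fm [ty0; ty0] := (#1 ≼ #0 ⊃ monus #1 #0 ≐ 0)%fm.
have E m : sat A (env2 m a) <-> (a <= m -> Monus · a · m = 0).
  by rewrite sat_Imp sat_Le sat_Eq.
apply/E; move: b; apply: qf_induction; first by do !split.
  apply/E; rewrite Monus0 => -[a0|//].
  by case: (dle0 a) => [a0'|//]; case: (dlt_irr (dlt_trans a0 a0')).
move=> n /E IH; apply/E => an; rewrite MonusS.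
have [/IH ->|->] : a <= n \/ a = n + 1.
- case: an => [an|]; [left|by right]; have [na|[->|an']] := dlt_total n a.
  + case/dleS: na => [na|na]; last by rewrite na in an; case: (dlt_irr an).
    by case: (dlt_irr (dlt_trans an na)).
  + exact: dle_refl.
  + exact: dlt_le.
- by rewrite Pred0.
- have E1 : Monus · (n + 1) · n = 1 by apply: (@daddI n); apply: MonusK; left; apply: dltS.
  by rewrite E1 -(dadd0 1) daddC PredS.
Qed.

Program Definition dom_semiring : ordered_semiring :=
  @OrderedSemiring (M ty0) 0 1 (fun a b => a + b) (fun a b => a * b) (fun a b => a < b)
    _ daddC _ _ dmulC _ _ _ dlt_irr dlt_trans dlt_total dlt_add dlt_mul dlt01 d_sub.
Next Obligation. by move=> a b c; rewrite daddA. Qed.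
Next Obligation. by move=> a; rewrite daddC dadd0. Qed.
Next Obligation. by move=> a b c; rewrite dmulA. Qed.
Next Obligation. by move=> a; rewrite dmulC dmul1. Qed.
Next Obligation. by move=> a b c; rewrite !(dmulC _ c) dmulDr. Qed.
Next Obligation. by move=> a; rewrite dmulC dmul0. Qed.

Definition fld : realFieldType := sval (cid (ordered_semiring_embedding dom_semiring)).
Definition emb0 : M ty0 -> fld :=
  sval (cid (svalP (cid (ordered_semiring_embedding dom_semiring)))).
End BasicArithmetic.

Notation "'ι' a" := (emb0 a) (at level 9, a at level 8, format "'ι'  a").

Section EmbeddingFacts.
Variable M : arith_model.
Implicit Types a b c n : M ty0.

Lemma emb_spec : [/\ ι (0 : M ty0) = 0%R, ι (1 : M ty0) = 1%R,
  forall a b, ι (a + b) = (ι a + ι b)%R,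
  forall a b, ι (a * b) = (ι a * ι b)%R &
  forall a b, (ι a < ι b)%R <-> a < b].
Proof. exact: (svalP (cid (svalP (cid (ordered_semiring_embedding (dom_semiring M)))))). Qed.

Lemma emb_0 : ι (0 : M ty0) = 0%R. Proof. by have [] := emb_spec. Qed.
Lemma emb_1 : ι (1 : M ty0) = 1%R. Proof. by have [] := emb_spec. Qed.
Lemma emb_D a b : ι (a + b) = (ι a + ι b)%R. Proof. by have [] := emb_spec. Qed.
Lemma emb_M a b : ι (a * b) = (ι a * ι b)%R. Proof. by have [] := emb_spec. Qed.
Lemma emb_lt a b : a < b <-> (ι a < ι b)%R. Proof. by have [_ _ _ _ ->] := emb_spec. Qed.

Lemma emb_eq a b : a = b <-> ι a = ι b.
Proof.
split=> [->//|E]; have [|[//|]] := dlt_total a b; rewrite emb_lt E ltxx //.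
Qed.

Lemma emb_le a b : a <= b <-> (ι a <= ι b)%R.
Proof.
by rewrite /dle emb_lt emb_eq le_eqVlt; split=> [[->|->]|/predU1P []];
   rewrite ?eqxx ?orbT //; [right|left].
Qed.

Lemma emb_ge0 a : (0 <= ι a)%R.
Proof. by rewrite -emb_0; apply/emb_le/dle0. Qed.

End EmbeddingFacts.

Definition emb_E := (emb_0, emb_1, emb_D, emb_M).

(* Transfers (in)equations between numbers of the model to the field, where [lra]
   and [nra] apply. *)
Ltac to_field :=
  repeat match goal with
  | H : dlt _ _ |- _ => apply (proj1 (emb_lt _ _)) in H
  | H : dle _ _ |- _ => apply (proj1 (emb_le _ _)) in H
  | H : @eq (dom _ ty0) _ _ |- _ => apply (proj1 (emb_eq _ _)) in H
  end;
  try lazymatch goal with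
  | |- dlt _ _ => apply (proj2 (emb_lt _ _))
  | |- dle _ _ => apply (proj2 (emb_le _ _))
  | |- @eq (dom _ ty0) _ _ => apply (proj2 (emb_eq _ _))
  end;
  rewrite ?emb_E;
  repeat match goal with
  | H : is_true (Order.le _ _) |- _ => rewrite !emb_E in H
  | H : is_true (Order.lt _ _) |- _ => rewrite !emb_E in H
  | H : @eq _ _ _ |- _ => rewrite !emb_E in H
  end.

(** * Functionals and predicates definable in the model *)

Section Definability.
Variable M : arith_model.

(** Semantic bracket abstraction: the lemmas below follow the shape of [F], so the tactic [lam_of]
    finds the combinator [f] as an existential variable. *)
Definition lam_of σ τ (F : M σ -> M τ) (f : M (σ ⇒ τ)%ty) : Prop := forall x, f · x = F x.

Lemma lam_eta σ τ (c : M (σ ⇒ τ)%ty) : lam_of (fun x => c · x) c.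
Proof. by []. Qed.

Lemma lam_cst σ τ (c : M τ) : lam_of (fun _ : M σ => c) (cint M (CPi τ σ) · c).
Proof. by move=> x; rewrite PiE. Qed.

Lemma lam_id σ : lam_of (fun x : M σ => x) (eval enil (lam_var VZ)).
Proof. by move=> x; rewrite eval_lam_var. Qed.

Lemma lam_app σ τ υ (F : M σ -> M (τ ⇒ υ)%ty) (G : M σ -> M τ) f g :
  lam_of F f -> lam_of G g -> lam_of (fun x => F x · G x) (cint M (CSigma σ τ υ) · f · g).
Proof. by move=> Hf Hg x; rewrite SigmaE Hf Hg. Qed.

Lemma def1 σ τ (F : M σ -> M τ) f : lam_of F f -> exists f, forall x, f · x = F x.
Proof. by exists f. Qed.

Lemma def2 σ τ υ (F : M σ -> M τ -> M υ) (g : M σ -> M (τ ⇒ υ)%ty) f :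
  (forall x, lam_of (F x) (g x)) -> lam_of g f -> exists f, forall x y, f · x · y = F x y.
Proof. by move=> Hg Hf; exists f => x y; rewrite Hf Hg. Qed.

Lemma def3 σ τ υ ν (F : M σ -> M τ -> M υ -> M ν) g h f :
  (forall x y, lam_of (F x y) (h x y)) -> (forall x, lam_of (h x) (g x)) ->
  lam_of g f -> exists f, forall x y z, f · x · y · z = F x y z.
Proof. by move=> Hh Hg Hf; exists f => x y z; rewrite Hf Hg Hh. Qed.

(** Truth is coded by 0, so that a sum is a conjunction and a product a disjunction. *)
Definition rep (P : Prop) (c : M ty0) : Prop := c = 0 <-> P.

Lemma char1 σ (P : M σ -> Prop) C f : (forall x, rep (P x) (C x)) ->
  lam_of C f -> exists c : M (σ ⇒ ty0)%ty, forall x, c · x = 0 <-> P x.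
Proof. by move=> HP Hf; exists f => x; rewrite Hf; apply: HP. Qed.

Lemma char2 σ τ (P : M σ -> M τ -> Prop) C g f : (forall x y, rep (P x y) (C x y)) ->
  (forall x, lam_of (C x) (g x)) -> lam_of g f ->
  exists c : M (σ ⇒ τ ⇒ ty0)%ty, forall x y, c · x · y = 0 <-> P x y.
Proof. by move=> HP Hg Hf; exists f => x y; rewrite Hf Hg; apply: HP. Qed.

Lemma char3 σ τ υ (P : M σ -> M τ -> M υ -> Prop) C h g f :
  (forall x y z, rep (P x y z) (C x y z)) -> (forall x y, lam_of (C x y) (h x y)) ->
  (forall x, lam_of (h x) (g x)) -> lam_of g f ->
  exists c : M (σ ⇒ τ ⇒ υ ⇒ ty0)%ty, forall x y z, c · x · y · z = 0 <-> P x y z.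
Proof. by move=> HP Hh Hg Hf; exists f => x y z; rewrite Hf Hg Hh; apply: HP. Qed.

Lemma char4 σ τ υ ν (P : M σ -> M τ -> M υ -> M ν -> Prop) C k h g f :
  (forall x y z w, rep (P x y z w) (C x y z w)) ->
  (forall x y z, lam_of (C x y z) (k x y z)) -> (forall x y, lam_of (k x y) (h x y)) ->
  (forall x, lam_of (h x) (g x)) -> lam_of g f ->
  exists c : M (σ ⇒ τ ⇒ υ ⇒ ν ⇒ ty0)%ty, forall x y z w, c · x · y · z · w = 0 <-> P x y z w.
Proof. by move=> HP Hk Hh Hg Hf; exists f => x y z w; rewrite Hf Hg Hh Hk; apply: HP. Qed.

Implicit Types a b c d n : M ty0.

Notation "a - b" := (Monus M · a · b) : dom_scope.

Lemma dadd_eq0 c d : c + d = 0 <-> c = 0 /\ d = 0.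
Proof.
split=> [E|[-> ->]]; last exact: dadd0.
have Ec := emb_ge0 c; have Ed := emb_ge0 d.
by split; to_field; lra.
Qed.

Lemma dmul_eq0 c d : c * d = 0 <-> c = 0 \/ d = 0.
Proof.
rewrite !emb_eq !emb_E; split=> [/eqP|].
  by rewrite mulf_eq0 => /orP [] /eqP; [left|right].
by case=> ->; rewrite ?mulr0 ?mul0r.
Qed.

Lemma done_neq0 : (1 : M ty0) <> 0.
Proof. by have := dlt01 M => + E; rewrite E; apply: dlt_irr. Qed.

Lemma d_leNlt a b : a <= b <-> ~ b < a.
Proof.
by rewrite emb_lt emb_le leNgt; split=> /negP.
Qed.

Lemma Monus_le a b : a - b = 0 <-> a <= b.
Proof.
split; last exact: Monus_eq0.
rewrite d_leNlt => E ba; have := MonusK (dlt_le ba); rewrite E dadd0 => E'.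
by move: ba; rewrite E'; apply: dlt_irr.
Qed.

Lemma rep_zero a : rep (a = 0) a. Proof. by []. Qed.
Lemma rep_le a b : rep (a <= b) (a - b). Proof. exact: Monus_le. Qed.
Lemma rep_lt a b : rep (a < b) (a + 1 - b).
Proof. by rewrite /rep Monus_le dleS. Qed.
Lemma rep_eq a b : rep (a = b) ((a - b) + (b - a)).
Proof.
rewrite /rep dadd_eq0 !Monus_le; split=> [[ab ba]|->]; last by split; right.
by to_field; lra.
Qed.
Lemma rep_not P c : rep P c -> rep (~ P) (1 - c).
Proof.
rewrite /rep => <-; rewrite Monus_le; split=> [c1 c0|c0].
  by to_field; lra.
by have [/d_discrete|/esym] := dle0 c.
Qed.
Lemma rep_and P Q c d : rep P c -> rep Q d -> rep (P /\ Q) (c + d).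
Proof. by rewrite /rep => <- <-; apply: dadd_eq0. Qed.
Lemma rep_or P Q c d : rep P c -> rep Q d -> rep (P \/ Q) (c * d).
Proof. by rewrite /rep => <- <-; apply: dmul_eq0. Qed.
Lemma rep_imp P Q c d : rep P c -> rep Q d -> rep (P -> Q) ((1 - c) * d).
Proof.
move=> /rep_not; rewrite /rep => Pc Qd; rewrite dmul_eq0 Pc Qd; split; first by case.
by have [HP /(_ HP)|nP] := pselect P; [right|left].
Qed.
Lemma rep_iff P Q c d : rep P c -> rep Q d -> rep (P <-> Q) ((1 - c) * d + (1 - d) * c).
Proof. by move=> Pc Qd; apply: rep_and; apply: rep_imp. Qed.
(** Quantifier-free induction on [#1 · #0 ≐ 0] with the characteristic function as a parameter.
    Whatever the meta-level shape of [P], the model has to contain that function. *)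
Lemma d_induction (P : M ty0 -> Prop) :
  (exists c : M ty1, forall n, c · n = 0 <-> P n) ->
  P 0 -> (forall n, P n -> P (n + 1)) -> forall n, P n.
Proof.
move=> [c cP] P0 PS n; apply/cP; move: n.
pose A : fm [ty0; ty1] := (#1 · #0 ≐ 0)%fm.
have E m : sat A (econs m (econs c enil)) <-> c · m = 0 by rewrite sat_Eq.
move=> n; apply/E; move: n; apply: qf_induction => [//||m /E /cP /PS Pm]; first by apply/E/cP.
by apply/E/cP.
Qed.

Lemma QFAC10 (P : M ty1 -> M ty0 -> Prop) :
  (exists c : M (ty1 ⇒ ty0 ⇒ ty0)%ty, forall x y, c · x · y = 0 <-> P x y) ->
  (forall x, exists y, P x y) -> exists Y : M ty2, forall x, P x (Y · x).
Proof.
move=> [c cP] HP.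
pose A : fm [ty0; ty1; (ty1 ⇒ ty0 ⇒ ty0)%ty] := (#2 · #1 · #0 ≐ 0)%fm.
have := am_RCA0w (@ax_QFAC [(ty1 ⇒ ty0 ⇒ ty0)%ty] A I) (econs c enil).
rewrite sat_Imp sat_All sat_Ex => /(_ _) [].
  by move=> x; apply/sat_Ex; have [y /cP Hy] := HP x; exists y; apply/sat_Eq.
move=> Y HY; exists Y => x; apply/cP.
by have := HY x; rewrite (deqE (am_normal M)).
Qed.

End Definability.

Ltac lam_of :=
  cbv beta;
  lazymatch goal with
  | |- lam_of (fun x => x) _ => eapply lam_id
  | |- lam_of (fun _ => ?c) _ => eapply lam_cst
  | |- lam_of (fun x => app _ x) _ => first [eapply lam_eta | eapply lam_app; lam_of]
  | |- lam_of (fun x => app _ _) _ => eapply lam_app; lam_of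
  | |- lam_of (app ?c) _ => exact (lam_eta c)
  end.
(** Hypotheses come first: a functional already known to satisfy [_ = 0 <-> P] decides [P] as it
    stands, even when [P] hides quantifiers. *)
Ltac rep :=
  cbv beta;
  match goal with
  | H : forall x, _ |- _ => solve [eapply H]
  | |- _ => lazymatch goal with
    | |- rep (_ /\ _) _ => eapply rep_and; rep
    | |- rep (_ \/ _) _ => eapply rep_or; rep
    | |- rep (_ <-> _) _ => eapply rep_iff; rep
    | |- rep (~ _) _ => eapply rep_not; rep
    | |- rep (_ -> _) _ => eapply rep_imp; rep
    | |- rep (dle _ _) _ => eapply rep_le
    | |- rep (dlt _ _) _ => eapply rep_lt
    | |- rep (_ = cint _ CZero) _ => eapply rep_zero
    | |- rep (_ = _) _ => eapply rep_eq
    end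
  end.
Ltac def1 := eapply def1; lam_of.
Ltac def2 := eapply def2; [intro; lam_of | lam_of].
Ltac def3 := eapply def3; [intros ? ?; lam_of | intro; lam_of | lam_of].
Ltac char1 := eapply char1; [intro; rep | lam_of].
Ltac char2 := eapply char2; [intros ? ?; rep | intro; lam_of | lam_of].
Ltac char3 := eapply char3; [intros ? ? ?; rep | intros ? ?; lam_of | intro; lam_of | lam_of].
Ltac char4 :=
  eapply char4; [intros ? ? ? ?; rep | intros ? ? ?; lam_of | intros ? ?; lam_of | intro; lam_of | lam_of].

(** * Coding of pairs and sequences *)

Notation "a - b" := (Monus _ · a · b) : dom_scope.

Section Coding.
Variable M : arith_model.
Implicit Types a b c i m n s : M ty0.

(** Only the recursor with values of type 0 has axioms; a parameter of any type can still be passed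
    along to the step. *)
Lemma d_recursion σ (m : M (σ ⇒ ty0)%ty) (h : M (σ ⇒ ty0 ⇒ ty0 ⇒ ty0)%ty) :
  exists R : M (σ ⇒ ty0 ⇒ ty0)%ty, forall x,
    R · x · 0 = m · x /\ forall n, R · x · (n + 1) = h · x · n · (R · x · n).
Proof.
have [R HR] : exists R : M (σ ⇒ ty0 ⇒ ty0)%ty, forall x n,
    R · x · n = cint M (CRec ty0) · (h · x) · (m · x) · n by def2.
by exists R => x; rewrite !HR Rec0E; split=> // n; rewrite !HR RecSE.
Qed.

Definition Pair : M (ty0 ⇒ ty0 ⇒ ty0)%ty := eval enil (lam (lam (pair #1 #0)%tm)).
Definition Sqrt : M ty1 := eval enil (lam (sqrt #0)%tm).
Definition Pow2 : M ty1 := eval enil (lam (pow2 #0)%tm).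
Definition Fst : M ty1 := eval enil (lam (pfst #0)%tm).
Definition Snd : M ty1 := eval enil (lam (psnd #0)%tm).
Definition Init : M (ty1 ⇒ ty0 ⇒ ty0)%ty := eval enil (lam (lam (initseg #1 #0)%tm)).

Lemma PairE a b : Pair · a · b = (a + b) * (a + b) + a.
Proof. by rewrite /Pair !eval_lam. Qed.

Lemma eval_app Γ (ρ : env M Γ) σ τ (t : tm Γ (σ ⇒ τ)%ty) u :
  eval ρ (t · u)%tm = eval ρ t · eval ρ u.
Proof. by []. Qed.
Lemma eval_plus Γ (ρ : env M Γ) t u : eval ρ (t + u)%tm = eval ρ t + eval ρ u.
Proof. by []. Qed.
Lemma eval_times Γ (ρ : env M Γ) t u : eval ρ (t * u)%tm = eval ρ t * eval ρ u.
Proof. by []. Qed.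
Lemma eval_zero Γ (ρ : env M Γ) : eval ρ 0%tm = 0. Proof. by []. Qed.
Lemma eval_one Γ (ρ : env M Γ) : eval ρ 1%tm = 1. Proof. by []. Qed.
Lemma eval_rec0 Γ (ρ : env M Γ) body t u :
  eval ρ (rec0 body t u) = cint M (CRec ty0) · eval ρ (lam (lam body)) · eval ρ t · eval ρ u.
Proof. by []. Qed.

Section Eval.
Variables (Γ : ctx) (ρ : env M Γ).
Implicit Types t u : tm Γ ty0.

Lemma eval_pair t u : eval ρ (pair t u) = Pair · eval ρ t · eval ρ u.
Proof. by rewrite PairE. Qed.
Lemma eval_pow2 t : eval ρ (pow2 t) = Pow2 · eval ρ t.
Proof. by rewrite /Pow2 eval_lam. Qed.
Lemma eval_pfst t : eval ρ (pfst t) = Fst · eval ρ t.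
Proof. by rewrite /Fst eval_lam. Qed.
Lemma eval_psnd t : eval ρ (psnd t) = Snd · eval ρ t.
Proof. by rewrite /Snd eval_lam. Qed.

End Eval.

Lemma eval_initseg_step Γ (ρ : env M Γ) (g : tm Γ ty1) a b :
  eval ρ (lam (lam (pair #0 (wk (wk g) · #1) + 1)%tm)) · a · b = Pair · b · (eval ρ g · a) + 1.
Proof.
by rewrite 2!eval_lam eval_plus eval_pair eval_app 2!eval_wk.
Qed.

(** The step term mentions [g], so its bracket abstraction depends on the term [g] and not just on
    its value. Extensionality of the model identifies the step functionals that arise. *)
Lemma InitE Γ (ρ : env M Γ) (g : tm Γ ty1) n :
  Init · eval ρ g · n =
  cint M (CRec ty0) · eval ρ (lam (lam (pair #0 (wk (wk g) · #1) + 1)%tm)) · 0 · n.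
Proof.
rewrite /Init 2!eval_lam /initseg eval_rec0; congr (_ · _ · _ · _).
apply: (app_ext (am_normal M)) => a; apply: (app_ext (am_normal M)) => b.
have -> := eval_initseg_step ρ g a b.
by have -> := eval_initseg_step (econs n (econs (eval ρ g) enil)) #1%tm a b.
Qed.

Lemma eval_initseg Γ (ρ : env M Γ) (g : tm Γ ty1) t :
  eval ρ (initseg g t) = Init · eval ρ g · eval ρ t.
Proof. by rewrite InitE. Qed.

Lemma Init0 g : Init · g · 0 = 0.
Proof. by rewrite (InitE (econs g enil) #0%tm) Rec0E. Qed.

Lemma InitS g n : Init · g · (n + 1) = Pair · (Init · g · n) · (g · n) + 1.
Proof.
rewrite (InitE (econs g enil) #0%tm) RecSE -InitE.
exact: (eval_initseg_step (econs g enil) #0%tm).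
Qed.

Lemma Sqrt0 : Sqrt · 0 = 0.
Proof. by rewrite /Sqrt eval_lam /sqrt eval_rec0 Rec0E. Qed.

Lemma SqrtS n : Sqrt · (n + 1) =
  Sqrt · n + (1 - ((Sqrt · n + 1) * (Sqrt · n + 1) - (n + 1))).
Proof. by rewrite /Sqrt !eval_lam /sqrt !eval_rec0 RecSE !eval_lam. Qed.

Lemma Pow2_0 : Pow2 · 0 = 1.
Proof. by rewrite /Pow2 eval_lam /pow2 eval_rec0 Rec0E. Qed.

Lemma Pow2_S n : Pow2 · (n + 1) = Pow2 · n + Pow2 · n.
Proof. by rewrite /Pow2 !eval_lam /pow2 !eval_rec0 RecSE !eval_lam. Qed.

Lemma FstE n : Fst · n = n - Sqrt · n * (Sqrt · n).
Proof. by rewrite /Fst /Sqrt !eval_lam. Qed.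

Lemma SndE n : Snd · n = Sqrt · n - Fst · n.
Proof. by rewrite /Snd /Fst /Sqrt !eval_lam. Qed.

Lemma Sqrt_bounds n : Sqrt · n * (Sqrt · n) <= n /\ n < (Sqrt · n + 1) * (Sqrt · n + 1).
Proof.
move: n; apply: d_induction; first by char1.
  by rewrite Sqrt0; split; to_field; lra.
move=> n [lo hi]; rewrite SqrtS; set s := Sqrt · n in lo hi *.
have s0 := emb_ge0 s.
have [/Monus_le E|nE] := pselect ((s + 1) * (s + 1) <= n + 1).
- have -> : 1 - ((s + 1) * (s + 1) - (n + 1)) = 1.
    have -> : (s + 1) * (s + 1) - (n + 1) = 0 by [].
    exact: Monus0.
  have /Monus_le E' := E; split; first by [].
  by to_field; nra.
- have -> : 1 - ((s + 1) * (s + 1) - (n + 1)) = 0.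
    apply: Monus_eq0; have [/d_discrete//|/esym/Monus_le//] := dle0 ((s + 1) * (s + 1) - (n + 1)).
  have {nE} E : n + 1 < (s + 1) * (s + 1) by have [//|[E|E]] := dlt_total (n + 1) ((s + 1) * (s + 1)); case: nE; [right|left].
  rewrite dadd0; split=> //; by to_field; lra.
Qed.

Lemma Sqrt_unique s n : s * s <= n -> n < (s + 1) * (s + 1) -> Sqrt · n = s.
Proof.
have [lo hi] := Sqrt_bounds n; set t := Sqrt · n in lo hi * => lo' hi'.
have s0 := emb_ge0 s; have t0 := emb_ge0 t.
have [/dleS|[//|/dleS]] := dlt_total t s => ts; exfalso; to_field; nra.
Qed.

Lemma Sqrt_Pair a b : Sqrt · (Pair · a · b) = a + b.
Proof.
have a0 := emb_ge0 a; have b0 := emb_ge0 b.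
by apply: Sqrt_unique; rewrite PairE; to_field; nra.
Qed.

Lemma Fst_Pair a b : Fst · (Pair · a · b) = a.
Proof.
rewrite FstE Sqrt_Pair PairE; apply: (@daddI _ ((a + b) * (a + b))); rewrite MonusK //.
by have a0 := emb_ge0 a; to_field; lra.
Qed.

Lemma Snd_Pair a b : Snd · (Pair · a · b) = b.
Proof.
rewrite SndE Sqrt_Pair Fst_Pair; apply: (@daddI _ a); rewrite MonusK //.
by have b0 := emb_ge0 b; to_field; lra.
Qed.

Lemma Pair_ge2 a b : b <= Pair · a · b.
Proof.
have a0 := emb_ge0 a; have b0 := emb_ge0 b.
(* In the field, [b <= b * b] requires [1 <= b], so zero is split off by discreteness. *)
rewrite PairE; have [/d_discrete b1|<-] := dle0 b; last exact: dle0.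
by to_field; nra.
Qed.

Lemma Pair_ge1 a b : a <= Pair · a · b.
Proof.
have a0 := emb_ge0 a; have b0 := emb_ge0 b.
by rewrite PairE; to_field; nra.
Qed.

Lemma Pow2_gt0 n : 0 < Pow2 · n.
Proof.
move: n; apply: d_induction; first by char1.
  by rewrite Pow2_0; apply: dlt01.
by move=> n n0; rewrite Pow2_S; to_field; lra.
Qed.

Lemma Pow2D m n : Pow2 · (m + n) = Pow2 · m * (Pow2 · n).
Proof.
move: n; apply: d_induction; first by char1.
  by rewrite dadd0 Pow2_0 dmul1.
by move=> n E; rewrite -daddA !Pow2_S E; to_field; ring.
Qed.

Lemma Init_ge g n : n <= Init · g · n.
Proof.
move: n; apply: d_induction; first by char1.
  exact: dle0.
move=> n IH; rewrite InitS; have := Pair_ge1 (Init · g · n) (g · n) => H.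
by to_field; lra.
Qed.

(** A code is unwound by tails: [It · s · i] drops the last [i] entries, and [L · s · i] counts the
    nonempty ones among the first [i] tails ([1 - (1 - c)] is the sign of [c]). A code is at least
    its length, so counting up to [s] itself is enough. *)
Lemma decode_Init : exists (Len : M ty1) (Nth : M (ty0 ⇒ ty0 ⇒ ty0)%ty), forall g n,
  Len · (Init · g · n) = n /\ forall i, i < n -> Nth · (Init · g · n) · i = g · i.
Proof.
have [Tl HTl] : exists Tl : M ty1, forall s, Tl · s = Fst · (Pred M · s) by def1.
have [h Hh] : exists h : M (ty0 ⇒ ty0 ⇒ ty0 ⇒ ty0)%ty, forall s i v, h · s · i · v = Tl · v by def3.
have [id Hid] : exists id : M ty1, forall s, id · s = s by def1.
have [It HIt] := d_recursion id h.
have It0 s : It · s · 0 = s by rewrite (HIt s).1.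
have ItS s i : It · s · (i + 1) = Fst · (Pred M · (It · s · i)).
  by rewrite (HIt s).2 Hh HTl.
have [z Hz] : exists z : M ty1, forall s : M ty0, z · s = 0 by def1.
have [h' Hh'] : exists h : M (ty0 ⇒ ty0 ⇒ ty0 ⇒ ty0)%ty,
    forall s i v, h · s · i · v = v + (1 - (1 - It · s · i)) by def3.
have [L HL] := d_recursion z h'.
have L0 s : L · s · 0 = 0 by rewrite (HL s).1 Hz.
have LS s i : L · s · (i + 1) = L · s · i + (1 - (1 - It · s · i)) by rewrite (HL s).2 Hh'.
have [Len HLen] : exists Len : M ty1, forall s, Len · s = L · s · s by def1.
(* Entry [i] is the last one of the segment of length [i + 1], which is reached by dropping
   [Len - (i + 1)] entries. *)
have [Nth HNth] : exists Nth : M (ty0 ⇒ ty0 ⇒ ty0)%ty, forall s i,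
  Nth · s · i = Snd · (Pred M · (It · s · (Len · s - (i + 1)))) by def2.
have Fst0 : Fst · 0 = 0 by rewrite FstE; apply: Monus_eq0; apply: dle0.
have It_Init g n i : It · (Init · g · n) · i = Init · g · (n - i).
  move: i; apply: d_induction; first by char1.
    by rewrite It0 Monus0.
  move=> i IH; rewrite ItS IH MonusS; have [->|ne] := pselect (n - i = 0).
    by rewrite Pred0 Init0 Pred0.
  by rewrite -{1}(PredK ne) InitS PredS Fst_Pair.
have L_Init g n b : (b <= n -> L · (Init · g · n) · b = b) /\ (n <= b -> L · (Init · g · n) · b = n).
  move: b; apply: d_induction; first by char1.
    rewrite L0; split=> // n0; have := dle0 n => n0'; to_field; lra.
  move=> b [IH1 IH2]; rewrite LS It_Init.
  have [nb|bn] := pselect (n <= b).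
    have -> : n - b = 0 by apply: Monus_eq0.
    rewrite Init0 Monus0 (Monus_eq0 (dle_refl 1)) dadd0 IH2 //.
    by split=> // bn; to_field; lra.
  have {}bn : b < n by have [//|[E|E]] := dlt_total b n; case: bn; [right|left].
  have pos : 1 <= Init · g · (n - b).
    have := Init_ge g (n - b); have := MonusK (dlt_le bn) => E H.
    suff : 1 <= n - b by move=> ?; to_field; lra.
    by apply: d_discrete; to_field; lra.
  rewrite (Monus_eq0 pos) Monus0 IH1; last exact: dlt_le.
  by split=> // nb; have /dleS bn' := bn; to_field; lra.
have HL' g n : Len · (Init · g · n) = n.
  by rewrite HLen; apply: (L_Init g n _).2; apply: Init_ge.
exists Len, Nth => g n; split=> // i lt_in.
rewrite HNth HL' It_Init.
have -> : n - (n - (i + 1)) = i + 1.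
  have le1 : i + 1 <= n by apply/dleS.
  have E := MonusK le1.
  have E2 := @MonusK M n (n - (i + 1)).
  have i0 := emb_ge0 i.
  have /E2 {}E2 : n - (i + 1) <= n by to_field; lra.
  by to_field; lra.
by rewrite InitS PredS Snd_Pair.
Qed.

End Coding.

(** * Kleene normal form and quantification over numbers *)

Section KleeneSemantics.
Variable M : arith_model.
Implicit Types (n s : M ty0) (f g X : M ty1).

Fixpoint Tup (l : list (M ty0)) : M ty0 :=
  match l with
  | [] => 0
  | [a] => a
  | a :: l' => Pair M · a · Tup l'
  end.

Definition quantified q σ (P : M σ -> Prop) : Prop :=
  match q with QAll => forall a, P a | QEx => exists a, P a end.

Fixpoint kleene_true q k f (gs : list (M ty1)) : Prop :=
  match k with
  | O => quantified q (fun n => f · Tup (map (fun g => Init M · g · n) gs) = 0)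
  | S k' => quantified q (fun g => kleene_true (dual q) k' f (gs ++ [g])%list)
  end.

Lemma quantified_iff q σ (P Q : M σ -> Prop) :
  (forall a, P a <-> Q a) -> quantified q P <-> quantified q Q.
Proof.
move=> PQ; suff -> : P = Q by [].
by apply: funext => a; apply: propext.
Qed.

Lemma sat_quantify q Γ (ρ : env M Γ) σ A :
  sat (quantify q σ A) ρ <-> quantified q (fun a => sat A (econs a ρ)).
Proof. by case: q; [|exact: sat_Ex]. Qed.

Lemma eval_tuple Γ (ρ : env M Γ) l : eval ρ (tuple l) = Tup (map (eval ρ (τ := ty0)) l).
Proof.
elim: l => // t [|u l] IH //.
by rewrite -[tuple _]/(pair t (tuple (u :: l))) eval_pair IH.
Qed.

Lemma sat_kleene k : forall q Γ (ρ : env M Γ) (f : tm Γ ty1) gs,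
  sat (kleene q k f gs) ρ <-> kleene_true q k (eval ρ f) (map (eval ρ (τ := ty1)) gs).
Proof.
elim: k => [|k IH] q Γ ρ f gs; rewrite sat_quantify; apply: quantified_iff => a.
- rewrite sat_Eq eval_app eval_wk eval_tuple !map_map.
  by under map_ext => g do rewrite eval_initseg eval_wk.
- rewrite IH eval_wk map_app map_map.
  by under map_ext => g do rewrite eval_wk.
Qed.

Lemma kleene_true_not k : forall q f f' gs, (forall s, f' · s = 0 <-> ~ f · s = 0) ->
  kleene_true (dual q) k f' gs <-> ~ kleene_true q k f gs.
Proof.
elim: k => [|k IH] q f f' gs ff'; case: q => /=.
- split=> [[a /ff' Ha] H|H]; first exact: Ha (H a).
  by apply: contrapT => H'; apply: H => a; apply: contrapT => Ha; apply: H'; exists a; apply/ff'.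
- split=> [H [a]|H a]; first exact/ff'.
  by apply/ff' => Ha; apply: H; exists a.
- split=> [[g] H H'|H]; first by have := H' g; apply/(IH QEx f).
  apply: contrapT => H'; apply: H => g; apply: contrapT => Hg; apply: H'; exists g.
  exact/(IH QEx f).
- split=> [H [g Hg]|H g]; first by have := H g; rewrite (IH QAll f) //; apply.
  by apply/(IH QAll f) => // Hg; apply: H; exists g.
Qed.

Fixpoint last_quant q k := if k is k'.+1 then last_quant (dual q) k' else q.

Lemma kleene_true_const k q f gs (P : Prop) :
  (forall gs', length gs' = k ->
    quantified (last_quant q k) (fun n => f · Tup (map (fun g => Init M · g · n) (gs ++ gs')%list) = 0)
    <-> P) ->
  kleene_true q k f gs <-> P.
Proof.
elim: k q gs => [|k IH] q gs H /=; first by have := H [] erefl; rewrite app_nil_r.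
have H' g : kleene_true (dual q) k f (gs ++ [g]) <-> P.
  by apply: IH => gs' E; rewrite -app_assoc; apply: H => /=; rewrite E.
case: q H H' => _ H' /=; last by split=> [[g /H']|HP]; [|exists (Sqrt M); apply/H'].
by split=> [/(_ (Sqrt M)) /H'|HP g]; [|apply/H'].
Qed.

Lemma Tup_first k : exists c : M ty1, forall g gs n, length gs = k ->
  c · Tup (map (fun g => Init M · g · n) (g :: gs)) = Init M · g · n.
Proof.
case: k => [|k].
  have [id Hid] : exists id : M ty1, forall s, id · s = s by def1.
  by exists id => g [|//] n _; rewrite Hid.
by exists (Fst M) => g [|g' gs] n // _; rewrite /= Fst_Pair.
Qed.

Lemma Init_neq0 g n : Init M · g · (n + 1) <> 0.
Proof. by rewrite InitS => /dadd_eq0 [_]; apply: done_neq0. Qed.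

Lemma d_case n : n = 0 \/ exists m, n = m + 1.
Proof.
have [->|ne] := pselect (n = 0); first by left.
by right; exists (Pred M · n); rewrite PredK.
Qed.

Lemma d_gt0 n : 0 < n + 1.
Proof. by have := emb_ge0 n => n0; to_field; lra. Qed.

(* [T · f] only inspects [g_1 0], so all the quantifiers after the first are vacuous. *)
Lemma ex_functional k (S : M ty2) :
  (forall f, S · f = 0 <-> kleene_true QEx k.+1 f []) ->
  exists E : M ty2, forall f, E · f = 0 <-> exists n, f · n = 0.
Proof.
move=> HS.
have [c Hc] := Tup_first k; have [Len [Nth HN]] := decode_Init M.
have HN0 g n : Nth · (Init M · g · (n + 1)) · 0 = g · 0.
  by apply: (HN g (n + 1)).2; apply: d_gt0.
have [T HT] : exists T : M (ty1 ⇒ ty1)%ty, forall f g gs, length gs = k ->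
    quantified (last_quant QAll k)
      (fun n => T · f · Tup (map (fun g => Init M · g · n) (g :: gs)) = 0) <-> f · (g · 0) = 0.
  (* At [n = 0] the initial segment is empty and does not show [g · 0]. There the matrix has to be
     true if the number quantifier is universal, and false if it is existential. *)
  case: (last_quant QAll k).
    have [T HT] : exists T : M (ty1 ⇒ ty0 ⇒ ty0)%ty, forall f s,
        T · f · s = 0 <-> c · s = 0 \/ f · (Nth · (c · s) · 0) = 0 by char2.
    exists T => f g gs Egs; split=> [/(_ (0 + 1))|Hf n]; rewrite HT Hc //.
      by rewrite HN0 => -[/Init_neq0|].
    by have [->|[m ->]] := d_case n; [left; rewrite Init0|right; rewrite HN0].
  have [T HT] : exists T : M (ty1 ⇒ ty0 ⇒ ty0)%ty, forall f s,
      T · f · s = 0 <-> ~ c · s = 0 /\ f · (Nth · (c · s) · 0) = 0 by char2.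
  exists T => f g gs Egs; split=> [[n]|Hf].
    rewrite HT Hc //; have [->|[m ->]] := d_case n; first by rewrite Init0 => -[].
    by rewrite HN0 => -[].
  apply: (ex_intro _ (0 + 1)); rewrite HT Hc // HN0.
  by split=> // /Init_neq0.
have [E HE] : exists E : M ty2, forall f, E · f = S · (T · f) by def1.
exists E => f; rewrite HE HS.
have key g : kleene_true QAll k (T · f) [g] <-> f · (g · 0) = 0.
  by apply: kleene_true_const => gs Egs; apply: HT.
split=> [[g /key Hg]|[n Hn]]; first by exists (g · 0).
have [g Hg] : exists g : M ty1, forall i : M ty0, g · i = n by def1.
by exists g; apply/key; rewrite Hg.
Qed.

(** Feferman's μ: with [E] as a parameter, the condition [E · f = 0 -> f · n = 0] is quantifier-free
    and always has a solution [n], so QF-AC applies. *)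
Lemma choice_functional (E : M ty2) : (forall f, E · f = 0 <-> exists n, f · n = 0) ->
  exists μ : M ty2, forall f n, f · n = 0 -> f · (μ · f) = 0.
Proof.
move=> HE; have [μ Hμ] : exists μ : M ty2, forall f, E · f = 0 -> f · (μ · f) = 0.
  apply: (QFAC10 (P := fun f n => E · f = 0 -> f · n = 0)); first by char2.
  move=> f; have [/HE [n Hn]|nE] := pselect (E · f = 0); first by exists n.
  by exists 0.
by exists μ => f n Hn; apply: Hμ; apply/HE; exists n.
Qed.

End KleeneSemantics.

(** * Normal form of arithmetical formulas *)

Section Polynomials.
Variable M : arith_model.
Implicit Types (Γ Δ : ctx) (i n : M ty0).

(** Terms with constants from the model, as functions of the environment. Closure under abstraction
    ([pol_lam]) is what later turns a polynomial dependence on variables into a functional of the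
    model. *)
Inductive polynomial Γ : forall τ, (env M Γ -> M τ) -> Prop :=
| pol_var : forall τ (x : var Γ τ), polynomial (fun ρ => ρ τ x)
| pol_cst : forall τ (c : M τ), polynomial (fun _ => c)
| pol_app : forall σ τ (F : env M Γ -> M (σ ⇒ τ)%ty) G,
    polynomial F -> polynomial G -> polynomial (fun ρ => F ρ · G ρ).

Lemma pol_lam Γ σ τ (F : env M (σ :: Γ) -> M τ) : polynomial F ->
  exists2 F' : env M Γ -> M (σ ⇒ τ)%ty, polynomial F' &
    forall ρ a, F' ρ · a = F (econs a ρ).
Proof.
elim=> {τ F} [τ x|τ c|τ υ F G _ [F' PF EF] _ [G' PG EG]].
- move: τ x; apply: var_cons_ind => [|τ x].
    exists (fun _ => eval enil (lam_var VZ)); first exact: pol_cst.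
    by move=> ρ a; rewrite eval_lam_var.
  exists (fun ρ => cint M (CPi τ σ) · ρ τ x); last by move=> ρ a; rewrite PiE.
  by apply: pol_app; [apply: pol_cst|apply: pol_var].
- exists (fun ρ => cint M (CPi τ σ) · c); last by move=> ρ a; rewrite PiE.
  exact: pol_cst.
- exists (fun ρ => cint M (CSigma σ τ υ) · F' ρ · G' ρ).
    by do 2 apply: pol_app => //; apply: pol_cst.
  by move=> ρ a; rewrite SigmaE EF EG.
Qed.

Lemma pol_comp Γ Δ (Ξ : env M Δ -> env M Γ) τ (F : env M Γ -> M τ) :
  (forall σ x, polynomial (fun ρ => Ξ ρ σ x)) -> polynomial F ->
  polynomial (fun ρ => F (Ξ ρ)).
Proof.
move=> PΞ; elim=> {τ F} [τ x|τ c|σ τ F G _ IHF _ IHG]; first exact: PΞ.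
  exact: pol_cst.
exact: pol_app.
Qed.

Lemma pol_wk Γ σ τ (F : env M Γ -> M τ) : polynomial F ->
  polynomial (fun ρ : env M (σ :: Γ) => F (fun _ x => ρ _ (VS x))).
Proof.
by apply: (@pol_comp Γ (σ :: Γ) (fun ρ _ x => ρ _ (VS x))) => ? ?; apply: pol_var.
Qed.

End Polynomials.

Ltac pol :=
  lazymatch goal with
  | |- polynomial (fun ρ => app _ _) => apply: pol_app; pol
  | |- polynomial (fun ρ => ρ _ _) => apply: pol_var
  | |- polynomial (fun ρ => ?F (fun _ x => ρ _ (VS x))) => apply: (@pol_wk _ _ _ _ F); assumption
  | |- _ => first [assumption | apply: pol_cst]
  end.

Section NormalForm.
Variable M : arith_model.
Implicit Types (Γ Δ : ctx) (i n : M ty0).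

Definition decidable_by Γ (P : env M Γ -> Prop) : Prop :=
  exists2 c : env M Γ -> M ty0, polynomial c & forall ρ, rep (P ρ) (c ρ).

Lemma decidable_imp Γ (P Q : env M Γ -> Prop) :
  decidable_by P -> decidable_by Q -> decidable_by (fun ρ => P ρ -> Q ρ).
Proof.
move=> [c pc Pc] [d pd Qd]; exists (fun ρ => (1 - c ρ) * d ρ).
  by pol.
by move=> ρ; apply: rep_imp.
Qed.

Lemma decidable_bot Γ : decidable_by (fun _ : env M Γ => False).
Proof. by exists (fun _ => 1); [exact: pol_cst|move=> ρ; split=> // /done_neq0]. Qed.

(* Terms over [Γ], an index and a witness of type 1; the witness and the variables of
   type 1 are used as oracles only. *)
Inductive oterm Γ : Type :=
| OVar : var Γ ty0 -> oterm Γ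
| OIdx : oterm Γ
| OCst : M ty0 -> oterm Γ
| OFun : M ty1 -> oterm Γ -> oterm Γ
| OBin : M (ty0 ⇒ ty0 ⇒ ty0)%ty -> oterm Γ -> oterm Γ -> oterm Γ
| OAsk : var Γ ty1 -> oterm Γ -> oterm Γ
| OWit : oterm Γ -> oterm Γ.
Arguments OIdx {Γ}.
Arguments OCst {Γ}.

Fixpoint oval Γ (h : M ty1) (a : M ty0) (ρ : env M Γ) (t : oterm Γ) : M ty0 :=
  match t with
  | OVar x => ρ _ x
  | OIdx => a
  | OCst c => c
  | OFun f u => f · oval h a ρ u
  | OBin f u v => f · oval h a ρ u · oval h a ρ v
  | OAsk X u => ρ _ X · oval h a ρ u
  | OWit u => h · oval h a ρ u
  end.

(* Exceeds all the arguments at which an oracle is evaluated. *)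
Fixpoint obound Γ (h : M ty1) (a : M ty0) (ρ : env M Γ) (t : oterm Γ) : M ty0 :=
  match t with
  | OVar _ | OCst _ | OIdx => 0
  | OFun _ u => obound h a ρ u
  | OBin _ u v => obound h a ρ u + obound h a ρ v
  | OAsk _ u | OWit u => obound h a ρ u + oval h a ρ u + 1
  end.

(** Each oracle call is determined by the previous answers, so the bounds agree along with the
    values. Thus an initial segment of the oracles can itself tell whether it is long enough. *)
Lemma oval_agree Γ n h h' a (ρ ρ' : env M Γ) t :
  (forall x : var Γ ty0, ρ _ x = ρ' _ x) ->
  (forall (X : var Γ ty1) i, i < n -> ρ _ X · i = ρ' _ X · i) ->
  (forall i, i < n -> h · i = h' · i) -> obound h a ρ t <= n ->
  oval h a ρ t = oval h' a ρ' t /\ obound h a ρ t = obound h' a ρ' t.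
Proof.
move=> A0 A1 A2; elim: t => [x||c|f u IH|f u IHu v IHv|X u IH|u IH] /= le_n //.
- by have [-> ->] := IH le_n.
- have u0 := emb_ge0 (obound h a ρ u); have v0 := emb_ge0 (obound h a ρ v).
  have [| -> ->] := IHu; first by to_field; lra.
  by have [| -> ->] := IHv; first by to_field; lra.
- have u0 := emb_ge0 (obound h a ρ u); have v0 := emb_ge0 (oval h a ρ u).
  have [|E1 E2] := IH; first by to_field; lra.
  by rewrite -E1 -E2 A1 //; to_field; lra.
- have u0 := emb_ge0 (obound h a ρ u); have v0 := emb_ge0 (oval h a ρ u).
  have [|E1 E2] := IH; first by to_field; lra.
  by rewrite -E1 -E2 A2 //; to_field; lra.
Qed.

Lemma pol_oval Γ Δ (H : env M Δ -> M ty1) A (Ξ : env M Δ -> env M Γ) t :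
  polynomial H -> polynomial A -> (forall σ x, polynomial (fun ρ => Ξ ρ σ x)) ->
  polynomial (fun ρ => oval (H ρ) (A ρ) (Ξ ρ) t) /\
  polynomial (fun ρ => obound (H ρ) (A ρ) (Ξ ρ) t).
Proof.
move=> PH PA PΞ.
elim: t => [x||c|f u [IH1 IH2]|f u [IHu1 IHu2] v [IHv1 IHv2]|X u [IH1 IH2]|u [IH1 IH2]] /=;
  split=> //; by repeat (assumption || apply: pol_cst || apply: pol_app || apply: PΞ).
Qed.

(** An oracle is only ever applied, so a variable of type 1 is replaced by an operation on terms.
    Other higher types do not occur in an [oterm] and get a dummy. *)
Definition osubst Δ (τ : ty) : Type :=
  match τ with ty0 => oterm Δ | _ => oterm Δ -> oterm Δ end.

Definition ofcons Γ Δ σ (b : osubst Δ σ) (s : forall τ, var Γ τ -> osubst Δ τ) :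
    forall τ, var (σ :: Γ) τ -> osubst Δ τ :=
  fun τ x =>
    match x in var Γ' τ'
      return match Γ' with
             | [] => unit
             | ν :: Γ1 => osubst Δ ν -> (forall τ, var Γ1 τ -> osubst Δ τ) -> osubst Δ τ'
             end
    with
    | VZ _ _ => fun b _ => b
    | VS _ _ _ y => fun _ s => s _ y
    end b s.

Definition oid Γ τ : var Γ τ -> osubst Γ τ :=
  match τ return var Γ τ -> osubst Γ τ with
  | ty0 => fun x => OVar x
  | arr ty0 ty0 => fun X u => OAsk X u
  | arr _ _ => fun _ u => u
  end.

Definition ocorrect Γ Δ h a (ρ : env M Δ) τ : osubst Δ τ -> M τ -> Prop :=
  match τ return osubst Δ τ -> M τ -> Prop with
  | ty0 => fun t v => oval h a ρ t = v
  | arr ty0 ty0 => fun t v => forall u, oval h a ρ (t u) = v · oval h a ρ u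
  | arr _ _ => fun _ _ => True
  end.

Lemma oid_correct Γ h a (ρ : env M Γ) τ x : @ocorrect Γ Γ h a ρ τ (oid x) (ρ τ x).
Proof. by case: τ x => [|[|? ?] [|? ?]]. Qed.

Fixpoint osub Γ Δ (s : forall τ, var Γ τ -> osubst Δ τ) (ta : oterm Δ)
    (th : oterm Δ -> oterm Δ) (t : oterm Γ) : oterm Δ :=
  match t with
  | OVar x => s ty0 x
  | OIdx => ta
  | OCst c => OCst c
  | OFun f u => OFun f (osub s ta th u)
  | OBin f u v => OBin f (osub s ta th u) (osub s ta th v)
  | OAsk X u => s ty1 X (osub s ta th u)
  | OWit u => th (osub s ta th u)
  end.

Lemma oval_sub Γ Δ s ta th h a (ρ : env M Δ) h' a' (ρ' : env M Γ) t :
  (forall τ x, @ocorrect Γ Δ h a ρ τ (s τ x) (ρ' τ x)) -> oval h a ρ ta = a' ->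
  (forall u, oval h a ρ (th u) = h' · oval h a ρ u) ->
  oval h a ρ (osub s ta th t) = oval h' a' ρ' t.
Proof.
move=> Es Ea Eh; elim: t => [x||c|f u IH|f u IHu v IHv|X u IH|u IH] //=.
- exact: (Es ty0).
- by rewrite IH.
- by rewrite IHu IHv.
- by rewrite (Es ty1) IH.
- by rewrite Eh IH.
Qed.

(* [P ρ] iff [∃ h, ∀ a, m = 0]; the witness [h] depends polynomially on [ρ], which takes
   the place of a choice axiom. *)
Definition sigma_form Γ (P : env M Γ -> Prop) : Prop :=
  exists (m : oterm Γ) (W : env M Γ -> M ty1), polynomial W /\ forall ρ,
    (P ρ -> forall a, oval (W ρ) a ρ m = 0) /\
    (forall h, (forall a, oval h a ρ m = 0) -> P ρ).

Lemma sigma_form_iff Γ (P Q : env M Γ -> Prop) :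
  (forall ρ, P ρ <-> Q ρ) -> sigma_form P -> sigma_form Q.
Proof.
move=> PQ [m [W [pW HW]]]; exists m, W; split=> // ρ; have [H1 H2] := HW ρ.
by split=> [/PQ|h /H2 /PQ].
Qed.

Lemma sigma_form_atom Γ (P : env M Γ -> Prop) (t : oterm Γ) :
  (forall h a ρ, rep (P ρ) (oval h a ρ t)) -> sigma_form P.
Proof.
move=> Pt; exists t, (fun _ => Sqrt M); split; first exact: pol_cst.
by move=> ρ; split=> [HP a|h /(_ 0)]; [apply/Pt|move/Pt].
Qed.

Lemma pol_lam0 Γ (F : env M (ty0 :: Γ) -> M ty0) : polynomial F ->
  exists2 F' : env M Γ -> M ty1, polynomial F' & forall ρ a, F' ρ · a = F (econs a ρ).
Proof. exact: pol_lam. Qed.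

Lemma fun_comp (p h : M ty1) : exists h' : M ty1, forall n, h' · n = p · (h · n).
Proof. by def1. Qed.

Notation oask_fst := (fun u => OFun (Fst M) (OWit u)).
Notation oask_snd := (fun u => OFun (Snd M) (OWit u)).

(** Values of the two witnesses are paired into one function, and adding the two matrices lets them
    share the index. *)
Lemma sigma_form_and Γ (P Q : env M Γ -> Prop) :
  sigma_form P -> sigma_form Q -> sigma_form (fun ρ => P ρ /\ Q ρ).
Proof.
move=> [m1 [W1 [pW1 H1]]] [m2 [W2 [pW2 H2]]].
have [W pW HW] := @pol_lam0 Γ (fun ρ => Pair M · (W1 (fun _ x => ρ _ (VS x)) · ρ _ VZ)
    · (W2 (fun _ x => ρ _ (VS x)) · ρ _ VZ))
  ltac:(pol).
pose m := OBin (cint M CPlus) (osub (@oid Γ) OIdx oask_fst m1) (osub (@oid Γ) OIdx oask_snd m2).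
have Em h h1 h2 a ρ : (forall n, h1 · n = Fst M · (h · n)) -> (forall n, h2 · n = Snd M · (h · n)) ->
    oval h a ρ m = 0 <-> oval h1 a ρ m1 = 0 /\ oval h2 a ρ m2 = 0.
  move=> E1 E2; rewrite /= dadd_eq0.
  rewrite (@oval_sub Γ Γ _ _ _ h a ρ h1 a ρ) //=; last exact: oid_correct.
  by rewrite (@oval_sub Γ Γ _ _ _ h a ρ h2 a ρ) //=; exact: oid_correct.
exists m, W; split=> // ρ; split=> [[HP HQ] a|h Hh].
  apply/(Em _ (W1 ρ) (W2 ρ)); try by move=> n; rewrite HW ?Fst_Pair ?Snd_Pair.
  by split; [apply: (H1 ρ).1|apply: (H2 ρ).1].
have [h1 E1] := fun_comp (Fst M) h; have [h2 E2] := fun_comp (Snd M) h.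
by split; [apply: ((H1 ρ).2 h1)|apply: ((H2 ρ).2 h2)] => a; have /(Em _ _ _ _ _ E1 E2) [] := Hh a.
Qed.

(** The first component of [h · 0] announces which disjunct the second components witness.
    Decidability of [P] is what lets a polynomial witness make this choice. *)
Lemma sigma_form_or Γ (P Q : env M Γ -> Prop) : decidable_by P ->
  sigma_form P -> sigma_form Q -> sigma_form (fun ρ => P ρ \/ Q ρ).
Proof.
move=> [c pc Pc] [m1 [W1 [pW1 H1]]] [m2 [W2 [pW2 H2]]].
(* Definition by cases as a sum: the factors [1 - c] and [1 - (1 - c)] are 1 and 0 when [P] holds,
   and 0 and 1 otherwise. *)
have [W pW HW] := @pol_lam0 Γ (fun ρ => Pair M · c (fun _ x => ρ _ (VS x))
    · ((1 - c (fun _ x => ρ _ (VS x))) * (W1 (fun _ x => ρ _ (VS x)) · ρ _ VZ) + (1 - (1 - c (fun _ x => ρ _ (VS x)))) * (W2 (fun _ x => ρ _ (VS x)) · ρ _ VZ)))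
  ltac:(pol).
pose flag : oterm Γ := OFun (Fst M) (OWit (OCst 0)).
pose m := OBin (cint M CTimes)
  (OBin (cint M CPlus) flag (osub (@oid Γ) OIdx oask_snd m1))
  (OBin (cint M CPlus) (OBin (Monus M) (OCst 1) flag) (osub (@oid Γ) OIdx oask_snd m2)).
have Em h h' a ρ : (forall n, h' · n = Snd M · (h · n)) ->
    oval h a ρ m = 0 <-> (Fst M · (h · 0) = 0 /\ oval h' a ρ m1 = 0) \/
                         (~ Fst M · (h · 0) = 0 /\ oval h' a ρ m2 = 0).
  move=> E; rewrite /= dmul_eq0 !dadd_eq0.
  rewrite (@oval_sub Γ Γ _ _ _ h a ρ h' a ρ) //=; last exact: oid_correct.
  rewrite (@oval_sub Γ Γ _ _ _ h a ρ h' a ρ) //=; last exact: oid_correct.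
  by have := rep_not (rep_zero (Fst M · (h · 0))); rewrite /rep => ->.
exists m, W; split=> // ρ; split=> [HPQ a|h Hh].
  have E0 : Fst M · (W ρ · 0) = c ρ by rewrite HW Fst_Pair.
  have [HP|nP] := pselect (P ρ).
    apply/(Em _ (W1 ρ)); last by left; rewrite E0; split; [apply/Pc|apply: (H1 ρ).1].
    move=> n; rewrite HW Snd_Pair (_ : c _ = 0) ?Monus0 ?(Monus_eq0 (dle_refl 1)); last exact/Pc.
    by rewrite dmulC dmul1 [X in _ + X]dmulC dmul0 dadd0.
  apply/(Em _ (W2 ρ)).
    move=> n; rewrite HW Snd_Pair; have /(rep_not (Pc ρ)) E : ~ P ρ by [].
    by rewrite E Monus0 dmulC dmul0 daddC dadd0 dmulC dmul1.
  by right; rewrite E0; split; [move/Pc|case: HPQ => // HQ; apply: (H2 ρ).1].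
have [h' E] := fun_comp (Snd M) h.
have [F0|F0] := pselect (Fst M · (h · 0) = 0).
  by left; apply: ((H1 ρ).2 h') => a; have /(Em _ _ _ _ E) [[]|[]] := Hh a.
by right; apply: ((H2 ρ).2 h') => a; have /(Em _ _ _ _ E) [[]|[]] := Hh a.
Qed.

(** The witness for [x] becomes the section [h <x, ·>] of a single function, and the index codes [x]
    together with the old index. The sections can be collected because the old witness is polynomial
    in [x]. *)
Lemma sigma_form_all Γ (P : env M (ty0 :: Γ) -> Prop) :
  sigma_form P -> sigma_form (fun ρ => forall x : M ty0, P (econs x ρ)).
Proof.
move=> [m1 [W1 [pW1 H1]]].
have [W' pW' HW'] := pol_lam pW1.
have [W pW HW] := @pol_lam0 Γ (fun ρ => W' (fun _ x => ρ _ (VS x)) · (Fst M · ρ _ VZ) · (Snd M · ρ _ VZ))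
  ltac:(pol).
pose m := osub (ofcons (OFun (Fst M) OIdx : osubst Γ ty0) (@oid Γ)) (OFun (Snd M) OIdx)
  (fun u => OWit (OBin (Pair M) (OFun (Fst M) OIdx) u)) m1.
have Em h a ρ h' : (forall n, h' · n = h · (Pair M · (Fst M · a) · n)) ->
    oval h a ρ m = oval h' (Snd M · a) (econs (Fst M · a) ρ) m1.
  move=> E; apply: oval_sub => //=.
  by apply: var_cons_ind => [//|τ x]; apply: oid_correct.
exists m, W; split=> // ρ; split=> [HP a|h Hh x].
  rewrite (Em _ _ _ (W1 (econs (Fst M · a) ρ))); last first.
    by move=> n; rewrite HW Fst_Pair Snd_Pair HW'.
  exact: (H1 _).1.
have [h' Hh'] : exists h' : M ty1, forall n, h' · n = h · (Pair M · x · n) by def1.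
apply: ((H1 _).2 h') => a.
by have := Hh (Pair M · x · a); rewrite (Em _ _ _ h') ?Fst_Pair ?Snd_Pair // => n; rewrite Fst_Pair Hh'.
Qed.

Variables (E μ : M ty2).
Hypothesis HE : forall f, E · f = 0 <-> exists n, f · n = 0.
Hypothesis Hμ : forall f n, f · n = 0 -> f · (μ · f) = 0.

Lemma decidable_all Γ (P : env M (ty0 :: Γ) -> Prop) :
  decidable_by P -> decidable_by (fun ρ => forall x : M ty0, P (econs x ρ)).
Proof.
move=> [c pc Pc].
have [C pC HC] := @pol_lam0 Γ (fun ρ => 1 - c ρ)
  ltac:(pol).
exists (fun ρ => 1 - E · C ρ); first by pol.
move=> ρ; have := rep_not (HE (C ρ)); rewrite /rep => ->.
split=> [H x|H [x]]; last by rewrite HC => /(rep_not (Pc _)); apply.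
by apply: contrapT => nP; apply: H; exists x; rewrite HC; apply/(rep_not (Pc _)).
Qed.

(** A suitable [x] is found by [μ] from the characteristic function of [P] and stored in the first
    component of [h · 0]. *)
Lemma sigma_form_ex Γ (P : env M (ty0 :: Γ) -> Prop) : decidable_by P ->
  sigma_form P -> sigma_form (fun ρ => exists x : M ty0, P (econs x ρ)).
Proof.
move=> [c pc Pc] [m1 [W1 [pW1 H1]]].
have [C pC HC] := pol_lam0 pc.
have [W' pW' HW'] := pol_lam pW1.
have [W pW HW] := @pol_lam0 Γ (fun ρ => Pair M · (μ · C (fun _ x => ρ _ (VS x))) · (W' (fun _ x => ρ _ (VS x)) · (μ · C (fun _ x => ρ _ (VS x))) · ρ _ VZ))
  ltac:(pol).
pose x0 : oterm Γ := OFun (Fst M) (OWit (OCst 0)).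
pose m := osub (ofcons (x0 : osubst Γ ty0) (@oid Γ)) OIdx oask_snd m1.
have Em h a ρ h' : (forall n, h' · n = Snd M · (h · n)) ->
    oval h a ρ m = oval h' a (econs (Fst M · (h · 0)) ρ) m1.
  move=> Eh; apply: oval_sub => //=.
  by apply: var_cons_ind => [//|τ x]; apply: oid_correct.
exists m, W; split=> // ρ; split=> [[x Px] a|h Hh].
  have /Pc : c (econs (μ · C ρ) ρ) = 0 by rewrite -HC; apply: (Hμ (n := x)); rewrite HC; apply/Pc.
  rewrite (Em _ _ _ (W1 (econs (μ · C ρ) ρ))); last by move=> n; rewrite HW Snd_Pair HW'.
  by rewrite HW Fst_Pair => /((H1 _).1) ->.
have [h' Eh] := fun_comp (Snd M) h.
exists (Fst M · (h · 0)); apply: ((H1 _).2 h') => a.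
by rewrite -Em.
Qed.

Lemma num_oterm Γ (t : tm Γ ty0) : num_term t ->
  exists o : oterm Γ, forall h a ρ, oval h a ρ o = eval ρ t.
Proof.
elim=> [x|||{}t u _ [o1 H1] _ [o2 H2]|{}t u _ [o1 H1] _ [o2 H2]].
- by exists (OVar x).
- by exists (OCst 0).
- by exists (OCst 1).
- by exists (OBin (cint M CPlus) o1 o2) => h a ρ; rewrite /= H1 H2.
- by exists (OBin (cint M CTimes) o1 o2) => h a ρ; rewrite /= H1 H2.
Qed.

Definition onot Γ (t : oterm Γ) : oterm Γ := OBin (Monus M) (OCst 1) t.

Lemma sigma_form_literals Γ (P : env M Γ -> Prop) (t : oterm Γ) :
  (forall h a ρ, rep (P ρ) (oval h a ρ t)) ->
  [/\ decidable_by P, sigma_form P & sigma_form (fun ρ => ~ P ρ)].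
Proof.
move=> Pt; split; [|exact: sigma_form_atom Pt|].
  exists (fun ρ => oval (Sqrt M) 0 ρ t); last by move=> ρ; apply: Pt.
  by apply: (@pol_oval Γ Γ (fun _ => Sqrt M) (fun _ => 0) id t _ _ _).1 => *; [apply: pol_cst|apply: pol_cst|apply: pol_var].
by apply: (@sigma_form_atom Γ _ (onot t)) => h a ρ; apply: rep_not.
Qed.

(** Implication negates its premise, and a negated universal quantifier is existential, so the
    induction carries both [A] and its negation. Decidability, which survives quantifiers by [E],
    serves the disjunctive and existential cases. *)
Lemma arithmetical_normal_form Γ (A : fm Γ) : arithmetical A ->
  [/\ decidable_by (sat A : env M Γ -> Prop), sigma_form (sat A : env M Γ -> Prop) &
      sigma_form (fun ρ : env M Γ => ~ sat A ρ)].
Proof.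
elim=> {Γ A}.
- move=> Γ s t /num_oterm [o1 H1] /num_oterm [o2 H2].
  apply: (@sigma_form_literals Γ _ (OBin (cint M CPlus) (OBin (Monus M) o1 o2) (OBin (Monus M) o2 o1))).
  by move=> h a ρ; rewrite /rep sat_Eq /= !H1 !H2; apply: rep_eq.
- move=> Γ s t /num_oterm [o1 H1] /num_oterm [o2 H2].
  apply: (@sigma_form_literals Γ _ (OBin (Monus M) (OBin (cint M CPlus) o1 (OCst 1)) o2)).
  by move=> h a ρ; rewrite /= !H1 !H2; apply: rep_lt.
- move=> Γ t X /num_oterm [o H].
  apply: (@sigma_form_literals Γ _
    (OBin (cint M CPlus) (OBin (Monus M) (OAsk X o) (OCst 1)) (OBin (Monus M) (OCst 1) (OAsk X o)))).
  by move=> h a ρ; rewrite /rep sat_Eq /= H; apply: rep_eq.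
- by move=> Γ; apply: (@sigma_form_literals Γ _ (OCst 1)) => h a ρ; split=> // /done_neq0.
- move=> Γ A B _ [dA sA nA] _ [dB sB nB]; split.
  + exact: decidable_imp.
  + apply: sigma_form_iff (sigma_form_or _ nA sB).
      move=> ρ; split=> [[nHA /nHA|HB] //|H].
      by have [/H|] := pselect (sat A ρ); [right|left].
    exact: decidable_imp dA (decidable_bot Γ).
  + apply: sigma_form_iff (sigma_form_and sA nB) => ρ.
    split=> [[HA nHB] H|H]; first exact: nHB (H HA).
    by split; [apply: contrapT => nHA; apply: H|move=> HB; apply: H].
- move=> Γ A _ [dA sA nA]; split.
  + exact: decidable_all.
  + exact: sigma_form_all.
  + have dnA : decidable_by (fun ρ : env M (ty0 :: Γ) => ~ sat A ρ) := decidable_imp dA (decidable_bot _).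
    apply: sigma_form_iff (sigma_form_ex dnA nA) => ρ.
    split=> [[x nx] H|H]; first exact: nx (H x).
    by apply: contrapT => nx; apply: H => x; apply: contrapT => Hx; apply: nx; exists x.
Qed.

End NormalForm.

(** * Normal form of second-order formulas *)

Section SecondOrderNormalForm.
Variable M : arith_model.
Implicit Types (Γ : ctx) (i j k : nat).

Lemma Sigma1_inv k Γ (A : fm Γ) : Sigma1 k A ->
  match k return Prop with
  | O => arithmetical A
  | S k' => exists2 B : fm (ty1 :: Γ), A = ExSet B & Pi1 k' B
  end.
Proof. by case=> // {}k {A}Γ B PB; exists B. Qed.

Lemma Pi1_inv k Γ (A : fm Γ) : Pi1 k A ->
  match k return Prop with
  | O => arithmetical A
  | S k' => exists2 B : fm (ty1 :: Γ), A = AllSet B & Sigma1 k' B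
  end.
Proof. by case=> // {}k {A}Γ B PB; exists B. Qed.

Lemma sat_is_set Γ (ρ : env M Γ) X : sat (is_set X) ρ <-> forall n : M ty0, eval ρ X · n <= 1.
Proof.
by rewrite /is_set sat_All; split=> H n; have := H n; rewrite sat_Le eval_app eval_wk.
Qed.

Lemma sat_mem Γ (ρ : env M Γ) t X : sat (mem t X) ρ <-> eval ρ X · eval ρ t = 1.
Proof. exact: sat_Eq. Qed.

Definition is_char (X : M ty1) : Prop := forall n, X · n <= 1.

Lemma sat_AllSet Γ (ρ : env M Γ) A :
  sat (AllSet A) ρ <-> forall X, is_char X -> sat A (econs X ρ).
Proof.
by rewrite /AllSet sat_All; split=> H X; have := H X; rewrite sat_Imp sat_is_set.
Qed.

Lemma sat_ExSet Γ (ρ : env M Γ) A :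
  sat (ExSet A) ρ <-> exists2 X, is_char X & sat A (econs X ρ).
Proof.
rewrite /ExSet sat_Ex; split=> [[X /sat_And [/sat_is_set HX HA]]|[X HX HA]]; exists X => //.
by apply/sat_And; split=> //; apply/sat_is_set.
Qed.

Lemma bit_le1 (c : M ty0) : 1 - c <= 1.
Proof.
have [/Monus_eq0 ->|nc] := pselect (1 <= c); first exact: dle0.
have c1 : c <= 1 by have [?|[->|?]] := dlt_total c 1; [left|right|case: nc; left].
by have := MonusK c1 => E; have := emb_ge0 c => c0; to_field; lra.
Qed.

Lemma bit_eq1 (c : M ty0) : 1 - c = 1 <-> c = 0.
Proof.
split=> [E|->]; last exact: Monus0.
have [//|[m Em]] := d_case c; exfalso.
move: E; rewrite Em (Monus_eq0 (_ : 1 <= m + 1)); last by have m0 := emb_ge0 m; to_field; lra.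
by move=> /esym /done_neq0.
Qed.

(* The set with the same elements, where membership of [n] in [X] is [X · n = 1]. *)
Lemma char_of (X : M ty1) : exists2 X', is_char X' & forall n, X' · n = 1 <-> X · n = 1.
Proof.
have [X' HX'] : exists X' : M ty1, forall n, X' · n = 1 - ((X · n - 1) + (1 - X · n)) by def1.
exists X' => n; rewrite HX'; first exact: bit_le1.
by rewrite bit_eq1; apply: rep_eq.
Qed.

(** Second-order formulas see an object of type 1 only through membership. Hence a quantifier over
    characteristic functions may be traded for the quantifier over all of type 1 that the Kleene
    form has. *)
Definition same_members Γ (ρ ρ' : env M Γ) : Prop :=
  (forall x : var Γ ty0, ρ _ x = ρ' _ x) /\
  (forall (X : var Γ ty1) n, ρ _ X · n = 1 <-> ρ' _ X · n = 1).

Lemma same_members_econs0 Γ (ρ ρ' : env M Γ) (a : M ty0) : same_members ρ ρ' ->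
  same_members (econs a ρ) (econs a ρ').
Proof.
move=> [E0 E1]; split=> x.
  (* The induction on variables ranges over all types, so the motive is made trivial at every type
     but the one in question. *)
  apply: (@var_cons_ind Γ ty0 (fun τ => match τ return var _ τ -> Prop with
    ty0 => fun x => econs a ρ x = econs a ρ' x | _ => fun _ => True end) _ _ ty0 x) => //.
  by move=> [|? ?] y //=; apply: E0.
apply: (@var_cons_ind Γ ty0 (fun τ => match τ return var _ τ -> Prop with
    arr ty0 ty0 => fun X => forall n, econs a ρ X · n = 1 <-> econs a ρ' X · n = 1
    | _ => fun _ => True end) _ _ ty1 x) => //.
by move=> [|[|? ?] [|? ?]] y //=; apply: E1.
Qed.

Lemma same_members_econs1 Γ (ρ ρ' : env M Γ) (X X' : M ty1) : same_members ρ ρ' ->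
  (forall n, X · n = 1 <-> X' · n = 1) -> same_members (econs X ρ) (econs X' ρ').
Proof.
move=> [E0 E1] EX; split=> x.
  apply: (@var_cons_ind Γ ty1 (fun τ => match τ return var _ τ -> Prop with
    ty0 => fun x => econs X ρ x = econs X' ρ' x | _ => fun _ => True end) _ _ ty0 x) => //.
  by move=> [|? ?] y //=; apply: E0.
apply: (@var_cons_ind Γ ty1 (fun τ => match τ return var _ τ -> Prop with
    arr ty0 ty0 => fun Y => forall n, econs X ρ Y · n = 1 <-> econs X' ρ' Y · n = 1
    | _ => fun _ => True end) _ _ ty1 x) => //.
by move=> [|[|? ?] [|? ?]] y //=; apply: E1.
Qed.

Lemma num_term_same Γ (ρ ρ' : env M Γ) t : same_members ρ ρ' -> num_term t ->
  eval ρ t = eval ρ' t.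
Proof. by move=> [E0 _]; elim=> //= [u v _ -> _ ->|u v _ -> _ ->]. Qed.

Lemma arithmetical_same Γ (A : fm Γ) : arithmetical A ->
  forall ρ ρ' : env M Γ, same_members ρ ρ' -> sat A ρ <-> sat A ρ'.
Proof.
elim=> {Γ A}.
- by move=> Γ s t Hs Ht ρ ρ' E; rewrite !sat_Eq (num_term_same E Hs) (num_term_same E Ht).
- by move=> Γ s t Hs Ht ρ ρ' E; rewrite /= (num_term_same E Hs) (num_term_same E Ht).
- by move=> Γ t X Ht ρ ρ' E; rewrite !sat_mem (num_term_same E Ht); apply: E.2.
- by [].
- by move=> Γ A B _ IHA _ IHB ρ ρ' E; rewrite !sat_Imp (IHA _ _ E) (IHB _ _ E).
- move=> Γ A _ IH ρ ρ' E; rewrite !sat_All.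
  by split=> H a; have := H a; rewrite (IH _ _ (same_members_econs0 a E)).
Qed.

Lemma second_order_same k : forall Γ (A : fm Γ), Pi1 k A \/ Sigma1 k A ->
  forall ρ ρ' : env M Γ, same_members ρ ρ' -> sat A ρ <-> sat A ρ'.
Proof.
elim: k => [|k IH] Γ A.
  by case=> [/Pi1_inv|/Sigma1_inv]; apply: arithmetical_same.
have EE (B : fm (ty1 :: Γ)) : Pi1 k B \/ Sigma1 k B -> forall (ρ ρ' : env M Γ) X,
    same_members ρ ρ' -> sat B (econs X ρ) <-> sat B (econs X ρ').
  by move=> HB ρ ρ' X E; apply: IH HB _ _ _; apply: same_members_econs1.
case=> [/Pi1_inv [B -> HB]|/Sigma1_inv [B -> HB]] ρ ρ' E.
- by rewrite !sat_AllSet; split=> H X /H; rewrite (EE B _ ρ ρ') //; right.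
- by rewrite !sat_ExSet; split=> -[X HX H]; exists X => //; move: H; rewrite (EE B _ ρ ρ') //; left.
Qed.

Lemma sat_AllSet_any k Γ (B : fm (ty1 :: Γ)) (ρ : env M Γ) : Pi1 k B \/ Sigma1 k B ->
  sat (AllSet B) ρ <-> forall X, sat B (econs X ρ).
Proof.
move=> HB; rewrite sat_AllSet; split=> H X; last by [].
have [X' HX' E] := char_of X; have := H _ HX'.
by apply: (second_order_same HB _).1; apply: same_members_econs1.
Qed.

Lemma sat_ExSet_any k Γ (B : fm (ty1 :: Γ)) (ρ : env M Γ) : Pi1 k B \/ Sigma1 k B ->
  sat (ExSet B) ρ <-> exists X, sat B (econs X ρ).
Proof.
move=> HB; rewrite sat_ExSet; split=> [[X _ H]|[X H]]; first by exists X.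
have [X' HX' E] := char_of X; exists X' => //; move: H.
by apply: (second_order_same HB _).2; apply: same_members_econs1.
Qed.

(** The set variables whose quantifiers have been stripped, the latest first; [oracles] lists their
    values in the order of quantification, as [kleene] does. *)
Fixpoint oracle_ctx Γ i : ctx := if i is i'.+1 then ty1 :: oracle_ctx Γ i' else Γ.

Fixpoint oracle_env Γ i (g : nat -> M ty1) (ρ : env M Γ) : env M (oracle_ctx Γ i) :=
  match i return env M (oracle_ctx Γ i) with
  | O => ρ
  | S i' => econs (g i') (@oracle_env Γ i' g ρ)
  end.
Arguments oracle_env {Γ} i g ρ [τ] _.

Fixpoint oracles i (g : nat -> M ty1) : list (M ty1) :=
  if i is i'.+1 then (oracles i' g ++ [g i'])%list else [].

Definition upd i (X : M ty1) (g : nat -> M ty1) : nat -> M ty1 :=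
  fun j => if j == i then X else g j.

Lemma oracle_env_ext Γ i g g' (ρ : env M Γ) : (forall j, (j < i)%N -> g j = g' j) ->
  oracle_env i g ρ = oracle_env i g' ρ.
Proof.
elim: i => // i IH E /=; rewrite IH ?E // => j ji; apply: E; exact: ltnW.
Qed.

Lemma oracles_ext i g g' : (forall j, (j < i)%N -> g j = g' j) -> oracles i g = oracles i g'.
Proof. by elim: i => // i IH E /=; rewrite IH ?E // => j ji; apply: E; exact: ltnW. Qed.

Lemma oracle_env_upd Γ i X g (ρ : env M Γ) :
  oracle_env i.+1 (upd i X g) ρ = econs X (oracle_env i g ρ).
Proof.
rewrite /= /upd eqxx (@oracle_env_ext _ _ _ g) // => j ji.
by rewrite ltn_eqF.
Qed.

Lemma oracles_upd i X g : oracles i.+1 (upd i X g) = (oracles i g ++ [X])%list.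
Proof.
rewrite /= /upd eqxx (@oracles_ext _ _ g) // => j ji.
by rewrite ltn_eqF.
Qed.

Lemma Tup_nth (l : list (M ty0)) j : (j < length l)%N -> exists c : M ty1,
  forall l', length l' = length l -> c · Tup l' = List.nth j l' 0.
Proof.
elim: l j => // a [|b l] IH [|j] //= jl.
- have [id Hid] : exists id : M ty1, forall s, id · s = s by def1.
  by exists id => -[|x [|y l']] //= _; rewrite Hid.
- by exists (Fst M) => -[|x [|y l']] //= _; rewrite Fst_Pair.
- have [c Hc] := IH j jl.
  have [c' Hc'] : exists c' : M ty1, forall s, c' · s = c · (Snd M · s) by def1.
  exists c' => -[|x [|y l']] // [El].
  by rewrite Hc' -[Tup _]/(Pair M · x · Tup (y :: l')) Snd_Pair Hc //= El.
Qed.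

Lemma length_oracles N g : length (oracles N g) = N.
Proof. by elim: N => //= N IH; rewrite length_app IH /= PeanoNat.Nat.add_1_r. Qed.

Lemma nth_oracles N g j d : (j < N)%N -> List.nth j (oracles N g) d = g j.
Proof.
elim: N => // N IH; rewrite ltnS leq_eqVlt => /orP [/eqP ->|jN] /=.
  by rewrite app_nth2 ?length_oracles ?PeanoNat.Nat.sub_diag.
by rewrite app_nth1 ?IH // length_oracles; apply/ssrnat.ltP.
Qed.

Lemma Tup_component N : exists c : nat -> M ty1, forall j g n, (j < N)%N ->
  c j · Tup (map (fun g => Init M · g · n) (oracles N g)) = Init M · g j · n.
Proof.
suff /choice [c Hc] : forall j, exists c : M ty1, forall g n, (j < N)%N ->
    c · Tup (map (fun g => Init M · g · n) (oracles N g)) = Init M · g j · n by exists c => *; apply: Hc.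
move=> j; have [jN|nj] := boolP (j < N)%N; last by exists (Sqrt M).
have [|c Hc] := @Tup_nth (map (fun g => Init M · g · 0) (oracles N (fun _ => Sqrt M))) j.
  by rewrite length_map length_oracles.
exists c => g n _; rewrite Hc ?length_map ?length_oracles //.
rewrite (nth_indep _ _ (Init M · Sqrt M · n)); last by rewrite length_map length_oracles; apply/ssrnat.ltP.
by rewrite (map_nth (fun g => Init M · g · n)) nth_oracles.
Qed.

Lemma pol_oracle_env Γ Δ i (G : env M Δ -> nat -> M ty1) (R : env M Δ -> env M Γ) :
  (forall j, (j < i)%N -> polynomial (fun ρ => G ρ j)) ->
  (forall σ x, polynomial (fun ρ => R ρ σ x)) ->
  forall σ x, polynomial (fun ρ => oracle_env i (G ρ) (R ρ) x : M σ).
Proof.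
move=> PG PR; elim: i PG => [|i IH] PG σ x; first exact: PR.
move: σ x; apply: var_cons_ind => [|σ x] /=; first exact: PG.
by apply: IH => j ji; apply: PG; apply: ltnW.
Qed.

Lemma oracle_env_agree Γ i n g g' (ρ : env M Γ) :
  (forall j, (j < i)%N -> forall m, m < n -> g j · m = g' j · m) ->
  (forall x : var (oracle_ctx Γ i) ty0, oracle_env i g ρ x = oracle_env i g' ρ x) /\
  (forall (X : var (oracle_ctx Γ i) ty1) m, m < n ->
     oracle_env i g ρ X · m = oracle_env i g' ρ X · m).
Proof.
elim: i => // i IH E; have [|E0 E1] := IH; first by move=> j ji; apply: E; apply: ltnW.
split=> x.
  apply: (@var_cons_ind _ ty1 (fun τ => match τ return var _ τ -> Prop with
    ty0 => fun x => oracle_env i.+1 g ρ x = oracle_env i.+1 g' ρ x | _ => fun _ => True end) _ _ ty0 x) => //.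
  by move=> [|? ?] y //=; apply: E0.
apply: (@var_cons_ind _ ty1 (fun τ => match τ return var _ τ -> Prop with
    arr ty0 ty0 => fun X => forall m, m < n ->
      oracle_env i.+1 g ρ X · m = oracle_env i.+1 g' ρ X · m
    | _ => fun _ => True end) _ _ ty1 x).
  by move=> m; apply: E.
by move=> [|[|? ?] [|? ?]] y //=; apply: E1.
Qed.

(** The set [X] and the witness are merged into one function [G]. The number [n] of the normal form
    is both the length of the initial segments and a code [<a, b>]; the matrix runs [m] at index [a]
    on these segments and counts as true when they are too short. No index is lost, since [b] can be
    taken so large that [<a, b>] exceeds the bound of the run. *)
Lemma sigma_kleene Γ i (P : env M (oracle_ctx Γ i.+1) -> Prop) : sigma_form P ->
  exists2 F : env M Γ -> M ty1, polynomial F & forall ρ g,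
    (exists X, P (econs X (oracle_env i g ρ))) <->
    kleene_true QEx 1 (F ρ) (oracles i g).
Proof.
move=> [m [W [pW HW]]].
have [c Hc] := Tup_component i.+1; have [Len [Nth HN]] := decode_Init M.
have [FstC HFst] : exists C : M (ty1 ⇒ ty1)%ty, forall G n, C · G · n = Fst M · (G · n) by def2.
have [SndC HSnd] : exists C : M (ty1 ⇒ ty1)%ty, forall G n, C · G · n = Snd M · (G · n) by def2.
pose ga s j := if j == i then FstC · (Nth · (c i · s)) else Nth · (c j · s).
pose h s := SndC · (Nth · (c i · s)).
pose len s := Len · (c i · s).
pose ξ s (ρ : env M Γ) := oracle_env i.+1 (ga s) ρ.
pose D s ρ := (1 - (obound (h s) (Fst M · len s) (ξ s ρ) m - len s)) *
  oval (h s) (Fst M · len s) (ξ s ρ) m.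
have Ptl : forall σ (x : var Γ σ), polynomial (fun ρ : env M (ty0 :: Γ) => ρ _ (VS x)).
  by move=> *; apply: pol_var.
have [P1 P2] : polynomial (fun ρ : env M (ty0 :: Γ) =>
    oval (h (ρ _ VZ)) (Fst M · len (ρ _ VZ)) (ξ (ρ _ VZ) (fun _ x => ρ _ (VS x))) m) /\
  polynomial (fun ρ : env M (ty0 :: Γ) =>
    obound (h (ρ _ VZ)) (Fst M · len (ρ _ VZ)) (ξ (ρ _ VZ) (fun _ x => ρ _ (VS x))) m).
  apply: (@pol_oval M (oracle_ctx Γ i.+1) (ty0 :: Γ) (fun ρ => h (ρ _ VZ))
    (fun ρ => Fst M · len (ρ _ VZ)) (fun ρ => ξ (ρ _ VZ) (fun _ x => ρ _ (VS x)))).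
  - by rewrite /h; pol.
  - by rewrite /len; pol.
  - apply: (@pol_oracle_env Γ (ty0 :: Γ) i.+1 (fun ρ => ga (ρ _ VZ)) (fun ρ _ x => ρ _ (VS x))); [|exact: Ptl].
    move=> j _; rewrite /ga; case: (j == i).
      by pol.
    by pol.
have [F pF HF] := @pol_lam0 M Γ (fun ρ => D (ρ _ VZ) (fun _ x => ρ _ (VS x)))
  ltac:(rewrite /D {2}/len; pol).
exists F => // ρ g.
have HD s : F ρ · s = 0 <->
    (obound (h s) (Fst M · len s) (ξ s ρ) m <= len s -> oval (h s) (Fst M · len s) (ξ s ρ) m = 0).
  rewrite HF; apply: rep_imp; [exact: rep_le|exact: rep_zero].
pose code G n := Tup (map (fun g => Init M · g · n) (oracles i.+1 (upd i G g))).
have key G X w : (forall n, X · n = Fst M · (G · n)) -> (forall n, w · n = Snd M · (G · n)) ->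
    (forall n, F ρ · code G n = 0) <-> (forall a, oval w a (econs X (oracle_env i g ρ)) m = 0).
  move=> EX Ew.
  have lenE n : len (code G n) = n by rewrite /len Hc //; apply: (HN _ _).1.
  (* Either the run on the segments is the true run, or both runs have a bound beyond [n]. *)
  have agr n : oval (h (code G n)) (Fst M · n) (ξ (code G n) ρ) m =
        oval w (Fst M · n) (econs X (oracle_env i g ρ)) m /\
      obound (h (code G n)) (Fst M · n) (ξ (code G n) ρ) m =
        obound w (Fst M · n) (econs X (oracle_env i g ρ)) m \/
      n < obound (h (code G n)) (Fst M · n) (ξ (code G n) ρ) m /\
      n < obound w (Fst M · n) (econs X (oracle_env i g ρ)) m.
    have Eh r : r < n -> h (code G n) · r = w · r.
      by move=> rn; rewrite /h HSnd /code Hc // (HN _ _).2 // /upd eqxx Ew.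
    rewrite -oracle_env_upd.
    have Ega j : (j < i.+1)%N -> forall r, r < n -> ga (code G n) j · r = upd i X g j · r.
      move=> ji r rn; rewrite /ga [in RHS]/upd; case: eqP => [_|ne].
        by rewrite HFst /code Hc // (HN _ _).2 // /upd eqxx EX.
      by rewrite /code Hc // (HN _ _).2 // /upd; case: eqP ne.
    have [E0 E1] := @oracle_env_agree Γ i.+1 n (ga (code G n)) (upd i X g) ρ Ega.
    have [b|nb] := pselect (obound (h (code G n)) (Fst M · n) (ξ (code G n) ρ) m <= n).
      by left; apply: (@oval_agree M _ n).
    have [b|nb'] := pselect (obound w (Fst M · n) (oracle_env i.+1 (upd i X g) ρ) m <= n).
      left; have [-> ->] := @oval_agree M _ n w (h (code G n)) (Fst M · n) _ (ξ (code G n) ρ) m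
        (fun x => esym (E0 x)) (fun Y r rn => esym (E1 Y r rn)) (fun r rn => esym (Eh r rn)) b.
      by split.
    by right; split; apply: contrapT => /d_leNlt.
  split=> [H a|H n].
    (* With the true bound as second component, [n = <a, b>] is at least [b], so the segments of
       length [n] suffice. *)
    pose b := obound w a (econs X (oracle_env i g ρ)) m.
    have /HD := H (Pair M · a · b); rewrite lenE.
    have := agr (Pair M · a · b); rewrite Fst_Pair -/b => -[[-> ->]|[_ lt_b]].
      by apply; apply: Pair_ge2.
    by have /d_leNlt := Pair_ge2 a b.
  apply/HD; rewrite lenE => le_n.
  by have [[-> _]|[lt_n _]] := agr n; [|case: ((d_leNlt _ _).1 le_n lt_n)].
rewrite /=; split=> [[X HX]|[G HG]].
  pose w := W (econs X (oracle_env i g ρ)).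
  have [G HG] : exists G : M ty1, forall n, G · n = Pair M · (X · n) · (w · n) by def1.
  exists G; rewrite -oracles_upd; apply/(key G X w); try by move=> n; rewrite HG ?Fst_Pair ?Snd_Pair.
  exact: (HW _).1 HX.
exists (FstC · G); apply: ((HW _).2 (SndC · G)); apply/(key G) => //.
by rewrite /code oracles_upd.
Qed.

Variables (E μ : M ty2).
Hypothesis HE : forall f, E · f = 0 <-> exists n, f · n = 0.
Hypothesis Hμ : forall f n, f · n = 0 -> f · (μ · f) = 0.

(** The context splits in two: quantified sets become oracles read through initial segments, while
    the matrix depends on the parameters in [Γ] polynomially. *)
Lemma second_order_normal_form k : forall q Γ i (A : fm (oracle_ctx Γ i)),
  (if q is QEx then Sigma1 k.+1 A else Pi1 k.+1 A) ->
  exists2 F : env M Γ -> M ty1, polynomial F & forall ρ g,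
    sat A (oracle_env i g ρ) <-> kleene_true q k.+1 (F ρ) (oracles i g).
Proof.
elim: k => [|k IH] [] Γ i A.
- move=> /Pi1_inv [B -> HB].
  have [_ _ nB] := arithmetical_normal_form HE Hμ (Sigma1_inv HB).
  (* A universal set quantifier is treated as the negation of [∃ X, ¬ B], whose matrix is then
     complemented. *)
  have [F pF HF] := @sigma_kleene Γ i (fun ρ => ~ sat B ρ) nB.
  have [F' pF' HF'] := @pol_lam0 M Γ (fun ρ => 1 - F (fun _ x => ρ _ (VS x)) · ρ _ VZ) ltac:(pol).
  exists F' => // ρ g.
  rewrite -[QAll]/(dual QEx) (@kleene_true_not M _ _ (F ρ)); last by move=> s; rewrite HF'; apply: rep_not.
  rewrite -HF (@sat_AllSet_any 0); last by right.
  split=> [H [X]|H X]; first by apply.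
  by apply: contrapT => nX; apply: H; exists X.
- move=> /Sigma1_inv [B -> HB].
  have [_ sB _] := arithmetical_normal_form HE Hμ (Pi1_inv HB).
  have [F pF HF] := @sigma_kleene Γ i (sat B) sB.
  exists F => // ρ g; rewrite -HF (@sat_ExSet_any 0) //; by left.
- move=> /Pi1_inv [B -> HB].
  have [F pF HF] := IH QEx Γ i.+1 B HB.
  exists F => // ρ g; rewrite (@sat_AllSet_any k.+1); last by right.
  by split=> H X; have := H X; rewrite -oracle_env_upd -oracles_upd HF.
- move=> /Sigma1_inv [B -> HB].
  have [F pF HF] := IH QAll Γ i.+1 B HB.
  exists F => // ρ g; rewrite (@sat_ExSet_any k.+1); last by left.
  by split=> -[X H]; exists X; move: H; rewrite -oracle_env_upd -oracles_upd HF.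
Qed.

(** Here [Y] and [m] count as parameters, so the matrix is a functional of them. [S] decides the
    dual form, which starts with an existential quantifier, and its answer is negated. *)
Lemma Pi1_decision k (S : M ty2) : (forall f, S · f = 0 <-> kleene_true QEx k.+1 f []) ->
  forall Γ (θ : fm (ty1 :: ty0 :: Γ)), Pi1 k.+1 θ -> forall ρ : env M Γ,
  exists G : M (ty0 ⇒ ty1 ⇒ ty0)%ty, forall m Y,
    G · m · Y = 0 <-> sat θ (econs Y (econs m ρ)).
Proof.
move=> HS Γ θ Hθ ρ.
have [F pF HF] := @second_order_normal_form k QAll (ty1 :: ty0 :: Γ) 0%N θ Hθ.
have [F1 pF1 HF1] := pol_lam pF; have [F2 pF2 HF2] := pol_lam pF1.
have [nt Hnt] : exists nt : M (ty1 ⇒ ty1)%ty, forall f s, nt · f · s = 1 - f · s by def2.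
have [G HG] : exists G : M (ty0 ⇒ ty1 ⇒ ty0)%ty, forall m Y,
    G · m · Y = 1 - S · (nt · (F2 ρ · m · Y)) by def2.
exists G => m Y; rewrite HG (HF _ (fun _ => Y)) HF2 HF1.
have := rep_not (HS (nt · F (econs Y (econs m ρ)))); rewrite /rep => ->.
rewrite -[QEx]/(dual QAll) (@kleene_true_not M _ _ (F (econs Y (econs m ρ)))).
  by split=> [H|H]; [apply: contrapT|].
by move=> s; rewrite Hnt; apply: rep_not.
Qed.

End SecondOrderNormalForm.

(** * Real numbers *)

Section Reals.
Variable M : arith_model.
Implicit Types (a b c d i m n p : M ty0) (x y z : M ty1).
Local Notation F := (fld M).

Definition ratv p : F := ((ι (Fst M · p) - ι (Fst M · (Snd M · p))) / (ι (Snd M · (Snd M · p)) + 1))%R.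
Definition qv x n : F := ratv (x · n).
Definition ev n : F := ((ι (Pow2 M · n))^-1)%R.

Definition real_d x := forall n i, (qv x n - qv x (n + i)%D < ev n /\ qv x (n + i)%D - qv x n < ev n)%R.
Definition real_eq_d x y := forall n, (qv x n - qv y n <= 2 * ev n /\ qv y n - qv x n <= 2 * ev n)%R.
Definition real_lt_d x y := exists n, (qv x n + 2 * ev n < qv y n)%R.
(** The two bounds are the negations of [x < 0] and [1 < x], read off each approximation. *)
Definition unit_d x := real_d x /\ (forall n, (0 <= qv x n + 2 * ev n)%R) /\
  (forall n, (qv x n <= 1 + 2 * ev n)%R).

Section RationalTerms.
Variables (Γ : ctx) (ρ : env M Γ).
Implicit Types (r s : rat Γ).

Definition rval r : F := ((ι (eval ρ (rp r)) - ι (eval ρ (rm r))) / ι (eval ρ (rd r)))%R.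
Definition rpos r := (0 < ι (eval ρ (rd r)))%R.

Lemma rpos_add r s : rpos r -> rpos s -> rpos (radd r s).
Proof. by rewrite /rpos [rd _]/= emb_M; apply: mulr_gt0. Qed.
Lemma rpos_sub r s : rpos r -> rpos s -> rpos (rsub r s).
Proof. by rewrite /rpos [rd _]/= emb_M; apply: mulr_gt0. Qed.

Lemma rval_add r s : rpos r -> rpos s -> rval (radd r s) = (rval r + rval s)%R.
Proof.
move=> /lt0r_neq0 r0 /lt0r_neq0 s0; rewrite /rval addf_div //; cbn [rp rm rd radd].
rewrite !(eval_plus, eval_times) !emb_E.
by congr (_ / _)%R; ring.
Qed.

Lemma rval_neg r : rval (rneg r) = (- rval r)%R.
Proof. by rewrite /rval [rp _]/= [rm _]/= [rd _]/= -mulNr opprB. Qed.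

Lemma rval_sub r s : rpos r -> rpos s -> rval (rsub r s) = (rval r - rval s)%R.
Proof. by move=> r0 s0; rewrite /rsub rval_add // rval_neg. Qed.

Lemma cross_lt (u v w a b c : F) : (0 < w -> 0 < c ->
  (u * c + b * w < a * w + v * c) = ((u - v) / w < (a - b) / c))%R.
Proof.
move=> w0 c0; rewrite ltr_pdivrMr // mulrAC ltr_pdivlMr //.
by apply/idP/idP => H; lra.
Qed.

Lemma cross_le (u v w a b c : F) : (0 < w -> 0 < c ->
  (u * c + b * w <= a * w + v * c) = ((u - v) / w <= (a - b) / c))%R.
Proof.
move=> w0 c0; rewrite ler_pdivrMr // mulrAC ler_pdivlMr //.
by apply/idP/idP => H; lra.
Qed.

Lemma sat_rlt r s : rpos r -> rpos s -> sat (rlt r s) ρ <-> (rval r < rval s)%R.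
Proof.
move=> r0 s0; rewrite /rval -cross_lt //.
by rewrite /rlt [sat _ _]/= emb_lt !emb_E.
Qed.

Lemma sat_rle r s : rpos r -> rpos s -> sat (rle r s) ρ <-> (rval r <= rval s)%R.
Proof.
move=> r0 s0; rewrite /rval -cross_le //.
by rewrite /rle sat_Le emb_le /= !emb_E.
Qed.

Lemma sat_rabs_lt r s : rpos r -> rpos s ->
  sat (rabs_lt r s) ρ <-> (rval r < rval s)%R /\ (- rval r < rval s)%R.
Proof. by move=> r0 s0; rewrite /rabs_lt sat_And !sat_rlt // rval_neg. Qed.

Lemma sat_rabs_le r s : rpos r -> rpos s ->
  sat (rabs_le r s) ρ <-> (rval r <= rval s)%R /\ (- rval r <= rval s)%R.
Proof. by move=> r0 s0; rewrite /rabs_le sat_And !sat_rle // rval_neg. Qed.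

Lemma rval_approx (x : tm Γ ty1) t : rval (approx x t) = qv (eval ρ x) (eval ρ t).
Proof.
rewrite /rval /approx /ratc [rp _]/= [rm _]/= [rd _]/= eval_plus !(eval_pfst, eval_psnd) emb_D.
by rewrite eval_one emb_1.
Qed.
Lemma rpos_approx (x : tm Γ ty1) t : rpos (approx x t).
Proof.
rewrite /rpos /approx /ratc [rd _]/= eval_plus emb_D eval_one emb_1.
by have := emb_ge0 (eval ρ (psnd (psnd (x · t)))); lra.
Qed.

Lemma rval_eps t : rval (eps t) = ev (eval ρ t).
Proof.
rewrite /rval /eps [rp _]/= [rm _]/= [rd _]/= eval_pow2.
by rewrite eval_one eval_zero !emb_E subr0 mul1r.
Qed.
Lemma rpos_eps t : rpos (eps t).
Proof. by rewrite /rpos [rd _]/= eval_pow2 -(emb_0 M); apply/emb_lt/Pow2_gt0. Qed.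

Lemma rval_eps2 t : rval (eps2 t) = (2 * ev (eval ρ t))%R.
Proof.
rewrite /rval /eps2 [rp _]/= [rm _]/= [rd _]/= eval_pow2 eval_plus.
by rewrite eval_one eval_zero !emb_E subr0.
Qed.
Lemma rpos_eps2 t : rpos (eps2 t).
Proof. by rewrite /rpos [rd _]/= eval_pow2 -(emb_0 M); apply/emb_lt/Pow2_gt0. Qed.

End RationalTerms.

Lemma forall_iff T (P Q : T -> Prop) : (forall t, P t <-> Q t) -> (forall t, P t) <-> (forall t, Q t).
Proof. by move=> PQ; split=> H t; apply/PQ. Qed.

Lemma exists_iff T (P Q : T -> Prop) : (forall t, P t <-> Q t) -> (exists t, P t) <-> (exists t, Q t).
Proof. by move=> PQ; split=> -[t Ht]; exists t; apply/PQ. Qed.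

Definition rposE := (rpos_approx, rpos_eps, rpos_eps2, rpos_add, rpos_sub).

Section RealFormulas.
Variables (Γ : ctx) (ρ : env M Γ).
Implicit Types (X Y Z : tm Γ ty1).

Lemma sat_is_real X : sat (is_real X) ρ <-> real_d (eval ρ X).
Proof.
rewrite /is_real sat_All; apply: forall_iff => n; rewrite sat_All; apply: forall_iff => i.
rewrite sat_rabs_lt ?rposE // rval_sub ?rposE // !rval_approx rval_eps eval_plus !eval_wk.
by rewrite opprB.
Qed.

Lemma sat_real_eq X Y : sat (real_eq X Y) ρ <-> real_eq_d (eval ρ X) (eval ρ Y).
Proof.
rewrite /real_eq sat_All; apply: forall_iff => n.
rewrite sat_rabs_le ?rposE // rval_sub ?rposE // !rval_approx rval_eps2 !eval_wk.
by rewrite opprB.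
Qed.

Lemma sat_real_lt X Y : sat (real_lt X Y) ρ <-> real_lt_d (eval ρ X) (eval ρ Y).
Proof.
rewrite /real_lt sat_Ex; apply: exists_iff => n.
by rewrite sat_rlt ?rposE // rval_add ?rposE // !rval_approx rval_eps2 !eval_wk.
Qed.

Lemma sat_real_le X Y : sat (real_le X Y) ρ <-> ~ real_lt_d (eval ρ Y) (eval ρ X).
Proof. by rewrite -sat_real_lt. Qed.

Lemma sat_real_lt_add X Y Z : sat (real_lt_add X Y Z) ρ <-> exists n,
  (qv (eval ρ X) n + 2 * ev n < qv (eval ρ Y) (n + 1)%D + qv (eval ρ Z) (n + 1)%D)%R.
Proof.
rewrite /real_lt_add sat_Ex; apply: exists_iff => n.
by rewrite sat_rlt ?rposE // !rval_add ?rposE // !rval_approx rval_eps2 eval_plus !eval_wk.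
Qed.

Lemma sat_real_sub_lt Y Z X : sat (real_sub_lt Y Z X) ρ <-> exists n,
  (qv (eval ρ Y) (n + 1)%D - qv (eval ρ Z) (n + 1)%D + 2 * ev n < qv (eval ρ X) n)%R.
Proof.
rewrite /real_sub_lt sat_Ex; apply: exists_iff => n.
by rewrite sat_rlt ?rposE // rval_add ?rval_sub ?rposE // !rval_approx rval_eps2 eval_plus !eval_wk.
Qed.

Lemma ratv_nat m : ratv (Pair M · m · (Pair M · 0 · 0)) = ι m.
Proof. by rewrite /ratv !(Snd_Pair, Fst_Pair) emb_0 subr0 add0r divr1. Qed.

Lemma qv_real_nat t n : qv (eval ρ (real_nat t)) n = ι (eval ρ t).
Proof.
rewrite /qv /real_nat -[eval ρ (_ · _)%tm]/(cint M (CPi ty0 ty0) · eval ρ (pair t (pair 0%tm 0%tm))).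
by rewrite PiE !eval_pair ratv_nat.
Qed.

Lemma sat_in_unit X : sat (in_unit X) ρ <-> unit_d (eval ρ X).
Proof.
rewrite /in_unit 2!sat_And sat_is_real !sat_real_le.
have E (t : tm Γ ty0) n : qv (eval ρ (real_nat t)) n = ι (eval ρ t) by apply: qv_real_nat.
rewrite /unit_d; split=> -[HR [H0 H1]]; (split; [by []|split]).
- move=> n; rewrite leNgt; apply/negP => lt0; apply: H0; exists n.
  by rewrite E eval_zero emb_0.
- move=> n; rewrite leNgt; apply/negP => lt0; apply: H1; exists n.
  by rewrite E eval_one emb_1.
- move=> [n]; rewrite E eval_zero emb_0 => lt0.
  by have := H0 n; rewrite leNgt lt0.
- move=> [n]; rewrite E eval_one emb_1 => lt0.
  by have := H1 n; rewrite leNgt lt0.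
Qed.

End RealFormulas.

(** The form in which HBU is applied, with inequalities in the field: the functional to be used
    sends equal reals to identical objects, which is stronger than respecting [real_eq]. *)
Lemma HBU_model : sat HBU (enil : env M []) -> forall Ψ : M (ty1 ⇒ ty1)%ty,
  (forall x, real_d x -> real_d (Ψ · x) /\ exists n, (2 * ev n < qv (Ψ · x) n)%R) ->
  (forall x y, real_d x -> real_d y -> real_eq_d x y -> Ψ · x = Ψ · y) ->
  exists (k : M ty0) (y : M (ty0 ⇒ ty1)%ty),
  forall x, unit_d x -> exists i, [/\ i < k, real_d (y · i),
    exists n, (qv (y · i) (n + 1)%D - qv (Ψ · (y · i)) (n + 1)%D + 2 * ev n < qv x n)%R &
    exists n, (qv x n + 2 * ev n < qv (y · i) (n + 1)%D + qv (Ψ · (y · i)) (n + 1)%D)%R].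
Proof.
rewrite /HBU sat_All => H Ψ HΨ EΨ; have pf : sat (pos_fun #0%tm) (econs Ψ enil).
  rewrite /pos_fun sat_And !sat_All; split.
    move=> x; rewrite sat_Imp sat_And !sat_is_real sat_real_lt => /HΨ [HR [n Hn]].
    by split=> //; exists n; rewrite qv_real_nat eval_zero emb_0 add0r.
  move=> x; rewrite sat_All => y; rewrite !sat_Imp !sat_is_real !sat_real_eq => Hx Hy Exy n.
  rewrite [eval _ _](EΨ x y Hx Hy Exy) subrr; have := (Pow2_gt0 n); rewrite emb_lt emb_0 => P0.
  have : (0 < ev n)%R by rewrite invr_gt0.
  by split; lra.
have := H Ψ; rewrite sat_Imp => /(_ pf) /sat_Ex [k /sat_Ex [y]]; rewrite sat_And !sat_All => -[Hy Hcov].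
exists k, y => x Hx; have := Hcov x; rewrite sat_Imp sat_in_unit => /(_ Hx) /sat_Ex [i].
rewrite !sat_And sat_real_sub_lt sat_real_lt_add => -[ik [H1 H2]].
exists i; split=> //.
by have := Hy i; rewrite sat_Imp sat_in_unit => /(_ ik) [].
Qed.

End Reals.

(** * Covering Cantor space *)

Section CantorCover.
Variable M : arith_model.
Implicit Types (a b c d i m n p C : M ty0) (x y z Z : M ty1).
Local Notation F := (fld M).

Lemma Pow2_pos n : (0 < ι (Pow2 M · n))%R.
Proof. by rewrite -(emb_0 M); apply/emb_lt/Pow2_gt0. Qed.

Lemma Pow2_ge1 n : (1 <= ι (Pow2 M · n))%R.
Proof.
rewrite -(emb_1 M); apply/emb_le; move: n; apply: d_induction; first by char1.
  by rewrite Pow2_0; apply: dle_refl.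
by move=> n IH; rewrite Pow2_S; to_field; lra.
Qed.

Lemma ev_pos n : (0 < ev n)%R.
Proof. by rewrite invr_gt0 Pow2_pos. Qed.

Lemma ev_S n : ev (n + 1) = (ev n / 2)%R.
Proof.
rewrite /ev Pow2_S emb_D; have P0 : ι (Pow2 M · n) != 0%R by rewrite gt_eqF // Pow2_pos.
by field; rewrite P0 -mulr2n mulrn_eq0.
Qed.

Lemma ev_D m n : ev (m + n) = (ev m * ev n)%R.
Proof. by rewrite /ev Pow2D emb_M invfM. Qed.

Lemma ev_le1 n : (ev n <= 1)%R.
Proof. by rewrite invf_le1 ?Pow2_pos // Pow2_ge1. Qed.

Lemma ratv_frac a d : 0 < d -> ratv (Pair M · a · (Pair M · 0 · (d - 1))) = (ι a / ι d)%R.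
Proof.
move=> /d_discrete /MonusK E; rewrite /ratv !(Snd_Pair, Fst_Pair) emb_0 subr0.
by rewrite -[in RHS]E emb_D emb_1 addrC.
Qed.

(* [DA · Z · n] is the numerator of [Σ_{i<n} 2 Z(i) / 4^{i+1}] over [4^n]. *)
Lemma digit_accumulator : exists DA : M (ty1 ⇒ ty0 ⇒ ty0)%ty, forall Z,
  DA · Z · 0 = 0 /\ forall n,
  DA · Z · (n + 1) = (DA · Z · n + DA · Z · n) + (DA · Z · n + DA · Z · n) + (Z · n + Z · n).
Proof.
have [z Hz] : exists z : M ty2, forall Z, z · Z = 0 by def1.
have [h Hh] : exists h : M (ty1 ⇒ ty0 ⇒ ty0 ⇒ ty0)%ty, forall Z n C,
    h · Z · n · C = (C + C) + (C + C) + (Z · n + Z · n) by def3.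
have [R HR] := d_recursion z h.
by exists R => Z; split=> [|n]; rewrite ?(HR Z).1 ?(HR Z).2 ?Hz ?Hh.
Qed.

Lemma bit_cases b : b <= 1 -> b = 0 \/ b = 1.
Proof.
move=> b1; have [|[m E]] := d_case b; [by left|right].
by have m0 := emb_ge0 m; rewrite E in b1 *; to_field; lra.
Qed.

Variable DA : M (ty1 ⇒ ty0 ⇒ ty0)%ty.
Hypothesis DA0 : forall Z, DA · Z · 0 = 0.
Hypothesis DAS : forall Z n,
  DA · Z · (n + 1) = (DA · Z · n + DA · Z · n) + (DA · Z · n + DA · Z · n) + (Z · n + Z · n).

Definition four n := Pow2 M · (n + n).

Lemma emb_four n : ι (four n) = (ι (Pow2 M · n) * ι (Pow2 M · n))%R.
Proof. by rewrite /four Pow2D emb_M. Qed.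

Lemma four_S n : ι (four (n + 1)) = (4 * ι (four n))%R.
Proof. by rewrite !emb_four Pow2_S emb_D; ring. Qed.
Lemma four_D m n : ι (four (m + n)) = (ι (four m) * ι (four n))%R.
Proof. by rewrite !emb_four Pow2D emb_M; ring. Qed.
Lemma four_pos n : (0 < ι (four n))%R.
Proof. by rewrite Pow2_pos. Qed.

Definition partial Z n : F := (ι (DA · Z · n) / ι (four n))%R.

(** Digits after the first [m] add between 0 and [4^{-m} - 4^{-(m+i)}], stated for numerators. The
    upper bound persists because [4 d + 2 + 1 <= 4 (d + 1)]. *)
Lemma DA_tail Z : is_char Z -> forall m i,
  DA · Z · m * four i <= DA · Z · (m + i) /\
  DA · Z · (m + i) + 1 <= (DA · Z · m + 1) * four i.
Proof.
move=> HZ m; apply: d_induction; first by rewrite /four; char1.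
  by rewrite dadd0 /four dadd0 Pow2_0 !dmul1; split; apply: dle_refl.
move=> i; have -> : m + (i + 1) = (m + i) + 1 by rewrite daddA.
have := HZ (m + i); have := emb_ge0 (Z · (m + i)).
rewrite DAS !emb_le !emb_E four_S => *; split; lra.
Qed.

Lemma partial_tail Z : is_char Z -> forall m i,
  (partial Z m <= partial Z (m + i)%D)%R /\
  (partial Z (m + i)%D + (ι (four (m + i)%D))^-1 <= partial Z m + (ι (four m))^-1)%R.
Proof.
move=> HZ m i; have [] := DA_tail HZ m i; rewrite !emb_le !emb_E => H1 H2.
have m0 := four_pos m; have i0 := four_pos i.
have Em : partial Z m = (ι (DA · Z · m) * ι (four i) / ι (four (m + i)%D))%R.
  by rewrite /partial four_D -mulf_div divff ?mulr1 // gt_eqF.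
have Em' : ((ι (four m))^-1 = ι (four i) / ι (four (m + i)%D))%R.
  by rewrite four_D invfM mulrCA divff ?mulr1 // gt_eqF.
rewrite Em' Em /partial -mulrDl -[X in (_ + X <= _)%R]mul1r -mulrDl.
rewrite !ler_pM2r ?invr_gt0 ?four_pos //; split=> //.
by lra.
Qed.

Lemma inv_four n : ((ι (four n))^-1 = ev n * ev n)%R.
Proof. by rewrite emb_four invfM. Qed.

Lemma inv_four_le n : ((ι (four n))^-1 <= ev n)%R.
Proof. by rewrite inv_four; have := ev_pos n; have := ev_le1 n => *; nra. Qed.

Lemma cantor_real : exists rl : M (ty1 ⇒ ty1)%ty, forall Z n, qv (rl · Z) n = partial Z n.
Proof.
have [rl Hrl] : exists rl : M (ty1 ⇒ ty1)%ty, forall Z n,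
    rl · Z · n = Pair M · (DA · Z · n) · (Pair M · 0 · (Pow2 M · (n + n) - 1)) by def2.
exists rl => Z n; rewrite /qv Hrl ratv_frac //.
by apply/emb_lt; rewrite emb_0; apply: four_pos.
Qed.

Lemma cantor_real_unit rl Z : (forall n, qv (rl · Z) n = partial Z n) -> is_char Z ->
  unit_d (rl · Z).
Proof.
move=> Hrl HZ; have P0 n : (0 <= partial Z n < 1)%R.
  have [] := partial_tail HZ 0 n; rewrite !(daddC 0) !dadd0 /partial DA0 emb_0 mul0r add0r.
  have -> : ι (four 0) = 1%R by rewrite emb_four Pow2_0 emb_1 mulr1.
  rewrite invr1 => -> H2; rewrite /=; have : (0 < (ι (four n))^-1)%R by rewrite invr_gt0 four_pos.
  by lra.
split; last by split=> n; rewrite Hrl; have := P0 n; have := ev_pos n => ? /andP [? ?]; lra.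
move=> n i; rewrite !Hrl; have [H1 H2] := partial_tail HZ n i.
have := inv_four_le n; have : (0 < (ι (four (n + i)%D))^-1)%R by rewrite invr_gt0 four_pos.
by have := ev_pos n; split; lra.
Qed.

(* [x] lies to the left of the middle of the gap that separates the Cantor reals with
   digits 0 and 2 after the first [i] digits, of which [C / 4^i] is the value *)
Definition left_of x i C := exists n,
  (qv x n + 2 * ev n < (4 * ι C + 3 / 2) / ι (four (i + 1)%D))%R.

Lemma left_of_eq x y i C : real_d x -> real_d y -> real_eq_d x y ->
  left_of x i C -> left_of y i C.
Proof.
(* At [n + 2] the errors fit exactly: [2^{-n} + 2 · 2^{-n-2} + 2 · 2^{-n-2} = 2 · 2^{-n}]. *)
move=> Hx Hy E [n Hn]; exists (n + 1 + 1).
have [E1 E2] := E (n + 1 + 1); have [H1 H2] := Hx n (1 + 1).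
have En : n + (1 + 1) = n + 1 + 1 by rewrite daddA.
by rewrite En in H1 H2; move: E1 E2; rewrite !ev_S => *; lra.
Qed.

Variable E : M ty2.
Hypothesis HE : forall f, E · f = 0 <-> exists n, f · n = 0.

Lemma cross_frac (u v w c e t : F) : (0 < w -> 0 < e -> 0 < t ->
  (((u - v) / w + 2 * e^-1 < (4 * c + 3 / 2) / t) =
   (u * e * (t + t) + 2 * w * (t + t) < (8 * c + 3) * w * e + v * e * (t + t))))%R.
Proof.
move=> w0 e0 t0.
have -> : ((u - v) / w + 2 * e^-1 = ((u - v) * e + 2 * w) / (w * e))%R.
  by field; rewrite !gt_eqF.
rewrite ltr_pdivrMr ?mulr_gt0 // mulrAC ltr_pdivlMr //.
by apply/idP/idP => H; lra.
Qed.

(** Clearing denominators turns each instance into an inequality between numbers of the model; the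
    quantifier over approximations is left to [E]. *)
Lemma left_of_char : exists L : M (ty1 ⇒ ty0 ⇒ ty0 ⇒ ty0)%ty, forall x i C,
  L · x · i · C = 0 <-> left_of x i C.
Proof.
have [c Hc] : exists c : M (ty1 ⇒ ty0 ⇒ ty0 ⇒ ty0 ⇒ ty0)%ty, forall x i C n,
    c · x · i · C · n = 0 <->
    Fst M · (x · n) * (Pow2 M · n) * (four (i + 1) + four (i + 1))
      + (1 + 1) * (Snd M · (Snd M · (x · n)) + 1) * (four (i + 1) + four (i + 1)) <
    (((C + C) + (C + C)) + ((C + C) + (C + C)) + (1 + 1 + 1)) * (Snd M · (Snd M · (x · n)) + 1) * (Pow2 M · n)
      + Fst M · (Snd M · (x · n)) * (Pow2 M · n) * (four (i + 1) + four (i + 1)).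
  by rewrite /four; char4.
have [L HL] : exists L : M (ty1 ⇒ ty0 ⇒ ty0 ⇒ ty0)%ty, forall x i C,
    L · x · i · C = E · (c · x · i · C) by def3.
exists L => x i C; rewrite HL HE; apply: exists_iff => n.
rewrite Hc /qv /ratv /ev cross_frac ?Pow2_pos ?four_pos //; last first.
  by have := emb_ge0 (Snd M · (Snd M · (x · n))); lra.
rewrite emb_lt !(emb_D, emb_M, emb_1).
by split=> H; lra.
Qed.

(** Recursion yields only numbers, so the iteration runs over the numerator of the digits found so
    far. Each digit is computed from it, and [DA] of the decoded sequence gives the numerator
    back. *)
Lemma decode_digits : exists Dec : M (ty1 ⇒ ty1)%ty, forall x,
  is_char (Dec · x) /\ forall n, Dec · x · n = 0 <-> left_of x n (DA · (Dec · x) · n).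
Proof.
have [L HL] := left_of_char.
have [z Hz] : exists z : M ty2, forall x, z · x = 0 by def1.
have [h Hh] : exists h : M (ty1 ⇒ ty0 ⇒ ty0 ⇒ ty0)%ty, forall x n C,
    h · x · n · C = (C + C) + (C + C) + ((1 - (1 - L · x · n · C)) + (1 - (1 - L · x · n · C))) by def3.
have [R HR] := d_recursion z h.
have [Dec HDec] : exists Dec : M (ty1 ⇒ ty1)%ty, forall x n,
    Dec · x · n = 1 - (1 - L · x · n · (R · x · n)) by def2.
exists Dec => x.
have ER n : DA · (Dec · x) · n = R · x · n.
  move: n; apply: d_induction; first by char1.
    by rewrite DA0 (HR x).1 Hz.
  by move=> n IH; rewrite DAS IH (HR x).2 Hh HDec.
split=> n; rewrite HDec; first exact: bit_le1.
rewrite ER -HL; have := rep_not (rep_not (rep_zero (L · x · n · (R · x · n)))).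
by rewrite /rep => ->; split=> [|-> //]; apply: contrapT.
Qed.

Variable Dec : M (ty1 ⇒ ty1)%ty.
Hypothesis Dec_char : forall x, is_char (Dec · x).
Hypothesis DecE : forall x n, Dec · x · n = 0 <-> left_of x n (DA · (Dec · x) · n).

Lemma Dec_eq x y : real_d x -> real_d y -> real_eq_d x y -> Dec · x = Dec · y.
Proof.
move=> Hx Hy Exy.
have Eyx : real_eq_d y x by move=> n; have [] := Exy n; split.
have step n : DA · (Dec · x) · n = DA · (Dec · y) · n -> Dec · x · n = Dec · y · n.
  move=> EC; have Hiff : Dec · x · n = 0 <-> Dec · y · n = 0.
    by rewrite !DecE EC; split; apply: left_of_eq.
  have [Ex|Ex] := bit_cases (Dec_char x n); have [Ey|Ey] := bit_cases (Dec_char y n); rewrite Ex Ey //.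
    by have /Hiff := Ex; rewrite Ey.
  by have /Hiff := Ey; rewrite Ex.
apply: (app_ext (am_normal M)) => n; apply: (step n); move: n; apply: d_induction; first by char1.
  by rewrite !DA0.
by move=> n IH; rewrite !DAS IH step.
Qed.

(** Let [t = 4^{-(n+1)}]. With [n] digits in common, the real of [Z] is at least [t / 2] away from
    the middle of the gap, whereas [x] is within [r <= t / 4] of that real. Both lie on the same
    side, which determines the digit. *)
Lemma gap x Z N n (r : F) : real_d x -> is_char Z ->
  (r <= (ι (four (N + 1 + 1)%D))^-1)%R -> n <= N ->
  (exists b, (qv x (b + 1)%D - r + 2 * ev b < partial Z b)%R) ->
  (exists b, (partial Z b + 2 * ev b < qv x (b + 1)%D + r)%R) ->
  DA · Z · n = DA · (Dec · x) · n -> Z · n = Dec · x · n.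
Proof.
move=> Hx HZ Hr nN [b1 H1] [b2 H2] EC.
pose t : F := ((ι (four (n + 1)%D))^-1)%R.
pose C := DA · Z · n.
have t0 : (0 < t)%R by rewrite invr_gt0 four_pos.
have rt : (r <= t / 4)%R.
  apply: le_trans Hr _; have [j ->] : exists j, N = n + j by exists (N - n); rewrite MonusK.
  have p1 : (0 < (ι (four n))^-1)%R by rewrite invr_gt0 four_pos.
  have p2 : ((ι (four n))^-1 * (ι (four j))^-1 <= (ι (four n))^-1)%R.
    by apply: ler_piMr; [exact: ltW|exact: le_trans (inv_four_le j) (ev_le1 j)].
  by rewrite /t !four_S four_D !invfM; lra.
have [Zn|Zn] := bit_cases (HZ n); have [Dn|Dn] := bit_cases (Dec_char x n); rewrite Zn Dn //; exfalso.
(* Digit 0 in [Z] but 1 in the decoding: [x] is not left of the middle at any precision. *)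
- have nl a : ((4 * ι C + 3 / 2) * t <= qv x a + 2 * ev a)%R.
    rewrite leNgt; apply/negP => lt; have : Dec · x · n = 0.
      by apply/DecE; exists a; rewrite -EC.
    by rewrite Dn => /done_neq0.
  have [T1 _] := partial_tail HZ b1 (n + 1); have [_ T2] := partial_tail HZ (n + 1) b1.
  have p0 : (0 < (ι (four (n + 1 + b1)%D))^-1)%R by rewrite invr_gt0 four_pos.
  have Ep : partial Z (n + 1) = (4 * ι C * t)%R.
    by rewrite /partial DAS Zn dadd0 dadd0 -/t !emb_D -/C; congr (_ * _)%R; lra.
  have := nl (b1 + 1); rewrite ev_S; have := ev_pos b1.
  by move: T1 T2 p0; rewrite (daddC b1) Ep -/t => *; lra.
- have /DecE [a] := Dn; rewrite -EC -/C -/t => Ha.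
  have [_ T1] := partial_tail HZ b2 (n + 1); have [T2 _] := partial_tail HZ (n + 1) b2.
  have p0 : (0 < (ι (four (n + 1 + b2)%D))^-1)%R by rewrite invr_gt0 four_pos.
  have Ep : partial Z (n + 1) = ((4 * ι C + 2) * t)%R.
    by rewrite /partial DAS Zn -/t !emb_D -/C emb_1; congr (_ * _)%R; lra.
  have e1 := inv_four_le b2; have e2 := ev_pos a; have e3 := ev_pos b2.
  move: T1 T2 p0 H2; rewrite (daddC b2) Ep => T1 T2 p0 H2.
  (* [x] is known to be left of the middle at precision [a] and near [Z] at precision [b2 + 1]; a
     real compares an approximation only with later ones, hence the two cases. *)
  have [le|le] : a <= b2 + 1 \/ b2 + 1 <= a.
    by have [?|[->|?]] := dlt_total a (b2 + 1); [left; left|left; right|right; left].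
  + have [_] := Hx a (b2 + 1 - a); rewrite (MonusK le) => H3.
    by lra.
  + have [+ _] := Hx (b2 + 1) (a - (b2 + 1)); rewrite (MonusK le) ev_S => H3.
    by lra.
Qed.

End CantorCover.

(** HBU may return centres that are not in the image of Cantor space, so they are decoded. The
    radius is computed from the decoded sequence, which is identical for equal reals. *)
Theorem cantor_cover (M : arith_model) (E : M ty2) :
  (forall f, E · f = 0 <-> exists n, f · n = 0) -> sat HBU (enil : env M []) ->
  forall N : M ty2, exists (k : M ty0) (Y : M (ty0 ⇒ ty1)%ty),
    (forall i, is_char (Y · i)) /\
    forall Z, is_char Z -> exists2 i, i < k & forall n, n <= N · (Y · i) -> Z · n = Y · i · n.
Proof.
move=> HE HB N.
have [DA HDA] := digit_accumulator M.
have DA0 Z := (HDA Z).1; have DAS Z n := (HDA Z).2 n.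
have [Dec HDec] := decode_digits DA0 DAS HE.
have Dec_char x := (HDec x).1; have DecE x n := (HDec x).2 n.
have [rl Hrl] := cantor_real DA.
(* The constant sequence with value [4^{-(N+2)}]; a code [c] stands for the denominator [c + 1],
   hence the [- 1]. *)
have [Ψ HΨ] : exists Ψ : M (ty1 ⇒ ty1)%ty, forall x n, Ψ · x · n =
    Pair M · 1 · (Pair M · 0 · (Pow2 M · (N · (Dec · x) + 1 + 1 + (N · (Dec · x) + 1 + 1)) - 1)) by def2.
have qΨ x n : qv (Ψ · x) n = ((ι (four (N · (Dec · x) + 1 + 1)%D))^-1)%R.
  rewrite /qv HΨ ratv_frac; first by rewrite emb_1 mul1r.
  by apply/emb_lt; rewrite emb_0; apply: four_pos.
have [|x y Hx Hy Exy|k [y Hy]] := HBU_model HB (Ψ := Ψ).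
- move=> x Hx; split=> [n i|]; first by rewrite !qΨ subrr ev_pos.
  have key (m : M ty0) : exists n, (2 * ev n < ev m * ev m)%R.
    (* [2 · 2^{-(2m+2)}] is half of [2^{-2m}]. *)
    exists (m + m + 1 + 1); rewrite !ev_S ev_D.
    by have : (0 < ev m * ev m)%R by [rewrite mulr_gt0 ?ev_pos]; lra.
  have [n Hn] := key (N · (Dec · x) + 1 + 1).
  by exists n; rewrite qΨ inv_four.
- by apply: (app_ext (am_normal M)) => n; rewrite !HΨ (Dec_eq DA0 DAS Dec_char DecE Hx Hy Exy).
have [Y HY] : exists Y : M (ty0 ⇒ ty1)%ty, forall i, Y · i = Dec · (y · i) by def1.
exists k, Y; split=> [i|Z HZ]; first by rewrite HY.
have [i [ik Hyi [b1 H1] [b2 H2]]] := Hy _ (cantor_real_unit DA0 DAS (Hrl Z) HZ).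
exists i => //; rewrite HY; set N0 := N · (Dec · (y · i)).
have same n : n <= N0 -> DA · Z · n = DA · (Dec · (y · i)) · n -> Z · n = Dec · (y · i) · n.
  move=> nN; apply: (gap DAS Dec_char DecE Hyi HZ (lexx _) nN).
    by exists b1; move: H1; rewrite qΨ Hrl.
  by exists b2; move: H2; rewrite qΨ Hrl.
suff H n : n <= N0 -> DA · Z · n = DA · (Dec · (y · i)) · n by move=> n nN; apply: same (H _ nN).
move: n; apply: d_induction; first by char1.
  by rewrite !DA0.
move=> n IH /dleS nN; have nN' : n <= N0 by left.
by rewrite !DAS (IH nN') (same _ nN' (IH nN')).
Qed.

(** * Transfinite recursion *)

Section TransfiniteRecursion.
Variable M : arith_model.
Implicit Types (a b i j m n : M ty0) (f p X Y Z : M ty1).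

Variables (E : M ty2) (G : M (ty0 ⇒ ty1 ⇒ ty0)%ty) (X : M ty1).
Hypothesis HE : forall f, E · f = 0 <-> exists n, f · n = 0.

Definition below_in i j : Prop := X · (Pair M · i · j) = 1 /\ ~ X · (Pair M · j · i) = 1.

Hypothesis X_trans : forall a b c,
  X · (Pair M · a · b) = 1 -> X · (Pair M · b · c) = 1 -> X · (Pair M · a · c) = 1.
Hypothesis X_wf : ~ exists f, forall n, below_in (f · (n + 1)) (f · n).

Lemma below_in_trans a b c : below_in a b -> below_in b c -> below_in a c.
Proof.
move=> [ab nba] [bc ncb]; split; first exact: X_trans ab bc.
by move=> ca; apply: ncb; apply: X_trans ca ab.
Qed.

(** Iterating a chosen predecessor would give a descending sequence of levels. QF-AC chooses for
    arguments of type 1, so a number enters as the constant function [kc · n] and is read back at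
    0. *)
Lemma no_descent p : (forall n, p · n = 0 ->
    exists n', p · n' = 0 /\ below_in (Snd M · n') (Snd M · n)) -> forall n, p · n <> 0.
Proof.
move=> Hp n0 Hn0; apply: X_wf.
have [s Hs] : exists s : M ty2, forall x, p · (x · 0) = 0 ->
    p · (s · x) = 0 /\ below_in (Snd M · (s · x)) (Snd M · (x · 0)).
  apply: (QFAC10 (P := fun x y => p · (x · 0) = 0 ->
    p · y = 0 /\ below_in (Snd M · y) (Snd M · (x · 0)))).
    by rewrite /below_in; char2.
  move=> x; have [/Hp [y Hy]|nx] := pselect (p · (x · 0) = 0); first by exists y.
  by exists 0.
have [kc Hkc] : exists kc : M (ty0 ⇒ ty1)%ty, forall n i, kc · n · i = n by def2.
have [id Hid] : exists id : M ty1, forall s, id · s = s by def1.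
have [h Hh] : exists h : M (ty0 ⇒ ty0 ⇒ ty0 ⇒ ty0)%ty, forall x n v,
    h · x · n · v = s · (kc · v) by def3.
have [R HR] := d_recursion id h.
have R0 : R · n0 · 0 = n0 by rewrite (HR n0).1 Hid.
have RS n : R · n0 · (n + 1) = s · (kc · (R · n0 · n)) by rewrite (HR n0).2 Hh.
have pR n : p · (R · n0 · n) = 0.
  move: n; apply: d_induction; first by char1.
    by rewrite R0.
  by move=> n IH; rewrite RS; have [] := Hs (kc · (R · n0 · n)); rewrite ?Hkc.
have [f Hf] : exists f, forall n, f · n = Snd M · (R · n0 · n) by def1.
exists f => n; rewrite !Hf RS.
by have [] := Hs (kc · (R · n0 · n)); rewrite ?Hkc.
Qed.

(* The restriction of [Y] to the levels below [j], where [n] has level [Snd n] *)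
Variable In : M (ty1 ⇒ ty0 ⇒ ty1)%ty.
Hypothesis In_char : forall Y j, is_char (In · Y · j).
Hypothesis InE : forall Y j n, In · Y · j · n = 1 <->
  Pair M · (Fst M · n) · (Snd M · n) = n /\ below_in (Snd M · n) j /\ Y · n = 1.

(** The right-hand side of the recursion at [n = (m, j)], with [G] deciding [θ(m, Y^j)]. Pairing is
    not surjective, so the first conjunct says that [n] is a pair. *)
Definition correct Y n : Prop :=
  Pair M · (Fst M · n) · (Snd M · n) = n /\ X · (Pair M · (Snd M · n) · (Snd M · n)) = 1 /\
  G · (Fst M · n) · (In · Y · (Snd M · n)) = 0.

Definition wrong Y n : Prop := ~ (Y · n = 1 <-> correct Y n).

Definition first_wrong Y n : Prop :=
  wrong Y n /\ forall n', below_in (Snd M · n') (Snd M · n) -> ~ wrong Y n'.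

Lemma char_ext Y Z : is_char Y -> is_char Z -> (forall n, Y · n = 1 <-> Z · n = 1) -> Y = Z.
Proof.
move=> HY HZ EYZ; apply: (app_ext (am_normal M)) => n.
have [Yn|Yn] := bit_cases (HY n); have [Zn|Zn] := bit_cases (HZ n); rewrite Yn Zn //.
- by have /EYZ := Zn; rewrite Yn => /esym /done_neq0.
- by have /EYZ := Yn; rewrite Zn => /esym /done_neq0.
Qed.

Lemma In_ext Y Z j : (forall n, below_in (Snd M · n) j -> Y · n = 1 <-> Z · n = 1) ->
  In · Y · j = In · Z · j.
Proof.
move=> EYZ; apply: char_ext => // n; rewrite !InE.
by split=> -[pn [nj Hn]]; do 2 split=> //; apply/EYZ.
Qed.

(** Below the level of [n] both sets obey the recursion. A minimal disagreement [a] there is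
    impossible: both values at [a] are computed from the restrictions below the level of [a], which
    coincide. *)
Lemma first_wrong_In Y Z n : first_wrong Y n -> first_wrong Z n ->
  In · Y · (Snd M · n) = In · Z · (Snd M · n).
Proof.
move=> [_ HY] [_ HZ]; apply: In_ext.
have [p Hp] : exists p, forall a, p · a = 0 <->
    below_in (Snd M · a) (Snd M · n) /\ ~ (Y · a = 1 <-> Z · a = 1).
  by rewrite /below_in; char1.
move=> a an; apply: contrapT => ne; apply: (@no_descent p _ a); last exact/Hp.
move=> {an ne}a /Hp [an ne]; apply: contrapT => no; apply: ne.
have /contrapT -> := HY a an; have /contrapT -> := HZ a an.
rewrite /correct (In_ext (Z := Z)) // => b ba; apply: contrapT => ne; apply: no.
by exists b; split=> //; apply/Hp; split=> //; apply: below_in_trans ba an.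
Qed.

Lemma recursion_exists : sat HBU (enil : env M []) ->
  exists2 Y, is_char Y & forall n, Y · n = 1 <-> correct Y n.
Proof.
move=> HB; apply: contrapT => none.
have [cw Hcw] : exists cw : M (ty1 ⇒ ty0 ⇒ ty0)%ty, forall Y n, cw · Y · n = 0 <-> wrong Y n.
  by rewrite /wrong /correct; char2.
(* With [E] applied to [q], the absence of a wrong element at lower levels becomes quantifier-free,
   so QF-AC can select a first wrong element. *)
have [q Hq] : exists q : M (ty1 ⇒ ty0 ⇒ ty0 ⇒ ty0)%ty, forall Y n n',
    q · Y · n · n' = 0 <-> below_in (Snd M · n') (Snd M · n) /\ wrong Y n'.
  by rewrite /below_in; char3.
have [N HN] : exists N : M ty2, forall Y, first_wrong Y (N · Y).
  have [N HN] : exists N : M ty2, forall Y, wrong Y (N · Y) /\ ~ E · (q · Y · (N · Y)) = 0.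
    apply: (QFAC10 (P := fun Y n => wrong Y n /\ ~ E · (q · Y · n) = 0)); first by char2.
    move=> Y; apply: contrapT => nomin.
    have right_Y n : ~ wrong Y n.
      move=> /Hcw; apply: no_descent => {}n /Hcw Hn; apply: contrapT => no; apply: nomin.
      exists n; split=> // /HE [n' /Hq [n'n Hn']]; apply: no; exists n'; split=> //.
      exact/Hcw.
    (* [none] speaks of characteristic functions, so [Y] is replaced by the one with the same
       members; its restrictions are unchanged. *)
    have [Y' HY' EY] := char_of Y; apply: none; exists Y' => // n.
    have EIn j : In · Y' · j = In · Y · j by apply: In_ext.
    rewrite EY /correct EIn; exact: contrapT (right_Y n).
  exists N => Y; have [HNY HNE] := HN Y; split=> // n' Hn' Hw; apply: HNE.
  by apply/HE; exists n'; apply/Hq.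
have [k [Y [HY Hcov]]] := cantor_cover HE HB N.
have [r Hr] : exists r : M (ty0 ⇒ ty0 ⇒ ty0)%ty, forall n i, r · n · i = 0 <->
    i < k /\ N · (Y · i) = n /\ correct (Y · i) n.
  by rewrite /correct; char2.
have [Z HZ] : exists Z, forall n, Z · n = 1 - E · (r · n) by def1.
have [|i ik Hi] := Hcov Z; first by move=> n; rewrite HZ; apply: bit_le1.
have [Hw _] := HN (Y · i); apply: Hw.
(* The neighbourhood fixes the values up to and including [N · (Y · i)], the very place where [Z]
   takes the correct value and [Y · i] the wrong one. *)
rewrite -Hi; last exact: dle_refl.
rewrite HZ bit_eq1 HE; split=> [[i' /Hr [_ [Ei' Hi']]]|Hc]; last by exists i; apply/Hr.
move: Hi'; rewrite /correct.
have := HN (Y · i'); rewrite Ei' => H'.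
(* Another index [i'] may have put [n] into [Z], but it has the same first wrong element and hence
   the same correct value there. *)
by rewrite (first_wrong_In H' (HN _)).
Qed.

End TransfiniteRecursion.

(** * Truth of the recursion formulas in a model *)

Section Soundness.
Variable M : arith_model.
Implicit Types (i j n : M ty0).

Definition linear_order (X : M ty1) : Prop :=
  [/\ forall i j, X · (Pair M · i · j) = 1 -> X · (Pair M · i · i) = 1 /\ X · (Pair M · j · j) = 1,
      forall i j k, X · (Pair M · i · j) = 1 -> X · (Pair M · j · k) = 1 -> X · (Pair M · i · k) = 1,
      forall i j, X · (Pair M · i · j) = 1 -> X · (Pair M · j · i) = 1 -> i = j &
      forall i j, X · (Pair M · i · i) = 1 -> X · (Pair M · j · j) = 1 ->
        X · (Pair M · i · j) = 1 \/ X · (Pair M · j · i) = 1].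

Section Formulas.
Variables (Γ : ctx) (ρ : env M Γ).

Lemma sat_All2 σ τ A : sat (All σ (All τ A)) ρ <->
  forall (a : M σ) (b : M τ), sat A (econs b (econs a ρ)).
Proof. by []. Qed.

Lemma sat_All3 σ τ υ A : sat (All σ (All τ (All υ A))) ρ <->
  forall (a : M σ) (b : M τ) (c : M υ), sat A (econs c (econs b (econs a ρ))).
Proof. by []. Qed.

Lemma sat_pair_mem s t X :
  sat (mem (pair s t) X) ρ <-> eval ρ X · (Pair M · eval ρ s · eval ρ t) = 1.
Proof. by rewrite sat_mem eval_pair. Qed.

Lemma sat_lt_in X s t : sat (lt_in X s t) ρ <-> below_in (eval ρ X) (eval ρ s) (eval ρ t).
Proof. by rewrite /lt_in sat_And sat_Neg !sat_pair_mem. Qed.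
End Formulas.

Lemma sat_LO Γ (ρ : env M Γ) X : sat (LO X) ρ <-> linear_order (eval ρ X).
Proof.
rewrite /LO /le_in /in_field; cbv zeta; rewrite 3!sat_And; split.
- move=> [/sat_All2 H1 [/sat_All3 H2 [/sat_All2 H3 /sat_All2 H4]]]; split.
  + by move=> i j; have := H1 i j; rewrite sat_Imp sat_And !sat_pair_mem !eval_wk.
  + by move=> i j k; have := H2 i j k; rewrite 2!sat_Imp !sat_pair_mem !eval_wk.
  + by move=> i j; have := H3 i j; rewrite 2!sat_Imp !sat_pair_mem sat_Eq !eval_wk.
  + by move=> i j; have := H4 i j; rewrite 2!sat_Imp sat_Or !sat_pair_mem !eval_wk.
- move=> [H1 H2 H3 H4]; split; [|split; [|split]].
  + by apply/sat_All2 => i j; rewrite sat_Imp sat_And !sat_pair_mem !eval_wk; apply: H1.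
  + by apply/sat_All3 => i j k; rewrite 2!sat_Imp !sat_pair_mem !eval_wk; apply: H2.
  + by apply/sat_All2 => i j; rewrite 2!sat_Imp !sat_pair_mem sat_Eq !eval_wk; apply: H3.
  + by apply/sat_All2 => i j; rewrite 2!sat_Imp sat_Or !sat_pair_mem !eval_wk; apply: H4.
Qed.

Lemma sat_WO Γ (ρ : env M Γ) X : sat (WO X) ρ <-> linear_order (eval ρ X) /\
  ~ exists f : M ty1, forall n, below_in (eval ρ X) (f · (n + 1)) (f · n).
Proof.
rewrite /WO sat_And sat_LO sat_Neg sat_Ex.
split=> -[HL HW]; (split; [by []|move=> [f Hf]; apply: HW; exists f]).
- by apply/sat_All => n; rewrite sat_lt_in !eval_wk; apply: Hf.
- by move=> n; have /sat_All/(_ n) := Hf; rewrite sat_lt_in !eval_wk.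
Qed.

Lemma sat_is_initial Γ (ρ : env M Γ) X Y (j : tm Γ ty0) Z : sat (is_initial X Y j Z) ρ <->
  forall n, eval ρ Z · n = 1 <-> exists m i, n = Pair M · m · i /\
    below_in (eval ρ X) i (eval ρ j) /\ eval ρ Y · n = 1.
Proof.
rewrite /is_initial sat_All; apply: forall_iff => n; rewrite sat_Iff sat_mem eval_wk sat_Ex.
have E : (exists a : M ty0, sat (Ex ty0 ((#2 ≐ pair #1 #0)%fm ∧
      lt_in (wk (wk (wk X))) #0%tm (wk (wk (wk j))) ∧ mem #2%tm (wk (wk (wk Y)))))%fm
      (econs a (econs n ρ))) <->
    exists m i, n = Pair M · m · i /\ below_in (eval ρ X) i (eval ρ j) /\ eval ρ Y · n = 1.
  apply: exists_iff => m; rewrite sat_Ex; apply: exists_iff => i.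
  by rewrite 2!sat_And sat_Eq eval_pair sat_lt_in sat_mem !eval_wk.
by rewrite E.
Qed.

Lemma sat_theta_at Γ (θ : fm (ty1 :: ty0 :: Γ)) Δ (s : sub Γ Δ) (ρ : env M Δ) (m j : tm Δ ty0) X Y :
  sat (theta_at θ s m X Y j) ρ <-> exists2 Z : M ty1, is_char Z &
    (forall n, Z · n = 1 <-> exists m i, n = Pair M · m · i /\
      below_in (eval ρ X) i (eval ρ j) /\ eval ρ Y · n = 1) /\
    sat θ (econs Z (econs (eval ρ m) (fun τ x => eval ρ (s τ x)))).
Proof.
rewrite /theta_at sat_ExSet.
have EE Z : sat (fsub θ (scons #0%tm (scons (wk m) (fun τ x => wk (s τ x))))) (econs Z ρ) <->
    sat θ (econs Z (econs (eval ρ m) (fun τ x => eval ρ (s τ x)))).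
  rewrite sat_fsub; suff -> : (fun τ x => eval (econs Z ρ) (scons #0%tm (scons (wk m) (fun τ x => wk (s τ x))) x)) =
    econs Z (econs (eval ρ m) (fun τ x => eval ρ (s τ x))) by [].
  by apply: sub_cons_ext => //; apply: var_cons_ind => [|τ x] /=; rewrite eval_wk.
split=> -[Z HZ].
  by rewrite sat_And sat_is_initial !eval_wk EE; exists Z.
by move=> HZ'; exists Z => //; rewrite sat_And sat_is_initial !eval_wk EE.
Qed.

Lemma TR_sound k Γ (θ : fm (ty1 :: ty0 :: Γ)) : Pi1 k.+1 θ ->
  is_model M (Pi1CA0w_HBU k.+1) -> forall ρ : env M Γ, sat (TR θ) ρ.
Proof.
move=> Hθ HM ρ.
have HB : sat HBU (enil : env M []) by apply: HM; apply: CAH_HBU.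
have [S HS] : exists S : M ty2, forall f, S · f = 0 <-> kleene_true QEx k.+1 f [].
  have /sat_Ex [S] := HM _ _ (CAH_CA (@CA_Sk k.+1 [])) enil.
  rewrite sat_And => -[_ /sat_All HS]; exists S => f.
  by have := HS f; rewrite sat_Iff sat_kleene sat_Eq => <-.
have [E HE] := ex_functional HS.
have [μ Hμ] := choice_functional HE.
have [G HG] := Pi1_decision HE Hμ HS Hθ ρ.
rewrite /TR sat_AllSet => X HX; rewrite sat_Imp sat_WO => -[HLO HWO].
have [In' HIn'] : exists c : M (ty1 ⇒ ty0 ⇒ ty0 ⇒ ty0)%ty, forall Y j n, c · Y · j · n = 0 <->
    Pair M · (Fst M · n) · (Snd M · n) = n /\ below_in X (Snd M · n) j /\ Y · n = 1.
  by rewrite /below_in; char3.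
have [In HIn] : exists In : M (ty1 ⇒ ty0 ⇒ ty1)%ty, forall Y j n,
    In · Y · j · n = 1 - In' · Y · j · n by def3.
have In_char Y j : is_char (In · Y · j) by move=> n; rewrite HIn; apply: bit_le1.
have InE Y j n : In · Y · j · n = 1 <->
    Pair M · (Fst M · n) · (Snd M · n) = n /\ below_in X (Snd M · n) j /\ Y · n = 1.
  by rewrite HIn bit_eq1 HIn'.
have X_trans : forall a b c, X · (Pair M · a · b) = 1 -> X · (Pair M · b · c) = 1 ->
  X · (Pair M · a · c) = 1 by case: HLO.
have [Y HY EY] := recursion_exists G HE X_trans HWO In_char InE HB.
apply/sat_ExSet; exists Y => //; rewrite /H_ sat_And sat_LO sat_All; split=> // n.
rewrite sat_Iff sat_mem eval_wk -[eval _ #0%tm]/(Y : M ty1) EY sat_Ex.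
set P := (X in _ <-> X).
suff -> : P <-> exists m j, n = Pair M · m · j /\ X · (Pair M · j · j) = 1 /\
    G · m · (In · Y · j) = 0.
  rewrite /correct; split=> [Hc|[m [j [-> Hc]]]]; last by rewrite Fst_Pair Snd_Pair.
  by exists (Fst M · n), (Snd M · n); move: Hc => [En Hc]; rewrite En.
apply: exists_iff => m; rewrite sat_Ex; apply: exists_iff => j; cbv zeta.
rewrite 2!sat_And sat_Eq eval_pair sat_pair_mem sat_theta_at HG !eval_wk.
(* The set quantified in [theta_at] is unique, namely [In · Y · j]; so that formula says exactly
   what [G] decides in [correct]. *)
have init_In Z : is_char Z -> (forall n, Z · n = 1 <-> exists m i, n = Pair M · m · i /\
    below_in X i j /\ Y · n = 1) <-> Z = In · Y · j.
  move=> HZ; have HIni a : In · Y · j · a = 1 <-> exists m i, a = Pair M · m · i /\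
      below_in X i j /\ Y · a = 1.
    rewrite InE; split=> [[E1 H]|[p [i [-> H]]]]; last by rewrite Fst_Pair Snd_Pair.
    by exists (Fst M · a), (Snd M · a).
  by split=> [H|-> //]; apply: char_ext => // a; rewrite H HIni.
split=> -[En [Hj H]]; (split; [exact: En|split; [exact: Hj|]]).
  by case: H => Z HZ [/(init_In Z HZ) -> Hθ'].
by exists (In · Y · j) => //; split=> //; apply/init_In.
Qed.

End Soundness.

Local Close Scope dom_scope.

Theorem theorem4p25 :
  forall k : nat, (1 <= k)%coq_nat ->
  forall (Γ : ctx) (θ : fm (ty1 :: ty0 :: Γ)), Pi1 k θ ->
  proves (Pi1CA0w_HBU k) (TR θ).
Proof.
move=> [|k] lek Γ θ Hθ; first by inversion lek.
apply: normal_completeness.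
- by move=> Γ' Δ A s HA; apply: Pi1CA0w_HBU_fsub.
- by move=> Γ' A HA; do 2 constructor.
move=> M NM HM ρ.
have HR : is_model M RCA0w by move=> Γ' A HA; apply: HM; do 2 constructor.
exact: (@TR_sound (ArithModel NM HR) k).
Qed.
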